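(* Let $(\xi_k)_{k\in\mathbb{Z}}$ be i.i.d. real random variables with $\mathbb{E}\xi_0=0$, $\mathbb{E}\xi_0^2>0$ and $\mathbb{E}e^{\alpha\xi_0^2}<\infty$ for some $\alpha>0$. Let $(\theta_n)_{n\ge1}$ satisfy $\theta_n\in[0,1)$ and $\theta_n\to1$, and let $(b_n)_{n\ge 1}$ be positive numbers with $b_n\to\infty$ and $\frac{\sqrt n(1-\theta_n)^2}{b_n}\to\infty$. Let $X_{k,n}$ be the stationary autoregressive process with coefficient $\theta_n$ and noise $(\xi_k)$, and let $\hat\theta_n$ and $\tilde\theta_n$ be the least squares and Yule-Walker estimators of $\theta_n$ (all defined in the context). Then for any $r>0$, $$\lim_{n\to\infty}\frac{1}{b_n^2}\log\mathbb{P}\left(\frac{\sqrt n}{b_n(1-\theta_n^2)^{1/2}}\left|\hat\theta_n-\theta_n\right|\ge r\right)=-\frac{r^2}{2}$$ and $$\lim_{n\to\infty}\frac{1}{b_n^2}\log\mathbb{P}\left(\frac{\sqrt n}{b_n(1-\theta_n^2)^{1/2}}\left|\tilde\theta_n-\theta_n\right|\ge r\right)=-\frac{r^2}{2}.$$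
   Context: For every $n\ge1$, $X_{k,n}=\sum_{p=0}^\infty\theta_n^p\xi_{k-p}$ for $k\ge0$ (with $0^0=1$); this is the stationary solution of $X_{k,n}=\theta_nX_{k-1,n}+\xi_k$. The least squares estimator is $$\hat\theta_n=\frac{\sum_{k=1}^nX_{k,n}X_{k-1,n}}{\sum_{k=1}^nX_{k-1,n}^2},$$ and the Yule-Walker estimator is $$\tilde\theta_n=\frac{\sum_{k=1}^nX_{k,n}X_{k-1,n}}{\sum_{k=0}^nX_{k,n}^2}.$$ *)

(* Defs.v *)
From HB Require Import structures.
From mathcomp Require Export all_boot all_order all_algebra finmap.
From mathcomp Require Export all_classical all_reals all_analysis.
Set Implicit Arguments.
Unset Strict Implicit.
Unset Printing Implicit Defensive.
Export Order.TTheory GRing.Theory Num.Theory numFieldNormedType.Exports.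

Local Open Scope classical_set_scope.
Local Open Scope ring_scope.

Definition mutually_independent {d : measure_display} {T : measurableType d}
    {R : realType} (P : probability T R) {I : choiceType}
    (X : I -> {RV P >-> R}) : Prop :=
  forall (J : {fset I}) (A : I -> set R),
    (forall i, i \in J -> measurable (A i)) ->
    P (\bigcap_(i in [set` J]) X i @^-1` A i) =
    (\prod_(i <- J) P (X i @^-1` A i))%E.

(* The two laws are compared on measurable sets only: as functions on all
   subsets of R they may differ on sets where a measure has no meaning. *)
Definition identically_distributed {d : measure_display} {T : measurableType d}
    {R : realType} (P : probability T R) {I : Type}
    (X : I -> {RV P >-> R}) : Prop :=
  forall (i j : I) (A : set R), measurable A ->
    distribution P (X i) A = distribution P (X j) A.

Section Estimators.
Context {R : realType} {T : Type}.

(* The pointwise limit of the partial sums.  Under the assumptions of the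
   theorem the series converges almost surely; where it diverges, [lim] takes
   the default value of its type.  By convention, 0 ^+ 0 = 1. *)
Definition ar_process (theta : R) (xi : int -> T -> R) (k : nat) (w : T) : R :=
  limn (series (fun p : nat => theta ^+ p * xi (k%:Z - p%:Z) w)).

(* Division by 0 yields 0; the denominators of both estimators vanish with
   probability 0 as soon as 0 < theta < 1 and the noise is not degenerate. *)
Definition least_squares (X : nat -> T -> R) (n : nat) (w : T) : R :=
  (\sum_(1 <= k < n.+1) X k w * X k.-1 w) /
  (\sum_(1 <= k < n.+1) X k.-1 w ^+ 2).

Definition yule_walker (X : nat -> T -> R) (n : nat) (w : T) : R :=
  (\sum_(1 <= k < n.+1) X k w * X k.-1 w) /
  (\sum_(0 <= k < n.+1) X k w ^+ 2).

End Estimators.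

(* Main.v *)
From HB Require Import structures.
Require Import Defs.
From mathcomp Require Import all_boot all_order all_algebra finmap.
From mathcomp Require Import all_classical all_reals all_analysis.
From mathcomp Require Import measurable_realfun ring lra.
Set Implicit Arguments.
Unset Strict Implicit.
Unset Printing Implicit Defensive.
Import Order.TTheory GRing.Theory Num.Theory numFieldNormedType.Exports.

Local Open Scope classical_set_scope.
Local Open Scope ring_scope.

(** Write [rho = 1 - theta], [s2] for the variance of the noise,
    [M = \sum_k X_{k-1} xi_k] and [S = \sum_k X_{k-1}^2].  The errors of the least
    squares and Yule-Walker estimators are [M / S] and
    [(M - theta X_n^2) / (S + X_n^2)].  Squaring the recursion and summing gives
    [(1 - theta^2) S = \sum_k xi_k^2 + 2 theta M + X_0^2 - X_n^2], so [S] is close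
    to [n s2 / (1 - theta^2)] as soon as [M / n] and the endpoints are small.
    Everything reduces to the martingale [M], normalized so that its limiting
    rate function is [x^2 / 2].

    Let [Lam] be the logarithm of the Laplace transform of the noise.  Averaging
    over one noise variable at a time shows that
    [exp (lam M - \sum_k Lam (lam X_{k-1}))] has mean one
    ([exponential_martingale]).  Near 0, [Lam s] is close to [s2 s^2 / 2], so for
    the tilts [lam] of interest the compensator is close to
    [lam^2 s2 S / 2 = t^2 b^2 / 2], a constant.  The error comes from the times
    when [X] is large.  Convexity of the squared excess over a level turns it into
    a sum of squared excesses of the noise over [rho] times that level, which are
    i.i.d. and extremely rare ([sum_excess_le], [noise_excess_tail]).  No union
    bound over times is used, because [b] may grow arbitrarily slowly compared
    to the logarithm of [n].

    On a good event the exponential moments of the normalized martingale are thus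
    [exp (b^2 (t^2 / 2 + o(1)))].  Chernoff's inequality gives the upper bound
    ([normalized_upper]).  For the lower bound, tilting by [t] concentrates the
    martingale near [t], which is seen by comparing with the tilts [t - del] and
    [t + del] ([normalized_lower]).

    The complement of the good event must be negligible under the tilted measure
    too.  By the Cauchy-Schwarz inequality this follows when its probability is
    below [exp (- D b^2 / rho)] for every [D], because the squared density has
    mean at most [exp (C b^2 / rho)]: indeed [S] is at most of order
    [rho^-2 \sum_k xi_k^2], again by convexity ([crude_mgf], [tilted_square]).
    The assumption that [sqrt n rho^2 / b] tends to infinity makes all exceptional
    events that rare ([good_prob]).

    All estimates are stated for fixed [theta], [b] and [n] in a [regime], a
    quantitative form of the assumptions, and the limit is taken at the end. *)

(** * Events determined by the past of the noise *)

Section Past.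
Context {d : measure_display} {T : measurableType d} {R : realType}
  (P : probability T R) (xi : int -> {RV P >-> R}).

Definition past_cylinders (k : int) : set (set T) :=
  [set C | exists (J : {fset int}) (A : int -> set R),
    [/\ forall i, i \in J -> i <= k, forall i, measurable (A i) &
        C = \bigcap_(i in [set` J]) xi i @^-1` A i]].

(** The sample space equipped with the sigma-algebra generated by the noise up
    to time [k]: a function is measurable from [past k] when it is determined by
    that noise. *)
Definition past (k : int) := g_sigma_algebraType (past_cylinders k).

Lemma past_cylinders_setI k : setI_closed (past_cylinders k).
Proof.
move=> _ _ [J [A [Jk mA ->]]] [J' [A' [J'k mA' ->]]].
pose B i := (if i \in J then A i else setT) `&` (if i \in J' then A' i else setT).
exists (J `|` J')%fset, B; split.
- by move=> i; rewrite in_fsetU => /orP[/Jk|/J'k].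
- by move=> i; rewrite /B; apply: measurableI; case: ifP.
- apply/seteqP; split => [w [h h'] i /=|w h].
    by move=> _; split; case: ifP => // iJ; [exact: h|exact: h'].
  split => i /= iJ.
    by have := h i; rewrite /= in_fsetU iJ => /(_ isT)[]; rewrite iJ.
  by have := h i; rewrite /= in_fsetU iJ orbT => /(_ isT)[_]; rewrite iJ.
Qed.

Lemma past_cylinders_measurable k : past_cylinders k `<=` measurable.
Proof.
move=> _ [J [A [_ mA ->]]]; apply: fin_bigcap_measurable => // i _.
exact: measurable_funPTI.
Qed.

Lemma past_measurable k (A : set T) :
  measurable (A : set (past k)) -> measurable A.
Proof.
move: A; apply: smallest_sub; last exact: past_cylinders_measurable.
exact: sigma_algebra_measurable.
Qed.

Lemma past_measurable_fun k (f : T -> R) :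
  measurable_fun setT (f : past k -> R) -> measurable_fun setT f.
Proof.
by move=> mf _ B mB; apply: (@past_measurable k); exact: mf.
Qed.

Lemma past_measurable_noise k i : i <= k ->
  measurable_fun setT (xi i : past k -> R).
Proof.
move=> ik _ B mB; rewrite setTI; apply: sub_sigma_algebra.
exists [fset i]%fset, (fun=> B); split => //.
  by move=> j; rewrite in_fset1 => /eqP ->.
by rewrite set_fset1 bigcap_set1.
Qed.

Lemma past_incl k k' (f : T -> R) : k <= k' ->
  measurable_fun setT (f : past k -> R) -> measurable_fun setT (f : past k' -> R).
Proof.
move=> kk' mf _ B mB; have := mf measurableT B mB.
apply: sub_sigma_algebra2 => _ [J [A [Jk mA ->]]].
by exists J, A; split => // i /Jk /le_trans; apply.
Qed.

Hypothesis xi_indep : mutually_independent xi.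

(** On a cylinder the product rule is the assumed independence, for the index
    set of the cylinder enlarged by [k + 1].  Cylinders are stable under
    intersection, so Dynkin's induction carries the rule to the whole past. *)
Lemma past_indep k (A : set T) (B : set R) :
  measurable (A : set (past k)) -> measurable B ->
  P (A `&` xi (k + 1) @^-1` B) = (P A * P (xi (k + 1) @^-1` B))%E.
Proof.
move=> mA mB; move: A mA.
have mC : measurable (xi (k + 1) @^-1` B) by exact: measurable_funPTI.
set C := xi (k + 1) @^-1` B in mC *.
have Cfin : P C \is a fin_num by exact: fin_num_measure.
have compl (A : set T) : measurable A -> P (A `&` C) = (P A * P C)%E ->
    P (~` A `&` C) = (P (~` A) * P C)%E.
  move=> mA PA; have -> : ~` A `&` C = C `\` A by rewrite setIC.
  rewrite measureD//; last by rewrite ltey_eq Cfin.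
  rewrite [X in (_ - X)%E](_ : _ = P A * P C)%E; last by rewrite setIC -PA.
  rewrite probability_setC// muleBl//.
  by rewrite mul1e.
have union (F : (set T)^nat) : (forall n, measurable (F n)) ->
    trivIset [set: nat] F -> (forall n, P (F n `&` C) = (P (F n) * P C)%E) ->
    P (\bigcup_n F n `&` C) = (P (\bigcup_n F n) * P C)%E.
  move=> mF tF PF; rewrite setI_bigcupl.
  rewrite measure_bigcup//; last 2 first.
    by move=> n _; exact: measurableI.
    exact: trivIset_setIr.
  rewrite measure_bigcup// -(fineK Cfin) muleC -nneseriesZl//.
  by apply: eq_eseriesr => n _; rewrite (fineK Cfin) muleC; exact: PF.
apply: (@dynkin_induction _ (past k) (past_cylinders k)
  (fun A => P (A `&` C) = (P A * P C)%E)) => //.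
- exact: past_cylinders_setI.
- by rewrite setTI probability_setT mul1e.
- move=> _ [J [A [Jk mA ->]]].
  pose A' i := if i == k + 1 then B else A i.
  have kJ : (k + 1)%R \notin J.
    by apply/negP => /Jk; rewrite gerDl.
  have A'E i : i \in J -> A' i = A i.
    by rewrite /A'; case: eqP => // -> h; rewrite h in kJ.
  have := xi_indep (J := ((k + 1)%R |` J)%fset) (A := A') _.
  have A'k : A' (k + 1) = B by rewrite /A' eqxx.
  rewrite big_fsetU1//= A'k.
  have -> : (\prod_(i <- J) P (xi i @^-1` A' i) =
     \prod_(i <- J) P (xi i @^-1` A i))%E.
    by apply: eq_big_seq => i /A'E ->.
  rewrite -(xi_indep (A := A)); last by move=> i _; exact: mA.
  rewrite -/C [X in P X](_ : _ =
    \bigcap_(i in [set` J]) xi i @^-1` A i `&` C); last first.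
    apply/seteqP; split => w.
      move=> h; split; last first.
        by have := h (k + 1)%R; rewrite /= in_fsetU in_fset1 eqxx /A' eqxx; apply.
      move=> i /= iJ; rewrite -A'E//.
      by apply: h; rewrite /= in_fsetU iJ orbT.
    move=> [h h'] i /=; rewrite in_fsetU in_fset1 /A' => /orP[/eqP ->|iJ].
      by rewrite eqxx.
    by rewrite -/(A' i) A'E//; exact: h.
  move=> ->; first by rewrite muleC.
  by move=> i _; rewrite /A'; case: ifP.
- by move=> A /past_measurable mA PA; exact: compl.
- move=> F mF tF PF; apply: union => // n.
  exact: past_measurable (mF n).
Qed.

End Past.

(** * Integrating out one noise variable *)

Section OneStep.
Context {d : measure_display} {T : measurableType d} {R : realType}
  (P : probability T R) (xi : int -> {RV P >-> R}).
Hypothesis xi_indep : mutually_independent xi.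
Hypothesis xi_ident : identically_distributed xi.

Lemma integral_prob_cst (c : \bar R) : (\int[P]_w c = c)%E.
Proof.
rewrite integral_cst// (_ : _ setT = 1%E) ?mule1//; exact: probability_setT.
Qed.

Lemma integral_noise i (h : R -> \bar R) :
  measurable_fun setT h -> (forall x, 0 <= h x)%E ->
  (\int[P]_w h (xi i w) = \int[P]_w h (xi 0 w))%E.
Proof.
move=> mh h0.
rewrite -[LHS]/(\int[P]_w (h \o xi i) w)%E -[RHS]/(\int[P]_w (h \o xi 0) w)%E.
rewrite -!ge0_integral_distribution//.
by apply: eq_measure_integral => A mA _; exact: xi_ident.
Qed.

(** The past and the next noise variable have a product law, so the latter can
    be integrated out first.  This replaces conditional expectations: in every
    use below the inner mean [c] is a constant. *)
Lemma integral_one_step k (F Z : T -> R) (g : R * R -> R) (c : \bar R) :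
  measurable_fun setT (F : past xi k -> R) ->
  measurable_fun setT (Z : past xi k -> R) ->
  measurable_fun setT g -> (forall w, 0 <= F w) -> (forall u, 0 <= g u) ->
  (forall z, \int[P]_w (g (z, xi 0 w))%:E = c)%E ->
  (\int[P]_w (F w * g (Z w, xi (k + 1) w))%:E = c * \int[P]_w (F w)%:E)%E.
Proof.
move=> mF mZ mg F0 g0 gc.
have mU : measurable_fun setT ((fun w => (F w, Z w)) : past xi k -> R * R).
  exact/measurable_fun_pairP.
have mU' : measurable_fun setT (fun w => (F w, Z w)).
  by apply/measurable_fun_pairP; split; [exact: past_measurable_fun mF|exact: past_measurable_fun mZ].
have mW : measurable_fun setT (fun w => ((F w, Z w), xi (k + 1) w)).
  by apply/measurable_fun_pairP; split.
pose U : {mfun T >-> (R * R)%type} :=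
  HB.pack (fun w => (F w, Z w)) (isMeasurableFun.Build _ _ _ _ _ mU').
pose W : {mfun T >-> (R * R * R)%type} :=
  HB.pack (fun w => ((F w, Z w), xi (k + 1) w)) (isMeasurableFun.Build _ _ _ _ _ mW).
pose h (v : R * R * R) : \bar R := (`|v.1.1| * g (v.1.2, v.2))%:E.
have mh : measurable_fun setT h.
  apply/measurable_EFinP; apply: measurable_funM.
    apply: measurableT_comp => //.
    by apply: measurableT_comp => //; exact: measurableT_comp.
  apply: (measurableT_comp mg); apply: measurable_fun_pair => //.
  exact: measurableT_comp.
have h0 v : (0 <= h v)%E by rewrite lee_fin mulr_ge0.
have c0 : (0 <= c)%E.
  by rewrite -(gc 0); apply: integral_ge0 => w _; rewrite lee_fin.
have -> : (\int[P]_w (F w * g (Z w, xi (k + 1) w))%:E = \int[P]_w (h \o W) w)%E.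
  by apply: eq_integral => w _; rewrite /h /= ger0_norm.
rewrite -ge0_integral_distribution//.
rewrite (eq_measure_integral (distribution P U \x distribution P (xi (k + 1)))%E).
  rewrite fubini_tonelli1// /fubini_F.
  rewrite (_ : (fun x => _) = fun u : R * R => (c * `|u.1|%:E)%E).
  rewrite ge0_integral_distribution//=.
  - rewrite ge0_integralZl//.
    + by congr (_ * _)%E; apply: eq_integral => w _; rewrite ger0_norm.
    + apply/measurable_EFinP; apply: measurableT_comp => //.
      exact: past_measurable_fun mF.
  - apply: measurable_funeM; apply/measurable_EFinP.
    exact: measurableT_comp.
  - by move=> u; rewrite mule_ge0.
  apply/funext => u; rewrite ge0_integral_distribution//=; last first.
    exact: measurable_fun_pair2.
  rewrite /h/=.
  rewrite [LHS](integral_noise (k + 1) (h := fun x => (`|u.1| * g (u.2, x))%:E)).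
  - under eq_integral do rewrite EFinM.
    rewrite ge0_integralZl//.
    + by rewrite gc muleC.
    + apply/measurable_EFinP.
      by apply: measurableT_comp (measurable_fun_pair2 _ mg) _.
    + by move=> w _; rewrite lee_fin.
  - exact: measurable_fun_pair2 mh.
  - by move=> x; rewrite lee_fin mulr_ge0.
move=> A mA _ /=; apply/esym/product_measure_unique => // B C mB mC.
rewrite -[RHS]/(P (U @^-1` B) * P (xi (k + 1) @^-1` C))%E -past_indep//.
by rewrite -[X in measurable X]setTI; exact: mU.
Qed.

Corollary integral_one_step_prod k (F : T -> R) (h : R -> R) :
  measurable_fun setT (F : past xi k -> R) -> measurable_fun setT h ->
  (forall w, 0 <= F w) -> (forall x, 0 <= h x) ->
  (\int[P]_w (F w * h (xi (k + 1) w))%:E =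
   \int[P]_w (h (xi 0 w))%:E * \int[P]_w (F w)%:E)%E.
Proof.
move=> mF mh F0 h0.
apply: (integral_one_step (Z := F) (g := fun u => h u.2)) => //.
exact: measurableT_comp.
Qed.

End OneStep.

(** * Bounds on the exponential *)

Section ScalarBounds.
Context {R : realType}.
Implicit Types (u x s : R).

Lemma norm_le_of_derive (f df : R -> R) (B u : R) :
  f 0 = 0 -> (forall x, is_derive x 1 f (df x)) ->
  (forall x, `|x| <= `|u| -> `|df x| <= B) -> `|f u| <= B * `|u|.
Proof.
move=> f0 fdf dfB.
have cf (I : interval R) : {within [set` I], continuous f}.
  by apply: derivable_within_continuous => x _; apply: ex_derive.
have [u0|u0] := leP 0 u.
  have [c] := MVT_segment u0 (fun x _ => fdf x) (cf _).
  rewrite in_itv/= => /andP[c0 cu].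
  rewrite f0 !subr0 => ->; rewrite normrM ler_wpM2r//.
  by apply: dfB; rewrite !ger0_norm.
have [c] := MVT_segment (ltW u0) (fun x _ => fdf x) (cf _).
rewrite in_itv/= => /andP[cu c0].
rewrite f0 !sub0r => /(congr1 Num.norm); rewrite normrN => ->.
rewrite normrM normrN ler_wpM2r//.
by apply: dfB; rewrite !ler0_norm ?lerN2 // ltW.
Qed.

Lemma expR_taylor1 u : `|expR u - 1| <= `|u| * expR `|u|.
Proof.
rewrite mulrC.
apply: (@norm_le_of_derive (fun x => expR x - 1) expR); first by rewrite expR0 subrr.
  by move=> x; apply: is_derive_eq; rewrite ?subr0.
move=> x xu; rewrite ger0_norm ?expR_ge0// ler_expR.
exact: le_trans (ler_norm _) xu.
Qed.

(** Each Taylor bound has the previous one as a bound on its derivative. *)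
Lemma expR_taylor2 u : `|expR u - 1 - u| <= `|u| ^+ 2 * expR `|u|.
Proof.
rewrite expr2 -mulrA mulrC.
apply: (@norm_le_of_derive (fun x => expR x - 1 - x) (fun x => expR x - 1)).
- by rewrite expR0 subrr subr0.
- by move=> x; apply: is_derive_eq; rewrite ?subr0.
move=> x xu; apply: le_trans (expR_taylor1 _) _.
by rewrite ler_pM ?expR_ge0// ler_expR.
Qed.

Lemma expR_taylor3 u :
  `|expR u - 1 - u - u ^+ 2 / 2| <= `|u| ^+ 3 * expR `|u|.
Proof.
have -> : `|u| ^+ 3 * expR `|u| = `|u| ^+ 2 * expR `|u| * `|u| by ring.
apply: (@norm_le_of_derive (fun x => expR x - 1 - x - x ^+ 2 / 2)
  (fun x => expR x - 1 - x)).
- by rewrite expR0 subrr subr0 expr0n/= mul0r subr0.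
- move=> x; apply: is_derive_eq.
  rewrite subr0; congr (_ - _ - _).
  by rewrite !scaler0 add0r /GRing.scale/= mulr1; lra.
move=> x xu; apply: le_trans (expR_taylor2 _) _.
by rewrite ler_pM ?expR_ge0 ?exprn_ge0// ?ler_expR// lerXn2r ?nnegrE.
Qed.

(** From [1 + v <= exp v] at [v = u / (n + 1)], raised to the power [n + 1]. *)
Lemma expR_ge_pow (n : nat) u : 0 <= u -> (u / n.+1%:R) ^+ n.+1 <= expR u.
Proof.
move=> u0; rewrite -[in leRHS](divfK (_ : n.+1%:R != 0 :> R) u)//.
rewrite expRM_natr lerXn2r ?nnegrE ?expR_ge0 ?divr_ge0//.
by apply: le_trans (expR_ge1Dx _); rewrite lerDr.
Qed.

End ScalarBounds.

(** * Moments dominated by the exponential moment of the square *)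

Ltac solve_measurable := repeat (first
  [ by []
  | apply: measurable_funD | apply: measurable_funB | apply: measurable_funM
  | apply: measurable_funX | apply: measurable_maxr
  | apply: (measurableT_comp (@measurable_expR _))
  | apply: (measurableT_comp (@measurable_ln _))
  | apply: (measurableT_comp (@normr_measurable _ setT)) ]).

Section NoiseLaw.
Context {d : measure_display} {T : measurableType d} {R : realType}
  (P : probability T R) (X : {RV P >-> R}) (alpha : R).
Hypothesis alpha_gt0 : 0 < alpha.
Hypothesis X_exp : ('E_P[fun w => (expR (alpha * X w ^+ 2))%R] < +oo)%E.

Local Notation mean h := (\int[P]_w (h (X w))).

(** The functions whose moments are finite by domination alone, given the
    exponential moment of the squared noise. *)
Definition square_exp_bounded (h : R -> R) :=
  measurable_fun setT h /\ exists C, forall x, `|h x| <= C * expR (alpha * x ^+ 2).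

Lemma square_exp_integrable (h : R -> R) : square_exp_bounded h ->
  P.-integrable setT (EFin \o (h \o X)).
Proof.
move=> [mh [C hC]].
have mX : measurable_fun setT X by [].
apply: (@le_integrable _ _ _ _ _ _ _ (fun w => (C * expR (alpha * X w ^+ 2))%:E)) => //.
- by apply/measurable_EFinP; exact: measurableT_comp.
- by move=> w _; rewrite /= lee_fin (le_trans (hC _)) ?ler_norm.
under eq_fun do rewrite EFinM.
apply: integrableZl => //; apply/integrableP; split.
  by apply/measurable_EFinP; solve_measurable.
move: X_exp; rewrite unlock; congr (_ < _)%E.
by apply: eq_integral => w _; rewrite gee0_abs// lee_fin expR_ge0.
Qed.

Lemma square_exp_le (h g : R -> R) : measurable_fun setT h ->
  (forall x, `|h x| <= g x) -> square_exp_bounded g -> square_exp_bounded h.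
Proof.
move=> mh hg [_ [C gC]]; split => //; exists C => x.
exact: le_trans (hg _) (le_trans (ler_norm _) (gC _)).
Qed.

Lemma square_expD (h g : R -> R) : square_exp_bounded h -> square_exp_bounded g ->
  square_exp_bounded (fun x => h x + g x).
Proof.
move=> [mh [C hC]] [mg [D gD]]; split; first by solve_measurable.
exists (C + D) => x; rewrite mulrDl; apply: le_trans (ler_normD _ _) _.
exact: lerD.
Qed.

Lemma square_expZ c (h : R -> R) : square_exp_bounded h ->
  square_exp_bounded (fun x => c * h x).
Proof.
move=> [mh [C hC]]; split; first by solve_measurable.
by exists (`|c| * C) => x; rewrite normrM -mulrA ler_wpM2l.
Qed.

Lemma square_exp_exp m : m <= alpha ->
  square_exp_bounded (fun x => expR (m * x ^+ 2)).
Proof.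
move=> ma; split; first by solve_measurable.
exists 1 => x; rewrite mul1r ger0_norm ?expR_ge0// ler_expR.
by rewrite ler_wpM2r// sqr_ge0.
Qed.

Lemma square_exp_expR_norm c : square_exp_bounded (fun x => expR (c * `|x|)).
Proof.
split; first by solve_measurable.
(* the maximum of [c y - alpha y^2] *)
exists (expR (c ^+ 2 / (4 * alpha))) => x.
rewrite ger0_norm ?expR_ge0// -expRD ler_expR -[x ^+ 2]real_normK ?num_real//.
rewrite -subr_ge0.
have -> : c ^+ 2 / (4 * alpha) + alpha * `|x| ^+ 2 - c * `|x| =
   alpha * (`|x| - c / (2 * alpha)) ^+ 2 by field; rewrite gt_eqF.
by rewrite mulr_ge0 ?sqr_ge0// ltW.
Qed.

Lemma square_exp_poly_expR_norm n c :
  square_exp_bounded (fun x => `|x| ^+ n * expR (c * `|x|)).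
Proof.
apply: (square_exp_le (g := fun x => (n.+1%:R ^+ n.+1) * expR ((c + 1) * `|x|) +
  expR (c * `|x|))).
- by solve_measurable.
- move=> x; rewrite normrM normrX normr_id (ger0_norm (expR_ge0 _)).
  have e0 := expR_ge0 (c * `|x|).
  have [x1|x1] := leP `|x| 1.
    rewrite (_ : `|x| ^+ n * _ <= _) //.
    apply: (@le_trans _ _ (expR (c * `|x|))).
      by rewrite ler_piMl// exprn_ile1.
    by rewrite lerDr mulr_ge0 ?exprn_ge0 ?expR_ge0.
  apply: (@le_trans _ _ (n.+1%:R ^+ n.+1 * expR ((c + 1) * `|x|))); last first.
    by rewrite lerDl.
  rewrite mulrDl mul1r expRD (mulrC (expR (c * _))) mulrA ler_wpM2r//.
  apply: (@le_trans _ _ (`|x| ^+ n.+1)).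
    by rewrite exprS ler_peMl ?exprn_ge0// ltW.
  have := expR_ge_pow n (normr_ge0 x).
  by rewrite expr_div_n ler_pdivrMr ?exprn_gt0// mulrC.
- apply: square_expD; last exact: square_exp_expR_norm.
  exact/square_expZ/square_exp_expR_norm.
Qed.

Lemma square_exp_pow n : square_exp_bounded (fun x => x ^+ n).
Proof.
apply: (square_exp_le _ _ (square_exp_poly_expR_norm n 0)).
  by solve_measurable.
by move=> x; rewrite mul0r expR0 mulr1 normrX.
Qed.

Lemma square_exp_cst c : square_exp_bounded (fun=> c).
Proof.
split => //; exists `|c| => x; rewrite ler_peMr// -expR0 ler_expR.
by rewrite mulr_ge0 ?sqr_ge0 ?ltW.
Qed.

Lemma mean_cst c : mean (fun=> c) = c.
Proof.
rewrite Rintegral_cst// (_ : fine _ = 1) ?mulr1//.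
by rewrite (_ : _ setT = 1%E)//; exact: probability_setT.
Qed.

Lemma square_exp_comb (h k : R -> R) c0 c1 c2 : square_exp_bounded h ->
  square_exp_bounded k -> square_exp_bounded (fun x => c0 + c1 * h x + c2 * k x).
Proof.
move=> Bh Bk; apply: square_expD; last exact: square_expZ.
by apply: square_expD; [exact: square_exp_cst|exact: square_expZ].
Qed.

Lemma mean_comb (h k : R -> R) c0 c1 c2 : square_exp_bounded h ->
  square_exp_bounded k ->
  mean (fun x => c0 + c1 * h x + c2 * k x) = c0 + c1 * mean h + c2 * mean k.
Proof.
move=> Bh Bk.
have Bh' := square_expZ c1 Bh; have Bk' := square_expZ c2 Bk.
have Bc := square_exp_cst c0.
rewrite RintegralD//.
- rewrite RintegralD//; first last.
  + exact: square_exp_integrable Bh'.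
  + exact: square_exp_integrable Bc.
  by rewrite mean_cst !RintegralZl//; exact: square_exp_integrable.
- exact: square_exp_integrable (square_expD Bc Bh').
- exact: square_exp_integrable Bk'.
Qed.

(** Moment bounds are obtained by integrating a pointwise bound by an affine
    combination of two dominated functions. *)
Lemma mean_le_comb (g h k : R -> R) c0 c1 c2 : square_exp_bounded g ->
  square_exp_bounded h -> square_exp_bounded k ->
  (forall x, g x <= c0 + c1 * h x + c2 * k x) ->
  mean g <= c0 + c1 * mean h + c2 * mean k.
Proof.
move=> Bg Bh Bk gle; rewrite -mean_comb//.
apply: le_Rintegral => //; first exact: square_exp_integrable.
exact: square_exp_integrable (square_exp_comb c0 c1 c2 Bh Bk).
Qed.

Lemma mean_ge_comb (g h k : R -> R) c0 c1 c2 : square_exp_bounded g ->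
  square_exp_bounded h -> square_exp_bounded k ->
  (forall x, c0 + c1 * h x + c2 * k x <= g x) ->
  c0 + c1 * mean h + c2 * mean k <= mean g.
Proof.
move=> Bg Bh Bk gle; rewrite -mean_comb//.
apply: le_Rintegral => //; last exact: square_exp_integrable.
exact: square_exp_integrable (square_exp_comb c0 c1 c2 Bh Bk).
Qed.

Lemma mean_EFin (h : R -> R) : square_exp_bounded h ->
  (\int[P]_w (h (X w))%:E)%E = (mean h)%:E.
Proof.
by move=> Bh; rewrite fineK//; apply: integrable_fin_num => //;
  exact: square_exp_integrable.
Qed.

End NoiseLaw.

(** * Laplace transforms of the squared noise *)

Section NoiseMoments.
Context {d : measure_display} {T : measurableType d} {R : realType}
  (P : probability T R) (X : {RV P >-> R}) (alpha : R).
Hypothesis alpha_gt0 : 0 < alpha.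
Hypothesis X_exp : ('E_P[fun w => (expR (alpha * X w ^+ 2))%R] < +oo)%E.

Local Notation mean h := (\int[P]_w (h (X w))).
Local Notation seb := (square_exp_bounded alpha).
Local Notation J := (mean (fun x => expR (alpha * x ^+ 2))).
Local Notation s2 := (mean (fun x => x ^+ 2)).

Let a0 : 0 <= alpha. Proof. exact: ltW. Qed.

Let expJ : seb (fun x => expR (alpha * x ^+ 2)).
Proof. exact: square_exp_exp. Qed.

Lemma J_ge0 : 0 <= J.
Proof. by apply: Rintegral_ge0 => w _; exact: expR_ge0. Qed.

(** With [y] the squared noise, [exp (m y) - 1 <= m y exp (m y)], and the factor
    [y exp (m y)] stays integrable because [m] is at most half of [alpha]. *)
Lemma mgf_square m : 0 <= m <= alpha / 2 ->
  (\int[P]_w (expR (m * X w ^+ 2))%:E <= (expR (2 / alpha * J * m))%:E)%E.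
Proof.
move=> /andP[m0 ma].
have mB : seb (fun x => expR (m * x ^+ 2)).
  by apply: square_exp_exp; lra.
rewrite (mean_EFin X_exp mB) lee_fin.
suff : mean (fun x => expR (m * x ^+ 2)) <= 1 + m * (2 / alpha) * J + 0 * J.
  move=> h; apply: le_trans h (le_trans _ (expR_ge1Dx _)).
  by rewrite le_eqVlt; apply/orP; left; apply/eqP; ring.
apply: (mean_le_comb alpha_gt0 X_exp mB expJ expJ).
move=> x; rewrite mul0r addr0; move: (x ^+ 2) (sqr_ge0 x) => y y0.
have h1 : expR (m * y) <= 1 + m * y * expR (m * y).
  have := expR_ge1Dx (- (m * y)); rewrite expRN -div1r ler_pdivlMr ?expR_gt0//.
  by rewrite mulrDl mul1r mulNr lerBlDr.
apply: le_trans h1 _; rewrite lerD2l -!mulrA ler_wpM2l//.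
have h2 : y <= 2 / alpha * expR (alpha / 2 * y).
  rewrite -ler_pdivrMl ?divr_gt0// invf_div.
  by apply: le_trans (expR_ge1Dx _); rewrite lerDr.
apply: (@le_trans _ _ (2 / alpha * expR (alpha / 2 * y) * expR (alpha / 2 * y))).
  apply: ler_pM; rewrite ?expR_ge0 ?ler_expR//.
  exact: ler_wpM2r.
rewrite -[leLHS]mulrA -expRD -mulrDl -splitr.
by rewrite mulrA.
Qed.

Let centered_bounded :
  seb (fun x => (x ^+ 2 - s2) ^+ 2 * expR (alpha / 4 * `|x ^+ 2 - s2|)).
Proof.
apply: (square_exp_le (g := fun x =>
  (64 / alpha ^+ 2 * expR (alpha / 2 * s2)) * expR (alpha * x ^+ 2))).
- by solve_measurable.
- move=> x; rewrite normrM ger0_norm ?sqr_ge0// ger0_norm ?expR_ge0//.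
  have s20 : 0 <= s2 by apply: Rintegral_ge0 => w _; exact: sqr_ge0.
  have x0 : 0 <= x ^+ 2 by exact: sqr_ge0.
  set y := x ^+ 2 - s2.
  have yle : `|y| <= x ^+ 2 + s2.
    by apply: le_trans (ler_normB _ _) _; rewrite !ger0_norm.
  apply: (@le_trans _ _ (64 / alpha ^+ 2 * expR (alpha / 4 * `|y|) *
     expR (alpha / 4 * `|y|))).
    rewrite ler_wpM2r ?expR_ge0//.
    have := expR_ge_pow 1 (mulr_ge0 (divr_ge0 a0 (ler0n _ 4)) (normr_ge0 y)).
    rewrite (_ : (_ / _) ^+ 2 = `|y| ^+ 2 * (alpha ^+ 2 / 64)); last by field.
    rewrite real_normK ?num_real// -ler_pdivlMr ?divr_gt0 ?exprn_gt0//.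
    by rewrite invf_div mulrC.
  rewrite -[leLHS]mulrA -[leRHS]mulrA -!expRD ler_wpM2l ?divr_ge0 ?exprn_ge0//.
  rewrite ler_expR.
  have : alpha * `|y| <= alpha * (x ^+ 2 + s2) by rewrite ler_wpM2l.
  have : 0 <= alpha * x ^+ 2 by rewrite mulr_ge0.
  lra.
- exact: square_expZ.
Qed.

(** The linear term of the exponential integrates to zero, which leaves a bound
    that is quadratic in [m]. *)
Lemma mgf_square_centered : exists2 C, 0 <= C & forall m, `|m| <= alpha / 4 ->
  (\int[P]_w (expR (m * (X w ^+ 2 - s2)))%:E <= (expR (C * m ^+ 2))%:E)%E.
Proof.
pose h (x : R) := (x ^+ 2 - s2) ^+ 2 * expR (alpha / 4 * `|x ^+ 2 - s2|).
have sqB : seb (fun x => x ^+ 2) by exact: square_exp_pow.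
exists (mean h).
  by apply: Rintegral_ge0 => w _; rewrite mulr_ge0 ?sqr_ge0 ?expR_ge0.
move=> m ma.
have mle : m <= alpha / 4 by exact: le_trans (ler_norm _) ma.
have mB : seb (fun x => expR (m * (x ^+ 2 - s2))).
  have -> : (fun x => expR (m * (x ^+ 2 - s2))) =
     (fun x => expR (- (m * s2)) * expR (m * x ^+ 2)).
    by apply/funext => x; rewrite -expRD; congr expR; ring.
  apply: square_expZ; apply: square_exp_exp; apply: (le_trans mle).
  by rewrite ler_pdivrMr// ler_peMr// (ler_nat _ 1 4).
rewrite (mean_EFin X_exp mB) lee_fin; apply: le_trans (expR_ge1Dx _).
suff : mean (fun x => expR (m * (x ^+ 2 - s2))) <=
    (1 - m * s2) + m * s2 + m ^+ 2 * mean h.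
  by rewrite subrK [C in _ <= 1 + C -> _]mulrC.
apply: (mean_le_comb alpha_gt0 X_exp mB sqB centered_bounded).
move=> x; rewrite /h; set y := x ^+ 2 - s2.
have := expR_taylor2 (m * y); rewrite ler_norml => /andP[_].
rewrite -addrA -opprD lerBlDr => /le_trans; apply.
have -> : 1 - m * s2 + m * x ^+ 2 = 1 + m * y by rewrite /y; ring.
rewrite [leLHS]addrC lerD2l real_normK ?num_real// exprMn -[leLHS]mulrA.
apply: ler_wpM2l; first exact: sqr_ge0.
apply: ler_wpM2l; first exact: sqr_ge0.
by rewrite ler_expR normrM ler_wpM2r.
Qed.

(** The excess over [c] vanishes except on an exponentially small tail. *)
Lemma mgf_truncated c : 0 <= c ->
  (\int[P]_w (expR (alpha / 2 * Num.max (`|X w| - c) 0 ^+ 2))%:E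
    <= (1 + expR (- (alpha / 2 * c ^+ 2)) * J)%:E)%E.
Proof.
move=> c0.
have le x : expR (alpha / 2 * Num.max (`|x| - c) 0 ^+ 2) <=
    1 + expR (- (alpha / 2 * c ^+ 2)) * expR (alpha * x ^+ 2).
  have [xc|xc] := leP (`|x| - c) 0.
    by rewrite expr0n mulr0 expR0 lerDl mulr_ge0 ?expR_ge0.
  rewrite -expRD; apply: (@le_trans _ _ (expR (- (alpha / 2 * c ^+ 2) + alpha * x ^+ 2))).
    rewrite ler_expR -[x ^+ 2]real_normK ?num_real//.
    have -> : - (alpha / 2 * c ^+ 2) + alpha * `|x| ^+ 2 =
      alpha / 2 * (`|x| ^+ 2 - c ^+ 2) + alpha / 2 * `|x| ^+ 2 by field.
    have h1 : (`|x| - c) ^+ 2 <= `|x| ^+ 2.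
      by apply: lerXn2r; rewrite ?nnegrE//; lra.
    have h2 : c ^+ 2 <= `|x| ^+ 2.
      by apply: lerXn2r; rewrite ?nnegrE//; lra.
    rewrite (le_trans (ler_wpM2l _ h1)) ?divr_ge0// lerDr mulr_ge0 ?divr_ge0//.
    by rewrite subr_ge0.
  by rewrite lerDr.
have hB : seb (fun x => expR (alpha / 2 * Num.max (`|x| - c) 0 ^+ 2)).
  apply: (square_exp_le _ _ (square_exp_comb alpha_gt0 1 _ 0 expJ expJ)).
    by solve_measurable.
  by move=> x; rewrite mul0r addr0 ger0_norm ?expR_ge0//; exact: le.
rewrite (mean_EFin X_exp hB) lee_fin.
suff : mean (fun x => expR (alpha / 2 * Num.max (`|x| - c) 0 ^+ 2)) <=
    1 + expR (- (alpha / 2 * c ^+ 2)) * J + 0 * J by rewrite mul0r addr0.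
apply: (mean_le_comb alpha_gt0 X_exp hB expJ expJ).
by move=> x; rewrite mul0r addr0.
Qed.

End NoiseMoments.

(** * The logarithmic Laplace transform of the noise *)

Section LogMgf.
Context {d : measure_display} {T : measurableType d} {R : realType}
  (P : probability T R) (X : {RV P >-> R}) (alpha : R).
Hypothesis alpha_gt0 : 0 < alpha.
Hypothesis X_exp : ('E_P[fun w => (expR (alpha * X w ^+ 2))%R] < +oo)%E.
Hypothesis X_mean : \int[P]_w X w = 0.

Local Notation mean h := (\int[P]_w (h (X w))).
Local Notation seb := (square_exp_bounded alpha).
Local Notation J := (mean (fun x => expR (alpha * x ^+ 2))).
Local Notation s2 := (mean (fun x => x ^+ 2)).
Local Notation C3 := (mean (fun x => `|x| ^+ 3 * expR (1 * `|x|))).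

Definition mgf (s : R) : R := \int[P]_w expR (s * X w).

Let expJ : seb (fun x => expR (alpha * x ^+ 2)).
Proof. exact: square_exp_exp. Qed.

Let idB : seb (fun x => x).
Proof. by have := square_exp_pow alpha_gt0 1. Qed.

Let sqB : seb (fun x => x ^+ 2).
Proof. exact: square_exp_pow. Qed.

Let cubeB : seb (fun x => `|x| ^+ 3 * expR (1 * `|x|)).
Proof. exact: square_exp_poly_expR_norm. Qed.

Let mgfB s : seb (fun x => expR (s * x)).
Proof.
apply: (square_exp_le _ _ (square_exp_expR_norm alpha_gt0 `|s|)).
  by solve_measurable.
by move=> x; rewrite ger0_norm ?expR_ge0// ler_expR -normrM ler_norm.
Qed.

Lemma mgf_EFin s : (\int[P]_w (expR (s * X w))%:E)%E = (mgf s)%:E.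
Proof. exact: (mean_EFin X_exp (mgfB s)). Qed.

Lemma mgf_ge1 s : 1 <= mgf s.
Proof.
suff : 1 + s * mean (fun x => x) + 0 * mean (fun x => x) <= mgf s.
  by rewrite mul0r X_mean mulr0 !addr0.
apply: (mean_ge_comb alpha_gt0 X_exp (mgfB s) idB idB) => x.
by rewrite mul0r addr0 expR_ge1Dx.
Qed.

Lemma mgf_gt0 s : 0 < mgf s.
Proof. exact: lt_le_trans (mgf_ge1 s). Qed.

Lemma mgf_normalized s :
  (\int[P]_w (expR (s * X w - ln (mgf s)))%:E = 1)%E.
Proof.
under eq_integral do rewrite expRB lnK ?posrE ?mgf_gt0// mulrC EFinM.
rewrite ge0_integralZl//; last 2 first.
- by apply/measurable_EFinP; solve_measurable.
- by rewrite lee_fin invr_ge0 ltW// mgf_gt0.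
by rewrite mgf_EFin -EFinM mulVf// gt_eqF// mgf_gt0.
Qed.

Lemma measurable_mgf : measurable_fun setT mgf.
Proof.
pose f (u : R * T) : \bar R := (expR (u.1 * X u.2))%:E.
have mf : measurable_fun setT f.
  apply/measurable_EFinP; apply: (measurableT_comp (@measurable_expR _)).
  apply: measurable_funM => //; exact: measurableT_comp.
have f0 u : (0 <= f u)%E by rewrite lee_fin expR_ge0.
have := measurable_fun_fubini_tonelli_F (m2 := P) f mf f0.
rewrite /fubini_F /f/= => h; apply: measurableT_comp h => //.
Qed.

(** A third order expansion, in which the linear term vanishes because the noise
    is centered. *)
Lemma mgf_near0 s : `|s| <= 1 ->
  `|mgf s - 1 - s2 / 2 * s ^+ 2| <= C3 * `|s| ^+ 3.
Proof.
move=> s1.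
have bound x : `|expR (s * x) - 1 - s * x - (s * x) ^+ 2 / 2| <=
    `|s| ^+ 3 * (`|x| ^+ 3 * expR (1 * `|x|)).
  apply: le_trans (expR_taylor3 _) _.
  rewrite normrM exprMn -mulrA ler_wpM2l ?exprn_ge0//.
  by rewrite ler_wpM2l ?exprn_ge0// ler_expR ler_wpM2r.
have rest c : seb (fun x => s * x + c * (`|x| ^+ 3 * expR (1 * `|x|))).
  by apply: square_expD; exact: square_expZ.
have rest_mean c : mean (fun x => s * x + c * (`|x| ^+ 3 * expR (1 * `|x|))) = c * C3.
  have := mean_comb alpha_gt0 X_exp 0 s c idB cubeB.
  rewrite X_mean mulr0 !add0r => <-.
  by congr (Rintegral _ _ _); apply/funext => w; rewrite add0r.
have upper : mgf s <= 1 + s ^+ 2 / 2 * s2 + 1 * (`|s| ^+ 3 * C3).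
  rewrite -rest_mean; apply: (mean_le_comb alpha_gt0 X_exp (mgfB s) sqB (rest _)) => x.
  have := bound x; rewrite ler_norml => /andP[_]; rewrite exprMn; lra.
have lower : 1 + s ^+ 2 / 2 * s2 + 1 * (- `|s| ^+ 3 * C3) <= mgf s.
  rewrite -rest_mean; apply: (mean_ge_comb alpha_gt0 X_exp (mgfB s) sqB (rest _)) => x.
  have := bound x; rewrite ler_norml => /andP[+ _]; rewrite exprMn; lra.
rewrite ler_norml; apply/andP; split; lra.
Qed.

Lemma mgf_large s : mgf s <= expR (s ^+ 2 / (4 * alpha)) * J.
Proof.
suff : mgf s <= 0 + expR (s ^+ 2 / (4 * alpha)) * J + 0 * J.
  by rewrite mul0r addr0 add0r.
apply: (mean_le_comb alpha_gt0 X_exp (mgfB s) expJ expJ) => x.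
rewrite mul0r addr0 add0r -expRD ler_expR -subr_ge0.
have -> : s ^+ 2 / (4 * alpha) + alpha * x ^+ 2 - s * x =
   alpha * (x - s / (2 * alpha)) ^+ 2 by field; rewrite gt_eqF.
by rewrite mulr_ge0 ?sqr_ge0// ltW.
Qed.

Lemma ln_mgf_ge0 s : 0 <= ln (mgf s).
Proof. by rewrite ln_ge0// mgf_ge1. Qed.

Let s2_ge0 : 0 <= s2.
Proof. by apply: Rintegral_ge0 => w _; exact: sqr_ge0. Qed.

Let C3_ge0 : 0 <= C3.
Proof. by apply: Rintegral_ge0 => w _; rewrite mulr_ge0 ?exprn_ge0 ?expR_ge0. Qed.

Let C4 := C3 + (s2 / 2 + C3) ^+ 2.

(** The bounds [y - y^2 <= ln (1 + y) <= y] at [y = mgf s - 1]. *)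
Lemma ln_mgf_near0 s : `|s| <= 1 ->
  `|ln (mgf s) - s2 / 2 * s ^+ 2| <= C4 * `|s| ^+ 3.
Proof.
move=> s1; have := mgf_near0 s1.
have := mgf_ge1 s; set m := mgf s => m1.
have m0 : 0 < m by exact: lt_le_trans m1.
have lnle : ln m <= m - 1.
  by have := expR_ge1Dx (ln m); rewrite lnK ?posrE// => ?; lra.
(* [ln (1 / m) <= 1 / m - 1], and [1 / m <= 1 - y + y^2] for [m = 1 + y] *)
have lnge : (m - 1) - (m - 1) ^+ 2 <= ln m.
  have := expR_ge1Dx (- ln m); rewrite expRN lnK ?posrE// => h.
  have : m^-1 <= 1 - (m - 1) + (m - 1) ^+ 2.
    rewrite -div1r ler_pdivrMr// -subr_ge0.
    have -> : (1 - (m - 1) + (m - 1) ^+ 2) * m - 1 = (m - 1) ^+ 3 by ring.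
    by rewrite exprn_ge0// subr_ge0.
  lra.
set t := `|s| in s1 *; have t0 : 0 <= t by exact: normr_ge0.
have -> : s ^+ 2 = t ^+ 2 by rewrite real_normK ?num_real.
have t32 : t ^+ 3 <= t ^+ 2 by rewrite ler_wiXn2l.
have t43 : t ^+ 4 <= t ^+ 3 by rewrite ler_wiXn2l.
have t30 : 0 <= t ^+ 3 by rewrite exprn_ge0.
rewrite !ler_norml => /andP[h1 h2]; rewrite /C4.
have sq : (m - 1) ^+ 2 <= (s2 / 2 + C3) ^+ 2 * t ^+ 3.
  apply: (@le_trans _ _ (((s2 / 2 + C3) * t ^+ 2) ^+ 2)).
    apply: lerXn2r; rewrite ?nnegrE ?subr_ge0//.
      by rewrite mulr_ge0 ?exprn_ge0// addr_ge0// divr_ge0.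
    have : C3 * t ^+ 3 <= C3 * t ^+ 2 by rewrite ler_wpM2l.
    lra.
  by rewrite exprMn ler_wpM2l ?sqr_ge0// -exprM.
have q0 : 0 <= (s2 / 2 + C3) ^+ 2 * t ^+ 3 by rewrite mulr_ge0// sqr_ge0.
by apply/andP; split; lra.
Qed.

(** The second bound compares with the Gaussian case.  Its error is a small
    multiple of the square, plus the squared excess of [|s|] over a threshold:
    both parts can be summed along a trajectory, whatever the size of its
    largest values. *)
Lemma ln_mgf_bounds : exists2 K, 0 <= K &
  (forall s, ln (mgf s) <= K * s ^+ 2) /\
  (forall del s, 0 < del <= 1 -> `|ln (mgf s) - s2 / 2 * s ^+ 2| <=
     K * (del * s ^+ 2 + Num.max (`|s| - del / 2) 0 ^+ 2)).
Proof.
have J0 : 0 <= J by exact: J_ge0.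
have C40 : 0 <= C4 by rewrite addr_ge0 ?sqr_ge0.
have a40 : 0 <= (4 * alpha)^-1 by rewrite invr_ge0 mulr_ge0// ltW.
pose L := s2 / 2 + C4 + J + (4 * alpha)^-1.
have L0 : 0 <= L.
  apply: addr_ge0 => //; apply: addr_ge0 => //; apply: addr_ge0 => //.
  exact: divr_ge0.
have le1 s : ln (mgf s) <= L * s ^+ 2.
  have ss0 := sqr_ge0 s.
  have [s1|s1] := leP `|s| 1.
    have := ln_mgf_near0 s1; rewrite ler_norml => /andP[_].
    have : `|s| ^+ 3 <= s ^+ 2 by rewrite -[leRHS]real_normK ?num_real// ler_wiXn2l.
    move=> /(ler_wpM2l C40).
    have : 0 <= J * s ^+ 2 by rewrite mulr_ge0.
    have : 0 <= (4 * alpha)^-1 * s ^+ 2 by rewrite mulr_ge0.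
    rewrite /L; lra.
  have ss1 : 1 <= s ^+ 2 by rewrite -[leRHS]real_normK ?num_real// exprn_ege1// ltW.
  have : ln (mgf s) <= s ^+ 2 / (4 * alpha) + J.
    rewrite -[leRHS]expRK ler_ln ?posrE ?expR_gt0 ?mgf_gt0//.
    apply: le_trans (mgf_large s) _; rewrite expRD ler_wpM2l ?expR_ge0//.
    by apply: le_trans (expR_ge1Dx _); rewrite lerDr.
  have : J <= J * s ^+ 2 by rewrite ler_peMr.
  have : 0 <= (s2 / 2 + C4) * s ^+ 2 by rewrite mulr_ge0// addr_ge0// divr_ge0.
  rewrite /L; lra.
exists (C4 + 4 * (L + s2)); first by rewrite addr_ge0// mulr_ge0// addr_ge0.
split=> [s|del s /andP[del0 del1]].
  apply: le_trans (le1 s) _; apply: ler_wpM2r; first exact: sqr_ge0.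
  have -> : C4 + 4 * (L + s2) = L + (C4 + (3 * L + 4 * s2)) by ring.
  by rewrite lerDl; apply: addr_ge0 => //; apply: addr_ge0; exact: mulr_ge0.
have ss0 := sqr_ge0 s.
set q := Num.max _ _.
have q0 : 0 <= q by rewrite /q le_max lexx orbT.
have K0 : 0 <= 4 * (L + s2) by rewrite mulr_ge0// addr_ge0.
have del_s0 : 0 <= del * s ^+ 2 by rewrite mulr_ge0// ltW.
have [sd|sd] := leP `|s| del.
  apply: le_trans (ln_mgf_near0 (le_trans sd del1)) _.
  apply: (@le_trans _ _ (C4 * (del * s ^+ 2))).
    rewrite ler_wpM2l// exprS -[in leRHS]real_normK ?num_real//.
    by rewrite ler_wpM2r// exprn_ge0.
  rewrite -subr_ge0 (_ : _ - _ = C4 * q ^+ 2 +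
    4 * (L + s2) * (del * s ^+ 2 + q ^+ 2)); last by ring.
  apply: addr_ge0; apply: mulr_ge0 => //; first exact: sqr_ge0.
  by rewrite addr_ge0 ?sqr_ge0.
have h1 : `|ln (mgf s) - s2 / 2 * s ^+ 2| <= (L + s2) * s ^+ 2.
  have := ln_mgf_ge0 s; have := le1 s.
  have := mulr_ge0 s2_ge0 ss0; have := mulr_ge0 L0 ss0.
  by move=> ? ? ? ?; rewrite ler_norml; apply/andP; split; lra.
apply: le_trans h1 _.
have h2 : s ^+ 2 <= 4 * q ^+ 2.
  rewrite -[s ^+ 2]real_normK ?num_real//.
  have -> : 4 * q ^+ 2 = (2 * q) ^+ 2 by ring.
  apply: lerXn2r; rewrite ?nnegrE ?mulr_ge0//.
  have : `|s| - del / 2 <= q by rewrite /q le_max lexx.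
  lra.
apply: (@le_trans _ _ (4 * (L + s2) * q ^+ 2)).
  rewrite (mulrC 4) -[leRHS]mulrA; apply: ler_wpM2l => //; exact: addr_ge0.
rewrite -subr_ge0 (_ : _ - _ = C4 * (del * s ^+ 2 + q ^+ 2) +
  4 * (L + s2) * (del * s ^+ 2)); last by ring.
apply: addr_ge0; apply: mulr_ge0 => //.
by rewrite addr_ge0// sqr_ge0.
Qed.

End LogMgf.

(** * Measurable limits and geometric series *)

Section MeasurableLimit.
Context {d : measure_display} {T : measurableType d} {R : realType}.
Implicit Types h : (T -> R)^nat.

(** Cauchy's criterion with countably many precisions. *)
Lemma measurable_cvg_set h : (forall m, measurable_fun setT (h m)) ->
  measurable [set w | cvgn (h ^~ w)].
Proof.
move=> mh.
have -> : [set w | cvgn (h ^~ w)] =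
    \bigcap_(k : nat) \bigcup_(N : nat) \bigcap_(m : nat)
      [set w | `|h (N + m)%N w - h N w| <= k.+1%:R^-1].
  apply/seteqP; split=> [w /= /cvg_ex[l hl] k _|w hw].
    have e0 : 0 < k.+1%:R^-1 / 2 :> R by rewrite divr_gt0 ?invr_gt0.
    move/cvgrPdist_lt : hl => /(_ _ e0)[N _ hN]; exists N => // m _ /=.
    have h1 := hN (N + m)%N (leq_addr _ _); have h2 := hN N (leqnn _).
    rewrite -[_ - _]opprK opprB (_ : _ - _ = (l - h (N + m)%N w) - (l - h N w)); last by ring.
    rewrite normrN (le_trans (ler_normB _ _))// [leRHS]splitr lerD// ltW//.
  apply/cauchy_cvgP/cauchy_exP => e e0.
  have [k ke] : exists k, k.+1%:R^-1 < e.
    have [k _ hk] := near_infty_natSinv_lt (PosNum e0).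
    by exists k; exact: hk (leqnn k).
  have [N _ hN] := hw k I; exists (h N w), N => // m /= Nm.
  have := hN (m - N)%N I; rewrite /= subnKC// => h1.
  by rewrite -ball_normE /= distrC; exact: le_lt_trans h1 ke.
apply: bigcapT_measurable => k; apply: bigcupT_measurable => N.
apply: bigcapT_measurable => m.
rewrite -[X in measurable X]setTI; apply: measurable_fun_le => //.
apply: (measurableT_comp (@normr_measurable _ setT)).
exact: measurable_funB.
Qed.

(** Where the sequence diverges, its limit is a fixed default value. *)
Lemma measurable_limn h : (forall m, measurable_fun setT (h m)) ->
  measurable_fun setT (fun w => limn (h ^~ w)).
Proof.
move=> mh; have mC := measurable_cvg_set mh.
set C := [set w | _] in mC.
pose g m w := h m w * \1_C w + (point : R) * \1_(~` C) w.
apply: (@measurable_fun_cvg _ _ _ _ g) => [m|w _].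
  apply: measurable_funD; apply: measurable_funM => //.
  by apply: measurable_indic; exact: measurableC.
rewrite /g !indicE.
have [Cw|Cw] := pselect (C w).
  rewrite mem_set// memNset; last by move=> /(_ Cw).
  by under eq_fun do rewrite mulr1 mulr0 addr0.
rewrite memNset// mem_set//.
under eq_fun do rewrite mulr0 mulr1 add0r.
rewrite dvgP//; exact: cvg_cst.
Qed.

End MeasurableLimit.

Section Geometric.
Context {R : realType} (theta : R).
Hypothesis theta01 : 0 <= theta < 1.

Lemma geometric_partial_le N : \sum_(0 <= p < N) theta ^+ p <= (1 - theta)^-1.
Proof.
have /andP[t0 t1] := theta01.
have E : (1 - theta) * \sum_(0 <= p < N) theta ^+ p = 1 - theta ^+ N.
  elim: N => [|N IH]; first by rewrite big_geq// mulr0 expr0 subrr.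
  by rewrite big_nat_recr//= mulrDr IH exprS; ring.
rewrite -[leRHS]mul1r ler_pdivlMr ?subr_gt0// mulrC E.
by rewrite gerBl exprn_ge0.
Qed.

Lemma series_abs_bounded_cvg (u : R^nat) (M : R) :
  (forall N, \sum_(0 <= p < N) `|u p| <= M) -> cvgn (series u).
Proof.
move=> uM; apply: normed_cvg; apply: nondecreasing_is_cvgn.
  by apply: nondecreasing_series => n _ _; exact: normr_ge0.
by exists M => _ [N _ <-]; exact: uM.
Qed.

End Geometric.

(** * The stationary process *)

Section StationaryProcess.
Context {d : measure_display} {T : measurableType d} {R : realType}
  (P : probability T R) (xi : int -> {RV P >-> R}) (theta a C1 : R).
Hypothesis xi_indep : mutually_independent xi.
Hypothesis xi_ident : identically_distributed xi.
Hypothesis theta01 : 0 <= theta < 1.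
Hypothesis a_ge0 : 0 <= a.
Hypothesis sq_mgf : forall m, 0 <= m <= a ->
  (\int[P]_w (expR (m * xi 0 w ^+ 2))%:E <= (expR (C1 * m))%:E)%E.
Hypothesis xi_abs : (\int[P]_w (`|xi 0 w|)%:E < +oo)%E.

Local Notation rho := (1 - theta).

Let theta_ge0 : 0 <= theta. Proof. by have /andP[] := theta01. Qed.
Let rho_gt0 : 0 < rho. Proof. by have /andP[_] := theta01; rewrite subr_gt0. Qed.

Definition past_sum (k : int) (w : T) : R^nat :=
  series (fun p : nat => theta ^+ p * xi (k - p%:Z) w).

Definition stationary (k : int) (w : T) : R := limn (past_sum k w).

Lemma past_sum_past k m :
  measurable_fun setT ((fun w => past_sum k w m) : past xi k -> R).
Proof.
apply: measurable_sum => p; apply: measurable_funM => //.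
by apply: past_measurable_noise; rewrite gerBl.
Qed.

Lemma stationary_past k : measurable_fun setT (stationary k : past xi k -> R).
Proof.
exact: (@measurable_limn _ (past xi k) R (fun m w => past_sum k w m)
  (@past_sum_past k)).
Qed.

Lemma past_sumS k w m :
  past_sum (k + 1) w m.+1 = theta * past_sum k w m + xi (k + 1) w.
Proof.
rewrite /past_sum /series/= big_nat_recl//= expr0 mul1r subr0 addrC; congr (_ + _).
rewrite big_distrr/=; apply: eq_bigr => p _; rewrite exprS mulrA.
by congr (_ * xi _ _); rewrite -addn1 PoszD opprD addrACA subrr addr0.
Qed.

Lemma stationary_rec k w : cvgn (past_sum k w) ->
  cvgn (past_sum (k + 1) w) /\
  stationary (k + 1) w = theta * stationary k w + xi (k + 1) w.
Proof.
move=> /cvg_ex[l hl].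
have h : past_sum (k + 1) w @ \oo --> theta * l + xi (k + 1) w.
  rewrite -(cvg_shiftS (past_sum (k + 1) w)) (eq_cvg _ _ (past_sumS k w)).
  by apply: cvgD; [exact: cvgMr|exact: cvg_cst].
split; first by apply/cvg_ex; eexists; exact: h.
by rewrite /stationary (cvg_lim _ h)// (cvg_lim _ hl).
Qed.

(** Convexity of the square: [theta x + y] is the average of [x] and of
    [y / rho], with weights [theta] and [rho]. *)
Lemma convex_sq (x y : R) :
  rho * (theta * x + y) ^+ 2 <= theta * (rho * x ^+ 2) + y ^+ 2.
Proof.
rewrite -subr_ge0.
have -> : theta * (rho * x ^+ 2) + y ^+ 2 - rho * (theta * x + y) ^+ 2 =
  theta * (y - rho * x) ^+ 2 by ring.
by rewrite mulr_ge0 ?sqr_ge0.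
Qed.

(** The bound reproduces itself along the recursion, since
    [theta / rho + 1 = 1 / rho]. *)
Lemma sq_mgf_step k (Z : T -> R) : measurable_fun setT (Z : past xi k -> R) ->
  (forall c, 0 <= c <= a ->
    (\int[P]_w (expR (c * (rho * Z w ^+ 2)))%:E <= (expR (C1 * c / rho))%:E)%E) ->
  forall c, 0 <= c <= a ->
    (\int[P]_w (expR (c * (rho * (theta * Z w + xi (k + 1) w) ^+ 2)))%:E
      <= (expR (C1 * c / rho))%:E)%E.
Proof.
move=> mZ hZ c /andP[c0 ca].
have mZ' : measurable_fun setT Z by exact: past_measurable_fun mZ.
apply: (@le_trans _ _ (\int[P]_w
   (expR (c * theta * (rho * Z w ^+ 2)) * expR (c * xi (k + 1) w ^+ 2))%:E)%E).
  apply: ge0_le_integral => //.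
  - by apply/measurable_EFinP; solve_measurable.
  - by apply/measurable_EFinP; solve_measurable.
  - move=> w _; rewrite lee_fin -expRD ler_expR -mulrA -mulrDr.
    by apply: ler_wpM2l => //; exact: convex_sq.
have mF : measurable_fun setT
    ((fun w => expR (c * theta * (rho * Z w ^+ 2))) : past xi k -> R).
  by solve_measurable.
rewrite (integral_one_step_prod xi_indep xi_ident
  (h := fun x => expR (c * x ^+ 2)) mF)/=; first last.
- by move=> x; exact: expR_ge0.
- by move=> w; exact: expR_ge0.
- by solve_measurable.
have ct : 0 <= c * theta <= a.
  rewrite mulr_ge0//= (le_trans _ ca)// ler_piMr//.
  by move: rho_gt0; rewrite subr_gt0 => /ltW.
apply: (@le_trans _ _ ((expR (C1 * c))%:E * (expR (C1 * (c * theta) / rho))%:E)%E).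
  apply: lee_pmul => //; last exact: hZ.
  - by apply: integral_ge0 => w _; rewrite lee_fin expR_ge0.
  - by apply: integral_ge0 => w _; rewrite lee_fin expR_ge0.
  - by apply: sq_mgf; rewrite c0.
rewrite -EFinM lee_fin -expRD ler_expR le_eqVlt; apply/orP; left; apply/eqP.
by field; rewrite gt_eqF.
Qed.

Lemma past_sum_sq_mgf m k c : 0 <= c <= a ->
  (\int[P]_w (expR (c * (rho * past_sum k w m ^+ 2)))%:E
    <= (expR (C1 * c / rho))%:E)%E.
Proof.
elim: m k c => [|m IH] k c ca.
  under eq_integral do rewrite /past_sum /series/= big_geq// expr0n/= !mulr0 expR0.
  rewrite integral_prob_cst lee_fin -[leLHS]expR0 ler_expR.
  apply: divr_ge0; last exact: ltW rho_gt0.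
  have := sq_mgf ca => h; rewrite -ler_expR expR0 -lee_fin (le_trans _ h)//.
  rewrite -[leLHS](integral_prob_cst P).
  apply: ge0_le_integral => //.
  - by apply/measurable_EFinP; solve_measurable.
  - move=> w _; rewrite lee_fin -expR0 ler_expR mulr_ge0 ?sqr_ge0//.
    by case/andP: ca.
rewrite -(subrK 1 k).
under eq_integral do rewrite past_sumS.
apply: sq_mgf_step => // [|c' hc']; first exact: past_sum_past.
exact: IH.
Qed.

(** The series of absolute values has a finite mean. *)
Lemma past_sum_cvg k : {ae P, forall w, cvgn (past_sum k w)}.
Proof.
pose f (p : nat) (w : T) : \bar R := (theta ^+ p * `|xi (k - p%:Z) w|)%:E.
have f0 p w : (0 <= f p w)%E by rewrite lee_fin mulr_ge0 ?exprn_ge0.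
have mf p : measurable_fun setT (f p).
  by apply/measurable_EFinP; solve_measurable.
have xi_fin : (\int[P]_w (`|xi 0 w|)%:E)%E \is a fin_num.
  by rewrite ge0_fin_numE//; apply: integral_ge0 => w _; rewrite lee_fin.
pose m1 := fine (\int[P]_w (`|xi 0 w|)%:E)%E.
have m10 : 0 <= m1.
  by apply: fine_ge0; apply: integral_ge0 => w _; rewrite lee_fin.
have int_f p : (\int[P]_w f p w = (theta ^+ p * m1)%:E)%E.
  under eq_integral do rewrite /f EFinM.
  rewrite ge0_integralZl//; last 2 first.
    by apply/measurable_EFinP; solve_measurable.
    by rewrite lee_fin exprn_ge0.
  rewrite [X in (_ * X)%E](integral_noise xi_ident (k - p%:Z) (h := fun x => (`|x|)%:E)) => [|//|//].
    by rewrite EFinM fineK.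
  by apply/measurable_EFinP; solve_measurable.
pose S (w : T) : \bar R := (\sum_(p <oo) f p w)%E.
have mS : measurable_fun setT S by exact: ge0_emeasurable_sum.
have S0 w : (0 <= S w)%E by exact: nneseries_ge0.
have intS : P.-integrable setT S.
  apply/integrableP; split => //.
  under eq_integral do rewrite gee0_abs//.
  rewrite integral_nneseries//.
  under eq_eseriesr do rewrite int_f.
  apply: (@le_lt_trans _ _ ((1 - theta)^-1 * m1)%:E); last exact: ltry.
  apply: lime_le.
    by apply: is_cvg_nneseries => n _ _; rewrite lee_fin mulr_ge0 ?exprn_ge0.
  apply: nearW => N; rewrite sumEFin lee_fin -big_distrl/= ler_wpM2r//.
  exact: geometric_partial_le.
have := integrable_ae measurableT intS; apply: filterS => w /(_ I) Sfin.
apply: (series_abs_bounded_cvg (M := fine (S w))) => N.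
rewrite -lee_fin fineK// -sumEFin.
rewrite (eq_bigr (f^~ w)); last first.
  by move=> p _; rewrite /f normrM ger0_norm ?exprn_ge0.
exact: nneseries_lim_ge.
Qed.

(** Fatou's lemma along the partial sums. *)
Lemma stationary_sq_mgf k c : 0 <= c <= a ->
  (\int[P]_w (expR (c * (rho * stationary k w ^+ 2)))%:E
    <= (expR (C1 * c / rho))%:E)%E.
Proof.
move=> ca.
pose f m w := (expR (c * (rho * past_sum k w m ^+ 2)))%:E.
have mps m : measurable_fun setT (fun w => past_sum k w m).
  exact: past_measurable_fun (@past_sum_past k m).
have mst : measurable_fun setT (stationary k).
  exact: past_measurable_fun (@stationary_past k).
have mf m : measurable_fun setT (f m).
  by apply/measurable_EFinP; solve_measurable.
have f0 m w : setT w -> (0 <= f m w)%E by move=> _; rewrite lee_fin expR_ge0.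
apply: (@le_trans _ _ (\int[P]_w limn_einf (f ^~ w))%E).
  apply: ae_ge0_le_integral => //.
  - by apply/measurable_EFinP; solve_measurable.
  - move=> w _; rewrite limn_einf_lim; apply: lime_ge; first exact: is_cvg_einfs.
    by apply: nearW => m; apply: le_ereal_inf_tmp => /= _ [p /= _ <-]; exact: f0.
  - apply: (emeasurable_fun_cvg (fun m w => einfs (f ^~ w) m)).
      by move=> m; exact: measurable_fun_einfs.
    by move=> w _; rewrite limn_einf_lim; exact: is_cvg_einfs.
  have := past_sum_cvg k; apply: filterS => w cw _.
  have h : f ^~ w @ \oo --> (expR (c * (rho * stationary k w ^+ 2)))%:E.
    apply: cvg_EFin; first exact: nearW.
    have cs : past_sum k w @ \oo --> stationary k w by exact: cw.
    apply: (continuous_cvg _ (@continuous_expR _ _)).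
    by apply: cvgMr; apply: cvgMr; apply: cvgM.
  by rewrite (cvg_limn_einf_sup h).1.
apply: le_trans (fatou P measurableT mf f0) _.
rewrite limn_einf_lim; apply: lime_le; first exact: is_cvg_einfs.
apply: nearW => m; apply: (@le_trans _ _ (\int[P]_w f m w)%E); last exact: past_sum_sq_mgf.
by apply: ereal_inf_lbound; exists m => /=.
Qed.

End StationaryProcess.

(** * Deterministic estimates along a trajectory *)

Section PathIdentities.
Context {R : realType} (theta : R).
Local Notation rho := (1 - theta).
Implicit Types (x e u z : R^nat).

(** Squaring the recursion and summing telescopes the squares.  It expresses the
    denominator of the estimators through the noise, the numerator and the two
    endpoints, so that no separate estimate of it is needed. *)
Lemma sum_squares_identity x e n :
  (forall k, x k.+1 = theta * x k + e k) ->
  (1 - theta ^+ 2) * \sum_(0 <= k < n) x k ^+ 2 =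
  \sum_(0 <= k < n) e k ^+ 2 + 2 * theta * \sum_(0 <= k < n) x k * e k
  + x 0%N ^+ 2 - x n ^+ 2.
Proof.
move=> xe; elim: n => [|n IH]; first by rewrite !big_geq//; ring.
by rewrite !big_nat_recr//= mulrDr IH xe; ring.
Qed.

(** Summing a contractive recursion; used for the squares and for the truncated
    squares of the process. *)
Lemma sum_contraction u z n :
  (forall k, rho * u k.+1 <= theta * (rho * u k) + z k) -> 0 <= rho * u n ->
  rho ^+ 2 * \sum_(0 <= k < n) u k <= rho * u 0%N + \sum_(0 <= k < n) z k.
Proof.
move=> uz un; suff : rho * u n + rho ^+ 2 * \sum_(0 <= k < n) u k <=
    rho * u 0%N + \sum_(0 <= k < n) z k.
  by apply: le_trans; rewrite lerDr.
elim: n {un} => [|n IH]; first by rewrite !big_geq// mulr0.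
rewrite !big_nat_recr//=; have := uz n; move: IH.
set S := \sum_(_ <= _ < _) _; set Z := \sum_(_ <= _ < _) _ => h1 h2.
apply: le_trans (lerD h2 (lexx _)) _; rewrite addrA.
apply: le_trans _ (lerD h1 (lexx _)).
rewrite le_eqVlt; apply/orP; left; apply/eqP; ring.
Qed.

Hypothesis theta01 : 0 <= theta < 1.

Lemma sum_squares_le x e n : (forall k, x k.+1 = theta * x k + e k) ->
  rho ^+ 2 * \sum_(0 <= k < n) x k ^+ 2 <=
  rho * x 0%N ^+ 2 + \sum_(0 <= k < n) e k ^+ 2.
Proof.
have /andP[t0 t1] := theta01.
move=> xe; apply: (sum_contraction (u := fun k => x k ^+ 2)) => [k|].
  by rewrite xe convex_sq.
by rewrite mulr_ge0 ?sqr_ge0// subr_ge0 ltW.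
Qed.

(** The contraction [theta] leaves room [rho * A] below the threshold [A], which
    the new noise has to exceed. *)
Lemma excess_subadd (A x y : R) : 0 <= A ->
  Num.max (`|theta * x + y| - A) 0 <=
  theta * Num.max (`|x| - A) 0 + Num.max (`|y| - rho * A) 0.
Proof.
have /andP[t0 t1] := theta01 => A0.
have m0 (v : R) : 0 <= Num.max v 0 by rewrite le_max lexx orbT.
rewrite ge_max; apply/andP; split; last by rewrite addr_ge0// mulr_ge0.
have h1 : theta * (`|x| - A) <= theta * Num.max (`|x| - A) 0.
  by rewrite ler_wpM2l// le_max lexx.
have h2 : `|y| - rho * A <= Num.max (`|y| - rho * A) 0 by rewrite le_max lexx.
apply: le_trans (lerD h1 h2).
have := ler_normD (theta * x) y; rewrite normrM (ger0_norm t0); lra.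
Qed.

Lemma sum_excess_le x e n A : 0 <= A -> (forall k, x k.+1 = theta * x k + e k) ->
  rho ^+ 2 * \sum_(0 <= k < n) Num.max (`|x k| - A) 0 ^+ 2 <=
  rho * x 0%N ^+ 2 + \sum_(0 <= k < n) Num.max (`|e k| - rho * A) 0 ^+ 2.
Proof.
have /andP[t0 t1] := theta01 => A0 xe.
have r0 : 0 <= rho by rewrite subr_ge0 ltW.
have m0 (v : R) : 0 <= Num.max v 0 by rewrite le_max lexx orbT.
apply: (@le_trans _ _ (rho * Num.max (`|x 0%N| - A) 0 ^+ 2 +
    \sum_(0 <= k < n) Num.max (`|e k| - rho * A) 0 ^+ 2)).
  apply: (sum_contraction (u := fun k => Num.max (`|x k| - A) 0 ^+ 2)) => [k|].
    apply: le_trans (convex_sq theta01 _ _); apply: ler_wpM2l => //.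
    rewrite xe; apply: lerXn2r; rewrite ?nnegrE// ?addr_ge0 ?mulr_ge0//.
    exact: excess_subadd.
  by rewrite mulr_ge0 ?sqr_ge0.
rewrite lerD2r; apply: ler_wpM2l => //.
rewrite -[leRHS]real_normK ?num_real//; apply: lerXn2r; rewrite ?nnegrE//.
by rewrite ge_max normr_ge0 gerBl A0.
Qed.

End PathIdentities.

(** All that is used of the law of the noise, of variance [s2]: the squared
    noise has exponential moments up to order [a], and [Lam], its logarithmic
    Laplace transform, is nearly quadratic. *)
Record noise_bounds {d : measure_display} {T : measurableType d} {R : realType}
  (P : probability T R) (X : T -> R) (s2 a C1 C2 J K : R) (Lam : R -> R) : Prop :=
  NoiseBounds {
    nb_s2 : 0 < s2;
    nb_a : 0 < a;
    nb_C1 : 0 <= C1;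
    nb_C2 : 0 <= C2;
    nb_J : 0 <= J;
    nb_K : 0 <= K;
    nb_abs : (\int[P]_w (`|X w|)%:E < +oo)%E;
    nb_sq : forall m, 0 <= m <= a ->
      (\int[P]_w (expR (m * X w ^+ 2))%:E <= (expR (C1 * m))%:E)%E;
    nb_centered : forall m, `|m| <= a / 2 ->
      (\int[P]_w (expR (m * (X w ^+ 2 - s2)))%:E <= (expR (C2 * m ^+ 2))%:E)%E;
    nb_excess : forall c, 0 <= c ->
      (\int[P]_w (expR (a * Num.max (`|X w| - c) 0 ^+ 2))%:E
        <= (1 + expR (- (a * c ^+ 2)) * J)%:E)%E;
    nb_Lam_meas : measurable_fun setT Lam;
    nb_Lam : forall s, (\int[P]_w (expR (s * X w - Lam s))%:E = 1)%E;
    nb_Lam_ge0 : forall s, 0 <= Lam s;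
    nb_Lam_le : forall s, Lam s <= K * s ^+ 2;
    nb_Lam_near : forall del s, 0 < del <= 1 ->
      `|Lam s - s2 / 2 * s ^+ 2| <=
      K * (del * s ^+ 2 + Num.max (`|s| - del / 2) 0 ^+ 2) }.

Section NoiseBoundsHold.
Context {d : measure_display} {T : measurableType d} {R : realType}
  (P : probability T R) (X : {RV P >-> R}).

Lemma noise_bounds_hold :
  ('E_P[X] = 0)%E -> (0 < 'E_P[fun w => (X w ^+ 2)%R])%E ->
  (exists2 alpha : R, 0 < alpha &
     ('E_P[fun w => (expR (alpha * X w ^+ 2))%R] < +oo)%E) ->
  exists s2 a C1 C2 J K Lam, noise_bounds P X s2 a C1 C2 J K Lam.
Proof.
move=> X_mean X_var [alpha alpha0 X_exp].
have Xmean : \int[P]_w X w = 0 by rewrite /Rintegral; move: X_mean; rewrite unlock => ->.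
have sqB := square_exp_pow alpha0 2.
have s20 : 0 < \int[P]_w (X w ^+ 2).
  move: X_var; rewrite unlock (mean_EFin X_exp sqB).
  by rewrite lte_fin.
have [C2 C20 hC2] := mgf_square_centered alpha0 X_exp.
have [K K0 [Kle Knear]] := ln_mgf_bounds alpha0 X_exp Xmean.
exists (\int[P]_w (X w ^+ 2)), (alpha / 2),
  (2 / alpha * \int[P]_w (expR (alpha * X w ^+ 2))), C2,
  (\int[P]_w (expR (alpha * X w ^+ 2))), K, (fun s => ln (mgf X s)).
have absB : square_exp_bounded alpha (fun x : R => `|x|).
  apply: (square_exp_le _ _ (square_exp_expR_norm alpha0 1)) => //.
  by move=> x; rewrite normr_id mul1r (le_trans _ (expR_ge1Dx _))// lerDr.
have J0 := J_ge0 X alpha.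
split => //.
- by rewrite divr_gt0.
- by rewrite mulr_ge0// divr_ge0// ltW.
- by rewrite (mean_EFin X_exp absB) ltry.
- by move=> m hm; exact: mgf_square.
- move=> m hm; apply: hC2; apply: le_trans hm _; lra.
- by move=> c c0; exact: mgf_truncated.
- apply: (measurableT_comp (@measurable_ln _)); exact: measurable_mgf.
- move=> s; exact: (mgf_normalized alpha0 X_exp Xmean).
- move=> s; exact: (ln_mgf_ge0 alpha0 X_exp Xmean).
Qed.

End NoiseBoundsHold.

(** * The exponential martingale *)

Section ExponentialMartingale.
Context {d : measure_display} {T : measurableType d} {R : realType}
  (P : probability T R) (xi : int -> {RV P >-> R})
  (theta s2 a C1 C2 J K : R) (Lam : R -> R).
Hypothesis xi_indep : mutually_independent xi.
Hypothesis xi_ident : identically_distributed xi.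
Hypothesis theta01 : 0 <= theta < 1.
Hypothesis nb : noise_bounds P (xi 0) s2 a C1 C2 J K Lam.

Local Notation rho := (1 - theta).
Local Notation noise k := (xi (k%:Z + 1)).

Let theta_ge0 : 0 <= theta. Proof. by have /andP[] := theta01. Qed.
Let rho_gt0 : 0 < rho. Proof. by have /andP[_] := theta01; rewrite subr_gt0. Qed.

(** The process started from its stationary value at time 0 and continued by the
    recursion.  It agrees almost surely with [ar_process], and satisfies the
    recursion everywhere, even where the defining series diverges. *)
Fixpoint ar (k : nat) (w : T) : R :=
  if k is k'.+1 then theta * ar k' w + noise k' w else stationary xi theta 0 w.

Lemma ar_past k : measurable_fun setT (ar k : past xi k%:Z -> R).
Proof.
elim: k => [|k IH]; first exact: stationary_past.
have kk : (k%:Z <= k.+1%:Z) by rewrite lez_nat.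
apply: measurable_funD.
  by apply: measurable_funM => //; exact: past_incl IH.
by apply: past_measurable_noise; rewrite -PoszD addn1.
Qed.

Lemma measurable_ar k : measurable_fun setT (ar k).
Proof. exact: past_measurable_fun (@ar_past k). Qed.

Lemma ar_sq_mgf k c : 0 <= c <= a ->
  (\int[P]_w (expR (c * (rho * ar k w ^+ 2)))%:E <= (expR (C1 * c / rho))%:E)%E.
Proof.
have a0 : 0 <= a := ltW (nb_a nb).
elim: k c => [|k IH] c ca.
  exact: (stationary_sq_mgf xi_indep xi_ident theta01 (nb_sq nb) (nb_abs nb)).
exact: (sq_mgf_step xi_indep xi_ident theta01 (nb_sq nb) (@ar_past k)).
Qed.

Lemma ar_eq_process : {ae P, forall w, forall k, ar_process theta xi k w = ar k w}.
Proof.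
have := past_sum_cvg xi_ident theta01 (nb_abs nb) 0.
apply: filterS => w cw k.
suff [_ <-] : cvgn (past_sum xi theta k%:Z w) /\
   stationary xi theta k%:Z w = ar k w by [].
elim: k => [|k [ck IH]] //=.
have [ck1 E] := stationary_rec ck.
by rewrite -addn1 PoszD -IH.
Qed.

(** The martingale to which the errors of both estimators reduce. *)
Definition ar_noise n w : R := \sum_(0 <= k < n) ar k w * noise k w.
Definition ar_squares n w : R := \sum_(0 <= k < n) ar k w ^+ 2.
Definition noise_squares n w : R := \sum_(0 <= k < n) noise k w ^+ 2.
Definition ar_excess A n w : R :=
  \sum_(0 <= k < n) Num.max (`|ar k w| - A) 0 ^+ 2.
(** The logarithm of the compensator of [exp (lam * ar_noise)]. *)
Definition ar_Lam lam n w : R := \sum_(0 <= k < n) Lam (lam * ar k w).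

Lemma past_partial_sum (F : nat -> T -> R) n :
  (forall k, measurable_fun setT (F k : past xi k.+1%:Z -> R)) ->
  measurable_fun setT
    ((fun w => \sum_(0 <= k < n) F k w) : past xi n%:Z -> R).
Proof.
move=> mF; elim: n => [|n IH].
  by under eq_fun do rewrite big_geq//; exact: measurable_cst.
under eq_fun do rewrite big_nat_recr//=.
by apply: measurable_funD => //; apply: past_incl IH; rewrite lez_nat.
Qed.

Lemma noise_past k : measurable_fun setT (noise k : past xi k.+1%:Z -> R).
Proof. by apply: past_measurable_noise; rewrite -PoszD addn1. Qed.

Lemma ar_pastS k : measurable_fun setT (ar k : past xi k.+1%:Z -> R).
Proof. by apply: past_incl (@ar_past k); rewrite lez_nat. Qed.

Lemma ar_noise_past n : measurable_fun setT (ar_noise n : past xi n%:Z -> R).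
Proof.
apply: past_partial_sum => k.
by apply: measurable_funM; [exact: ar_pastS|exact: noise_past].
Qed.

Lemma ar_Lam_past lam n : measurable_fun setT (ar_Lam lam n : past xi n%:Z -> R).
Proof.
apply: past_partial_sum => k; apply: (measurableT_comp (nb_Lam_meas nb)).
by apply: measurable_funM => //; exact: ar_pastS.
Qed.

Lemma noise_squares_past n : measurable_fun setT (noise_squares n : past xi n%:Z -> R).
Proof.
by apply: past_partial_sum => k; apply: measurable_funX; exact: noise_past.
Qed.

Lemma measurable_ar_noise n : measurable_fun setT (ar_noise n).
Proof. exact: past_measurable_fun (@ar_noise_past n). Qed.

Lemma measurable_ar_Lam lam n : measurable_fun setT (ar_Lam lam n).
Proof. exact: past_measurable_fun (@ar_Lam_past lam n). Qed.

Lemma measurable_noise_squares n : measurable_fun setT (noise_squares n).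
Proof. exact: past_measurable_fun (@noise_squares_past n). Qed.

Lemma measurable_ar_squares n : measurable_fun setT (ar_squares n).
Proof.
by apply: measurable_sum => k; apply: measurable_funX; exact: measurable_ar.
Qed.

Lemma measurable_excess (f : T -> R) A : measurable_fun setT f ->
  measurable_fun setT (fun w => Num.max (`|f w| - A) 0 ^+ 2).
Proof. by move=> mf; solve_measurable. Qed.

(** Sums of functions of fresh noise behave as sums of i.i.d. terms, even when
    weighted by a factor that only depends on the past. *)
Lemma mgf_sum_noise (F : T -> R) (f : R -> R) (B : R) n :
  measurable_fun setT (F : past xi 0 -> R) -> (forall w, 0 <= F w) ->
  measurable_fun setT f ->
  (\int[P]_w (expR (f (xi 0 w)))%:E <= (expR B)%:E)%E ->
  (\int[P]_w (F w * expR (\sum_(0 <= k < n) f (noise k w)))%:E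
    <= (expR (n%:R * B))%:E * \int[P]_w (F w)%:E)%E.
Proof.
move=> mF F0 mf fB; elim: n => [|n IH].
  under eq_integral do rewrite big_geq// expR0 mulr1.
  by rewrite mul0r expR0 mul1e.
under eq_integral do rewrite big_nat_recr//= expRD mulrA.
rewrite (integral_one_step_prod xi_indep xi_ident
    (k := n%:Z) (F := fun w => F w * expR (\sum_(0 <= k < n) f (noise k w)))
    (h := fun x => expR (f x))); first last.
- by move=> x; exact: expR_ge0.
- by move=> w; rewrite mulr_ge0 ?expR_ge0.
- exact: (measurableT_comp (@measurable_expR _)).
- apply: measurable_funM; first by apply: past_incl mF; rewrite lez_nat.
  apply: (measurableT_comp (@measurable_expR _)).
  by apply: past_partial_sum => k; apply: measurableT_comp => //; exact: noise_past.
apply: le_trans (lee_pmul _ _ fB IH) _.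
- by apply: integral_ge0 => w _; rewrite lee_fin expR_ge0.
- by apply: integral_ge0 => w _; rewrite lee_fin mulr_ge0 ?expR_ge0.
by rewrite muleA -EFinM -expRD -[in leRHS]addn1 natrD mulrDl mul1r addrC.
Qed.

(** The conditional Laplace transform of [xi_{k+1}] at [lam X_k] is
    [exp (Lam (lam X_k))], so dividing by it makes the mean constant. *)
Lemma exponential_martingale lam n :
  (\int[P]_w (expR (lam * ar_noise n w - ar_Lam lam n w))%:E = 1)%E.
Proof.
elim: n => [|n IH].
  under eq_integral do rewrite /ar_noise /ar_Lam !big_geq// mulr0 subr0 expR0.
  exact: integral_prob_cst.
transitivity (1 * \int[P]_w (expR (lam * ar_noise n w - ar_Lam lam n w))%:E)%E;
  last by rewrite IH mul1e.
rewrite -(integral_one_step xi_indep xi_ident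
    (k := n%:Z) (Z := ar n) (g := fun u => expR (lam * u.1 * u.2 - Lam (lam * u.1)))).
- apply: eq_integral => w _; rewrite /= -expRD; congr (expR _)%:E.
  rewrite /ar_noise /ar_Lam !big_nat_recr//=; ring.
- apply: (measurableT_comp (@measurable_expR _)); apply: measurable_funB.
    by apply: measurable_funM => //; exact: ar_noise_past.
  exact: ar_Lam_past.
- exact: ar_past.
- apply: (measurableT_comp (@measurable_expR _)); apply: measurable_funB.
    by apply: measurable_funM => //; apply: measurable_funM.
  apply: (measurableT_comp (nb_Lam_meas nb)); exact: measurable_funM.
- by move=> w; exact: expR_ge0.
- by move=> u; exact: expR_ge0.
- by move=> z; exact: (nb_Lam nb (lam * z)).
Qed.

Lemma mgf_squares_le c n : 0 <= c <= a ->
  (\int[P]_w (expR (c * (rho ^+ 2 * ar_squares n w)))%:E <=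
   (expR (C1 * c * (rho^-1 + n%:R)))%:E)%E.
Proof.
move=> ca; have /andP[c0 _] := ca.
pose F w := expR (c * (rho * ar 0 w ^+ 2)).
have mF : measurable_fun setT (F : past xi 0 -> R).
  have := @ar_past 0; rewrite /F; move: (ar 0) => x mx.
  by solve_measurable.
apply: (@le_trans _ _ (\int[P]_w (F w * expR (\sum_(0 <= k < n) c * noise k w ^+ 2))%:E)%E).
  apply: ge0_le_integral => //.
  - apply/measurable_EFinP; apply: (measurableT_comp (@measurable_expR _)).
    apply: measurable_funM => //; apply: measurable_funM => //.
    exact: measurable_ar_squares.
  - apply/measurable_EFinP; apply: measurable_funM.
      exact: past_measurable_fun mF.
    apply: (measurableT_comp (@measurable_expR _)); apply: measurable_sum => k.
    by solve_measurable.
  - move=> w _; rewrite lee_fin /F -expRD ler_expR -big_distrr/= -mulrDr.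
    by apply: ler_wpM2l => //;
    exact: (@sum_squares_le _ _ theta01 (ar^~ w) (fun k => noise k w) n (fun=> erefl)).
have /= := mgf_sum_noise n mF (fun w => expR_ge0 _) (f := fun x => c * x ^+ 2)
  _ (nb_sq nb ca).
move=> h; apply: le_trans (h _) _; first by solve_measurable.
apply: (@le_trans _ _ ((expR (n%:R * (C1 * c)))%:E * (expR (C1 * c / rho))%:E)%E).
  by apply: lee_wpmul2l; [rewrite lee_fin expR_ge0|exact: ar_sq_mgf].
rewrite -EFinM -expRD lee_fin ler_expR le_eqVlt; apply/orP; left; apply/eqP.
by ring.
Qed.

(** Completing the exponential martingale at [2 lam] and bounding the
    compensator by the crude bound on the squares of the process; the product
    is split by the arithmetic-geometric mean inequality. *)
Lemma crude_mgf lam n : 4 * K * lam ^+ 2 <= a * rho ^+ 2 ->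
  (\int[P]_w (expR (lam * ar_noise n w))%:E <=
   (expR (C1 * (4 * K * lam ^+ 2 / rho ^+ 2) * (rho^-1 + n%:R)))%:E)%E.
Proof.
move=> lama; set c := 4 * K * lam ^+ 2 / rho ^+ 2.
have K0 := nb_K nb.
have r20 : 0 < rho ^+ 2 by rewrite exprn_gt0.
have ca : 0 <= c <= a.
  rewrite /c ler_pdivrMr// lama andbT.
  apply: divr_ge0; last exact: ltW.
  by apply: mulr_ge0; [exact: mulr_ge0|exact: sqr_ge0].
set B := C1 * c * _.
have B0 : 0 <= B.
  have /andP[c0 _] := ca.
  apply: mulr_ge0; first by apply: mulr_ge0 => //; exact: nb_C1 nb.
  by rewrite addr_ge0// invr_ge0 ltW.
(* [exp (lam M)] is the geometric mean of a martingale [D] at [2 lam] and of a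
   quantity dominated by [E] *)
pose D w := expR (2 * lam * ar_noise n w - ar_Lam (2 * lam) n w).
pose E w := expR (c * (rho ^+ 2 * ar_squares n w)).
have mD : measurable_fun setT D.
  apply: (measurableT_comp (@measurable_expR _)); apply: measurable_funB.
    by apply: measurable_funM => //; exact: measurable_ar_noise.
  exact: measurable_ar_Lam.
have mE : measurable_fun setT E.
  apply: (measurableT_comp (@measurable_expR _)).
  apply: measurable_funM => //; apply: measurable_funM => //.
  exact: measurable_ar_squares.
have LamS w : ar_Lam (2 * lam) n w <= c * (rho ^+ 2 * ar_squares n w).
  rewrite mulrA /c divfK ?gt_eqF// /ar_squares big_distrr/=.
  apply: ler_sum => k _; apply: le_trans (nb_Lam_le nb _) _.
  by rewrite le_eqVlt; apply/orP; left; apply/eqP; ring.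
have pw w : expR (lam * ar_noise n w) <=
    expR B / 2 * D w + expR (- B) / 2 * E w.
  have -> : expR B / 2 * D w + expR (- B) / 2 * E w =
     (expR (B + (2 * lam * ar_noise n w - ar_Lam (2 * lam) n w)) +
      expR (- B + c * (rho ^+ 2 * ar_squares n w))) / 2.
    by rewrite (expRD B) (expRD (- B)) -/(D w) -/(E w); lra.
  set u := B + _; set v := - B + _.
  apply: (@le_trans _ _ (expR ((u + v) / 2))).
    by rewrite ler_expR /u /v; have := LamS w; lra.
  have -> : expR u = expR (u / 2) ^+ 2 by rewrite -expRM_natr divfK.
  have -> : expR v = expR (v / 2) ^+ 2 by rewrite -expRM_natr divfK.
  rewrite mulrDl expRD.
  have := sqr_ge0 (expR (u / 2) - expR (v / 2)); rewrite sqrrB; lra.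
apply: (@le_trans _ _ (\int[P]_w ((expR B / 2)%:E * (D w)%:E +
    (expR (- B) / 2)%:E * (E w)%:E))%E).
  apply: ge0_le_integral => //.
  - apply/measurable_EFinP; apply: (measurableT_comp (@measurable_expR _)).
    by apply: measurable_funM => //; exact: measurable_ar_noise.
  - by apply/measurable_EFinP; apply: measurable_funD; apply: measurable_funM.
  - by move=> w _; rewrite -!EFinM -EFinD lee_fin.
have e0 x : (0 <= (expR x)%:E :> \bar R)%E by rewrite lee_fin expR_ge0.
have e20 x : (0 <= (expR x / 2)%:E :> \bar R)%E by rewrite lee_fin divr_ge0 ?expR_ge0.
rewrite ge0_integralD//; first last.
- by apply/measurable_EFinP; apply: measurable_funM.
- by move=> w _; apply: mule_ge0 => //; exact: e0.
- by apply/measurable_EFinP; apply: measurable_funM.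
- by move=> w _; apply: mule_ge0 => //; exact: e0.
rewrite !ge0_integralZl//; first last.
- by move=> w _; exact: e0.
- exact/measurable_EFinP.
- by move=> w _; exact: e0.
- exact/measurable_EFinP.
rewrite exponential_martingale mule1.
apply: (@le_trans _ _ ((expR B / 2)%:E + (expR (- B) / 2)%:E * (expR (B + B))%:E)%E).
  apply: leeD => //; apply: lee_wpmul2l => //.
  apply: le_trans (mgf_squares_le n ca) _; rewrite lee_fin ler_expR -/B.
  by rewrite lerDl.
rewrite -EFinM -EFinD lee_fin mulrAC -expRD addKr; lra.
Qed.

End ExponentialMartingale.

Arguments ar : simpl never.

(** * The asymptotic regime *)

Section Regime.
Context {R : realType}.
Implicit Types (kap theta b D eps tau : R) (n : nat).

(** The assumptions on [theta], [b] and [n] up to precision [kap].  Estimates are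
    proved for fixed parameters in the regime of some explicit [kap]; along the
    sequences of the theorem every regime is eventually entered. *)
Definition regime kap theta b n : Prop :=
  [/\ 1 <= kap, 0 <= theta < 1, kap * (1 - theta) <= 1, kap <= b &
      kap * b <= Num.sqrt n%:R * (1 - theta) ^+ 2].

Lemma regime_le kap kap' theta b n : 1 <= kap -> kap <= kap' ->
  regime kap' theta b n -> regime kap theta b n.
Proof.
move=> k1 kk' [k'1 t01 kr kb kn]; have /andP[_ t1] := t01.
split => //.
- by apply: le_trans kr; rewrite ler_wpM2r// subr_ge0 ltW.
- exact: le_trans kb.
- apply: le_trans kn; rewrite ler_wpM2r//.
  by apply: le_trans kb; apply: le_trans k'1.
Qed.

(** [budget] is the speed at which all exceptional events will be shown to
    become negligible; it dominates the speed [b^2] of the moderate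
    deviations. *)
Definition budget theta b : R := b ^+ 2 / (1 - theta).

Context {kap theta b : R} {n : nat}.
Hypothesis reg : regime kap theta b n.
Local Notation rho := (1 - theta).
Local Notation w := (budget theta b).

Let kap1 : 1 <= kap. Proof. by have [] := reg. Qed.
Let kap0 : 0 <= kap. Proof. exact: le_trans kap1. Qed.

Lemma regime_rho_gt0 : 0 < rho.
Proof. by have [_ /andP[_ t1] _ _ _] := reg; rewrite subr_gt0. Qed.

Lemma regime_rho_le1 : rho <= 1.
Proof. by have [_ /andP[t0 _] _ _ _] := reg; rewrite gerBl. Qed.

Lemma regime_b_ge1 : 1 <= b.
Proof. by have [_ _ _ kb _] := reg; exact: le_trans kb. Qed.

Let r0 := regime_rho_gt0.
Let r1 := regime_rho_le1.
Let b1 := regime_b_ge1.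
Let b0 : 0 <= b. Proof. exact: le_trans b1. Qed.

Lemma regime_sq_le : b ^+ 2 <= w.
Proof. by rewrite /budget ler_pdivlMr// ler_piMr// sqr_ge0. Qed.

Lemma regime_budget_ge1 : 1 <= w.
Proof. by apply: le_trans regime_sq_le; exact: exprn_ege1. Qed.

Lemma regime_inv_rho_le : rho^-1 <= w.
Proof.
by rewrite /budget -[leLHS]mul1r ler_wpM2r ?invr_ge0 ?(ltW r0)// exprn_ege1.
Qed.

Lemma regime_n4 : kap * b ^+ 2 <= n%:R * rho ^+ 4.
Proof.
have [_ _ _ kb kn] := reg.
apply: (@le_trans _ _ ((kap * b) ^+ 2)).
  by rewrite exprMn ler_wpM2r ?sqr_ge0// expr2 ler_peMr.
have -> : n%:R * rho ^+ 4 = (Num.sqrt n%:R * rho ^+ 2) ^+ 2.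
  by rewrite exprMn sqr_sqrtr// -exprM.
by apply: lerXn2r; rewrite ?nnegrE ?mulr_ge0 ?sqr_ge0 ?sqrtr_ge0 ?(ltW r0).
Qed.

Lemma regime_n3 : kap * w <= n%:R * rho ^+ 3.
Proof.
rewrite /budget mulrA ler_pdivrMr//; apply: le_trans regime_n4 _.
by rewrite [rho ^+ 4]exprSr mulrA.
Qed.

Lemma regime_n2 : kap * w <= n%:R * rho ^+ 2.
Proof.
apply: le_trans regime_n3 _; apply: ler_wpM2l => //; apply: ler_wiXn2l => //; exact: ltW.
Qed.

Lemma regime_n1 : kap * w <= n%:R * rho.
Proof.
apply: le_trans regime_n2 _.
apply: ler_wpM2l => //; rewrite expr2 ler_piMr//; exact: ltW.
Qed.

Lemma regime_bn : kap * w <= rho * (b * Num.sqrt n%:R).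
Proof.
have [_ _ _ kb kn] := reg.
rewrite /budget mulrA ler_pdivrMr//.
rewrite [leRHS](_ : _ = b * (Num.sqrt n%:R * rho ^+ 2)); last by ring.
by rewrite expr2 mulrA [leLHS]mulrC ler_wpM2l.
Qed.

Lemma regime_n_gt0 : (0 < n)%N.
Proof.
case: (posnP n) => // n0; have := regime_n1; rewrite n0 mul0r.
have := regime_budget_ge1 => w1; rewrite leNgt mulr_gt0//.
  exact: lt_le_trans kap1.
exact: lt_le_trans w1.
Qed.

Lemma regime_v : rho <= 1 - theta ^+ 2 <= 2 * rho.
Proof.
have [_ /andP[t0 t1] _ _ _] := reg.
have -> : 1 - theta ^+ 2 = rho * (1 + theta) by ring.
apply/andP; split; first by rewrite ler_peMr ?(ltW r0)// lerDl.
by rewrite mulrC ler_wpM2r ?(ltW r0)//; lra.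
Qed.

End Regime.

Section Markov.
Context {d : measure_display} {T : measurableType d} {R : realType}
  (P : probability T R).

Lemma exp_markov (f : T -> R) (B : R) : measurable_fun setT f ->
  (\int[P]_w (expR (f w))%:E <= (expR B)%:E)%E ->
  (P [set w | (0 <= f w)%R] <= (expR B)%:E)%E.
Proof.
move=> mf; apply: le_trans.
have mA : measurable [set w | 0 <= f w].
  by rewrite -[X in measurable X]setTI; apply: measurable_fun_le.
rewrite -[X in P X]setIT -integral_indic//.
apply: ge0_le_integral => //.
- by apply/measurable_EFinP; exact: measurable_indic.
- by apply/measurable_EFinP; exact: (measurableT_comp (@measurable_expR _)).
- move=> w _; rewrite lee_fin indicE; case: (boolP (w \in _)) => /=.
    by rewrite inE /= => fw; rewrite -expR0 ler_expR.
  by move=> _; exact: expR_ge0.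
Qed.

(** A finite union bound in which each event is that of an exponent being
    nonnegative. *)
Lemma exp_markov_union (A : set T) (m : nat) (f : nat -> T -> R) (B : R) :
  measurable A ->
  (forall i, (i < m)%N -> measurable_fun setT (f i) /\
     (\int[P]_w (expR (f i w))%:E <= (expR B)%:E)%E) ->
  (forall w, A w -> exists2 i, (i < m)%N & 0 <= f i w) ->
  (P A <= (m%:R * expR B)%:E)%E.
Proof.
move=> mA fB Af.
have mf (i : 'I_m) : measurable [set w | 0 <= f i w].
  rewrite -[X in measurable X]setTI; apply: measurable_fun_le => //.
  by have [] := fB i (ltn_ord i).
apply: (@le_trans _ _ (\sum_(i < m) P [set w | (0 <= f i w)%R])%E).
  apply: (@le_trans _ _ (P (\big[setU/set0]_(i < m) [set w | (0 <= f i w)%R]))).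
    apply: le_measure; rewrite ?inE//.
      by apply: bigsetU_measurable => i _; exact: mf.
    move=> w /Af[i im fw].
    by rewrite -(bigcup_mkord m (fun i => [set w | 0 <= f i w])); exists i.
  apply: (Boole_inequality P (A := fun i => [set w | 0 <= f i w])) => i im.
  exact: (mf (Ordinal im)).
apply: (@le_trans _ _ (\sum_(i < m) (expR B)%:E)%E).
  apply: lee_sum => i _; have [mfi fiB] := fB i (ltn_ord i).
  exact: exp_markov.
by rewrite sumEFin lee_fin sumr_const card_ord mulr_natl.
Qed.

End Markov.

(** * Tails of the exceptional quantities *)

Section Tails.
Context {d : measure_display} {T : measurableType d} {R : realType}
  (P : probability T R) (xi : int -> {RV P >-> R})
  (s2 a C1 C2 J K : R) (Lam : R -> R).
Hypothesis xi_indep : mutually_independent xi.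
Hypothesis xi_ident : identically_distributed xi.
Hypothesis nb : noise_bounds P (xi 0) s2 a C1 C2 J K Lam.

Implicit Types (theta b eps del D kap : R) (n : nat).
Local Notation noise k := (xi (k%:Z + 1)).
Local Notation ar := (ar xi).

Let a0 : 0 < a := nb_a nb.
Let C10 : 0 <= C1 := nb_C1 nb.
Let C20 : 0 <= C2 := nb_C2 nb.
Let J0 : 0 <= J := nb_J nb.
Let K0 : 0 <= K := nb_K nb.

Lemma integral_expRB (g : T -> R) (B c : R) : measurable_fun setT g ->
  (\int[P]_w (expR (g w))%:E <= (expR B)%:E)%E ->
  (\int[P]_w (expR (g w - c))%:E <= (expR (B - c))%:E)%E.
Proof.
move=> mg gB; under eq_integral do rewrite expRD mulrC EFinM.
rewrite ge0_integralZl//; last first.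
  by apply/measurable_EFinP; exact: (measurableT_comp (@measurable_expR _)).
by rewrite expRD mulrC EFinM; apply: lee_wpmul2l; rewrite ?lee_fin ?expR_ge0.
Qed.

Lemma regime_mul_le kap theta b n c : regime kap theta b n -> c <= kap ->
  c * (1 - theta) <= 1.
Proof.
move=> reg ck; have [_ _ kr _ _] := reg; apply: le_trans kr.
by rewrite ler_wpM2r// (ltW (regime_rho_gt0 reg)).
Qed.

Lemma mgf_sum_noise1 (f : R -> R) (B : R) n : measurable_fun setT f ->
  (\int[P]_w (expR (f (xi 0 w)))%:E <= (expR B)%:E)%E ->
  (\int[P]_w (expR (\sum_(0 <= k < n) f (noise k w)))%:E <= (expR (n%:R * B))%:E)%E.
Proof.
move=> mf fB.
have := @mgf_sum_noise _ _ _ _ _ xi_indep xi_ident (fun=> 1) f B n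
  (measurable_cst _) (fun=> ler01) mf fB.
by rewrite integral_prob_cst mule1; under eq_integral do rewrite mul1r.
Qed.

(** Chernoff's bound at the parameter [rho], which is small enough for the
    quadratic term of the exponent to be negligible. *)
Lemma noise_squares_tail eps D : 0 < eps -> 0 <= D ->
  exists2 kap, 1 <= kap & forall theta b n sg, regime kap theta b n ->
    `|sg| = 1 ->
    (\int[P]_w (expR (sg * (1 - theta) * (noise_squares xi n w - n%:R * s2)
        - (1 - theta) * eps * n%:R))%:E <= (expR (- (D * budget theta b)))%:E)%E.
Proof.
move=> e0 D0.
have p1 : 0 <= 2 * D / eps by rewrite divr_ge0 ?mulr_ge0// ltW.
have p2 : 0 <= 2 * C2 / eps by rewrite divr_ge0 ?mulr_ge0// ltW.
have p3 : 0 <= 2 / a by rewrite divr_ge0// ltW.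
exists (1 + 2 * D / eps + 2 * C2 / eps + 2 / a); first by lra.
move=> theta b n sg reg sg1; set rho := 1 - theta.
have r0 : 0 < rho := regime_rho_gt0 reg.
have ra : rho <= a / 2.
  have : 2 / a * rho <= 1 by apply: regime_mul_le reg _; lra.
  by rewrite mulrAC ler_pdivrMr// mul1r ler_pdivlMr// mulrC.
have rC2 : C2 * rho <= eps / 2.
  have : 2 * C2 / eps * rho <= 1 by apply: regime_mul_le reg _; lra.
  rewrite mulrAC ler_pdivrMr// mul1r; lra.
have sgr : `|sg * rho| = rho by rewrite normrM sg1 mul1r gtr0_norm.
have mQ := @measurable_noise_squares _ _ _ _ xi n.
apply: (@le_trans _ _ (expR (n%:R * (C2 * rho ^+ 2) - rho * eps * n%:R))%:E).
  apply: (integral_expRB (g := fun w => sg * rho * (noise_squares xi n w - n%:R * s2))).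
    by apply: measurable_funM => //; exact: measurable_funB.
  have E w : sg * rho * (noise_squares xi n w - n%:R * s2) =
      \sum_(0 <= k < n) sg * rho * (noise k w ^+ 2 - s2).
    by rewrite -big_distrr/= sumrB big_const_nat iter_addr addr0 subn0 mulr_natl.
  under eq_integral do rewrite E.
  apply: (@mgf_sum_noise1 (fun x => sg * rho * (x ^+ 2 - s2)) (C2 * rho ^+ 2) n).
    by solve_measurable.
  apply: le_trans (nb_centered nb _) _; first by rewrite sgr.
  by rewrite lee_fin ler_expR -[in leLHS]real_normK ?num_real// sgr.
rewrite lee_fin ler_expR.
have w0 : 0 <= budget theta b by apply: le_trans (regime_budget_ge1 reg).
have h1 : n%:R * rho * (C2 * rho) <= n%:R * rho * (eps / 2).
  by rewrite ler_wpM2l// mulr_ge0// ltW.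
have h2 : eps / 2 * (2 * D / eps * budget theta b) <= eps / 2 * (n%:R * rho).
  apply: ler_wpM2l; first by rewrite divr_ge0// ltW.
  apply: le_trans (regime_n1 reg); rewrite ler_wpM2r//; lra.
have h3 : eps / 2 * (2 * D / eps * budget theta b) = D * budget theta b.
  by field; rewrite gt_eqF.
rewrite h3 in h2; rewrite expr2; lra.
Qed.

(** With parameter [tau * rho^2] the crude bound has exponent of order
    [tau^2 * rho^2 * n], beaten by [tau * rho^2 * eps * n] once [tau] is small. *)
Lemma ar_noise_tail eps D : 0 < eps -> 0 <= D ->
  exists2 tau, 0 < tau & exists2 kap, 1 <= kap &
  forall theta b n sg, regime kap theta b n -> `|sg| = 1 ->
    (\int[P]_w (expR (sg * (tau * (1 - theta) ^+ 2) * ar_noise xi theta n w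
        - tau * (1 - theta) ^+ 2 * eps * n%:R))%:E
      <= (expR (- (D * budget theta b)))%:E)%E.
Proof.
move=> e0 D0; have aw := ltW a0; have ew := ltW e0.
pose L := 16 * C1 * K / eps + 4 * K / a + 1.
have L1 : 1 <= L.
  by rewrite /L lerDr addr_ge0// divr_ge0 ?mulr_ge0// ltW.
have L0 : 0 < L by exact: lt_le_trans L1.
pose tau := L^-1; have tau0 : 0 < tau by rewrite invr_gt0.
have tau1 : tau <= 1 by rewrite invf_le1.
have t1 : 8 * C1 * K * tau <= eps / 2.
  rewrite /tau ler_pdivrMr// /L mulrDr mulrDr mulr1.
  have -> : eps / 2 * (16 * C1 * K / eps) = 8 * C1 * K by field; rewrite gt_eqF.
  rewrite -addrA lerDl addr_ge0 ?divr_ge0 ?(ltW e0)//.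
  by rewrite !mulr_ge0 ?invr_ge0.
have t2 : 4 * K * tau ^+ 2 <= a.
  apply: (@le_trans _ _ (4 * K * tau)).
    by rewrite ler_wpM2l ?mulr_ge0// expr2 ler_piMr// ltW.
  rewrite /tau ler_pdivrMr// /L mulrDr mulrDr mulr1.
  have -> : a * (4 * K / a) = 4 * K by field; rewrite gt_eqF.
  rewrite addrAC lerDr addr_ge0 ?(ltW a0)//.
  by rewrite !mulr_ge0 ?invr_ge0.
have p1 : 0 <= 2 * D / (tau * eps) by rewrite divr_ge0 ?mulr_ge0// ltW.
exists tau => //; exists (1 + 2 * D / (tau * eps)); first by lra.
move=> theta b n sg reg sg1; set rho := 1 - theta.
have r0 : 0 < rho := regime_rho_gt0 reg.
have r1 : rho <= 1 := regime_rho_le1 reg.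
have [_ th01 _ _ _] := reg.
have w1 := regime_budget_ge1 reg; have w0 := le_trans ler01 w1.
have sg2 : sg ^+ 2 = 1 by rewrite -real_normK ?num_real// sg1 expr1n.
set lam := tau * rho ^+ 2.
have lam2 : 4 * K * (sg * lam) ^+ 2 <= a * rho ^+ 2.
  rewrite exprMn sg2 mul1r /lam exprMn mulrA.
  apply: (@le_trans _ _ (a * (rho ^+ 2) ^+ 2)); first by rewrite ler_wpM2r ?sqr_ge0.
  rewrite ler_wpM2l ?(ltW a0)// -exprM ler_wiXn2l// ltW//.
have mM := measurable_ar_noise xi theta n.
apply: le_trans (integral_expRB _ _ (crude_mgf xi_indep xi_ident th01 nb n lam2)) _.
  exact: measurable_funM.
rewrite lee_fin ler_expR.
have -> : 4 * K * (sg * lam) ^+ 2 / rho ^+ 2 = 4 * K * tau ^+ 2 * rho ^+ 2.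
  by rewrite exprMn sg2 mul1r /lam; field; rewrite gt_eqF.
have nrho : rho^-1 <= n%:R.
  by rewrite -[leLHS]mul1r ler_pdivrMr// (le_trans _ (regime_n1 reg))// mulr_ege1//; lra.
set c := 4 * K * tau ^+ 2 * rho ^+ 2.
have nr0 : 0 <= n%:R * rho ^+ 2 by rewrite mulr_ge0// sqr_ge0.
have h0 : C1 * c * (rho^-1 + n%:R) <= (8 * C1 * K * tau) * (tau * (n%:R * rho ^+ 2)).
  have -> : 8 * C1 * K * tau * (tau * (n%:R * rho ^+ 2)) = C1 * c * (n%:R + n%:R).
    by rewrite /c; ring.
  apply: ler_wpM2l; last by rewrite lerD2r.
  rewrite /c mulr_ge0// mulr_ge0 ?sqr_ge0// mulr_ge0 ?sqr_ge0//.
  exact: mulr_ge0.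
have h1 : 8 * C1 * K * tau * (tau * (n%:R * rho ^+ 2)) <=
    eps / 2 * (tau * (n%:R * rho ^+ 2)).
  by apply: ler_wpM2r => //; apply: mulr_ge0 => //; exact: ltW.
have h2 : tau * eps / 2 * (2 * D / (tau * eps) * budget theta b) <=
    tau * eps / 2 * (n%:R * rho ^+ 2).
  apply: ler_wpM2l; first by rewrite divr_ge0// mulr_ge0// ltW.
  apply: le_trans (regime_n2 reg); rewrite ler_wpM2r//; lra.
have h3 : tau * eps / 2 * (2 * D / (tau * eps) * budget theta b) = D * budget theta b.
  by field; rewrite !gt_eqF.
rewrite h3 in h2; rewrite /lam; lra.
Qed.

Lemma ar_tail eps D : 0 < eps -> 0 <= D ->
  exists2 kap, 1 <= kap & forall theta b n k z, regime kap theta b n ->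
    eps * (kap * budget theta b) <= (1 - theta) * z ->
    (\int[P]_w (expR (a * (1 - theta) * ar theta k w ^+ 2 - a * (1 - theta) * z))%:E
      <= (expR (- (D * budget theta b)))%:E)%E.
Proof.
move=> e0 D0.
have p1 : 0 <= (D + C1 * a) / (a * eps).
  by rewrite divr_ge0 ?addr_ge0 ?mulr_ge0// ltW.
exists (1 + (D + C1 * a) / (a * eps)); first by lra.
move=> theta b n k z reg hz; set rho := 1 - theta.
have r0 : 0 < rho := regime_rho_gt0 reg.
have [_ th01 _ _ _] := reg.
have w1 := regime_budget_ge1 reg; have w0 := le_trans ler01 w1.
have mx := measurable_ar xi theta k.
have ha : 0 <= a <= a by rewrite (ltW a0) lexx.
apply: le_trans (integral_expRB (B := C1 * a / rho) _ _ _) _.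
- by solve_measurable.
- under eq_integral do rewrite -mulrA.
  exact: (ar_sq_mgf xi_indep xi_ident th01 nb k ha).
rewrite lee_fin ler_expR.
have h1 : C1 * a * rho^-1 <= C1 * a * budget theta b.
  by rewrite ler_wpM2l ?(regime_inv_rho_le reg)// mulr_ge0// ltW.
have h2 : a * (eps * ((1 + (D + C1 * a) / (a * eps)) * budget theta b)) <=
    a * (rho * z) by rewrite ler_wpM2l// ltW.
have h3 : a * (eps * ((1 + (D + C1 * a) / (a * eps)) * budget theta b)) =
  a * eps * budget theta b + (D + C1 * a) * budget theta b.
  by field; rewrite !gt_eqF.
have h4 : 0 <= a * eps * budget theta b := mulr_ge0 (mulr_ge0 (ltW a0) (ltW e0)) w0.
lra.
Qed.

(** The size of the process beyond which [Lam] at the tilts of interest is no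
    longer in its quadratic range.  For the noise the corresponding threshold is
    [rho * level], which tends to infinity by the rate assumption. *)
Definition level (del theta b : R) n : R :=
  del * Num.sqrt n%:R / (b * Num.sqrt (1 - theta ^+ 2)).

Definition noise_excess (c : R) n (w : T) : R :=
  \sum_(0 <= k < n) Num.max (`|noise k w| - c) 0 ^+ 2.

Lemma level_sq_ge kap del theta b n : regime kap theta b n -> 0 < del ->
  del ^+ 2 * kap / (2 * (1 - theta)) <= ((1 - theta) * level del theta b n) ^+ 2.
Proof.
move=> reg del0; set rho := 1 - theta.
have r0 : 0 < rho := regime_rho_gt0 reg.
have r1 : rho <= 1 := regime_rho_le1 reg.
have b0 : 0 < b by apply: lt_le_trans (regime_b_ge1 reg).
have /andP[v1 v2] := regime_v reg; rewrite -/rho in v1 v2.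
set v := 1 - theta ^+ 2 in v1 v2 *.
have v0 : 0 < v by exact: lt_le_trans v1.
have -> : (rho * level del theta b n) ^+ 2 = rho ^+ 2 * del ^+ 2 * n%:R / (b ^+ 2 * v).
  rewrite /level -/v !exprMn exprVn exprMn sqr_sqrtr// sqr_sqrtr ?(ltW v0)//.
  by rewrite !mulrA.
have k0 : 0 <= kap by have [k1 _ _ _ _] := reg; exact: le_trans k1.
rewrite ler_pdivlMr ?mulr_gt0 ?exprn_gt0//.
apply: (@le_trans _ _ (del ^+ 2 * kap / (2 * rho) * (b ^+ 2 * (2 * rho)))).
  apply: ler_wpM2l; first by rewrite divr_ge0 ?mulr_ge0 ?sqr_ge0// ltW.
  by rewrite ler_wpM2l ?sqr_ge0.
have -> : del ^+ 2 * kap / (2 * rho) * (b ^+ 2 * (2 * rho)) = del ^+ 2 * (kap * b ^+ 2).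
  by field; rewrite gt_eqF.
rewrite (mulrC (rho ^+ 2)) -[leRHS]mulrA ler_wpM2l ?sqr_ge0//.
apply: le_trans (regime_n4 reg) _; rewrite mulrC ler_wpM2r//.
by rewrite ler_wiXn2l// ltW.
Qed.

(** A single term exceeds the threshold with a probability so small, compared to
    [rho], that the mean of the sum is negligible before [eps * n * rho]. *)
Lemma noise_excess_tail eps del D : 0 < eps -> 0 < del -> 0 <= D ->
  exists2 kap, 1 <= kap & forall theta b n, regime kap theta b n ->
    (\int[P]_w (expR (a * noise_excess ((1 - theta) * level del theta b n) n w
        - a * (eps * n%:R * (1 - theta))))%:E
      <= (expR (- (D * budget theta b)))%:E)%E.
Proof.
move=> e0 del0 D0.
have p1 : 0 <= 2 * D / (a * eps) by rewrite divr_ge0 ?mulr_ge0// ltW.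
pose q := a ^+ 2 * del ^+ 2 * eps.
have q0 : 0 < q by rewrite !mulr_gt0 ?exprn_gt0.
have p2 : 0 <= 4 * J / q by rewrite divr_ge0 ?mulr_ge0// ltW.
set kap := 1 + 2 * D / (a * eps) + 4 * J / q.
have k1 : 1 <= kap by rewrite /kap; lra.
exists kap => // theta b n reg; set rho := 1 - theta.
have r0 : 0 < rho := regime_rho_gt0 reg.
have [_ th01 _ _ _] := reg.
have w1 := regime_budget_ge1 reg; have w0 := le_trans ler01 w1.
set c := rho * level del theta b n.
have b0 : 0 < b by apply: lt_le_trans (regime_b_ge1 reg).
have c0 : 0 <= c.
  rewrite /c mulr_ge0 ?(ltW r0)// /level divr_ge0 ?mulr_ge0 ?sqrtr_ge0//.
    exact: ltW.
  exact: ltW.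
set y := a * c ^+ 2.
have mf : measurable_fun setT (fun x : R => a * Num.max (`|x| - c) 0 ^+ 2).
  by solve_measurable.
have mex : measurable_fun setT (fun w => a * noise_excess c n w).
  apply: measurable_funM => //; apply: measurable_sum => k.
  exact: measurable_excess.
apply: le_trans (integral_expRB (B := n%:R * (J * expR (- y))) _ mex _) _.
  under eq_integral do rewrite /noise_excess big_distrr/=.
  apply: (mgf_sum_noise1 n mf); apply: le_trans (nb_excess nb c0) _.
  by rewrite lee_fin (mulrC J); exact: expR_ge1Dx.
rewrite lee_fin ler_expR.
have hy : J * expR (- y) <= a * eps * rho / 2.
  (* [exp (- y) <= 1 / y <= 1 / y0] *)
  pose y0 := a * (del ^+ 2 * kap / (2 * rho)).
  have y00 : 0 < y0.
    by rewrite mulr_gt0// divr_gt0 ?mulr_gt0 ?exprn_gt0// (lt_le_trans _ k1).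
  have yy : y0 <= y by rewrite ler_wpM2l ?(ltW a0)//; exact: level_sq_ge.
  have h1 : expR (- y) <= y0^-1.
    rewrite expRN lef_pV2 ?posrE ?expR_gt0//.
    by apply: le_trans yy _; apply: le_trans (expR_ge1Dx _); rewrite lerDr.
  apply: le_trans (ler_wpM2l J0 h1) _.
  rewrite ler_pdivrMr//.
  have -> : a * eps * rho / 2 * y0 = q * kap / 4.
    by rewrite /y0 /q; field; rewrite gt_eqF.
  rewrite ler_pdivlMr// mulrC /kap !mulrDr.
  have -> : q * (4 * J / q) = 4 * J by field; rewrite gt_eqF.
  rewrite lerDr addr_ge0// ?mulr1 ?(ltW q0)// mulr_ge0//; exact: ltW.
have h1 : n%:R * (J * expR (- y)) <= n%:R * (a * eps * rho / 2) by rewrite ler_wpM2l.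
have h2 : a * eps / 2 * (2 * D / (a * eps) * budget theta b) <= a * eps / 2 * (n%:R * rho).
  apply: ler_wpM2l; first by rewrite divr_ge0// mulr_ge0// ltW.
  apply: le_trans (regime_n1 reg); rewrite ler_wpM2r// /kap; lra.
have h3 : a * eps / 2 * (2 * D / (a * eps) * budget theta b) = D * budget theta b.
  by field; rewrite !gt_eqF.
rewrite h3 in h2; lra.
Qed.

End Tails.

(** * The good event *)

Section GoodEvent.
Context {d : measure_display} {T : measurableType d} {R : realType}
  (P : probability T R) (xi : int -> {RV P >-> R})
  (s2 a C1 C2 J K : R) (Lam : R -> R).
Hypothesis xi_indep : mutually_independent xi.
Hypothesis xi_ident : identically_distributed xi.
Hypothesis nb : noise_bounds P (xi 0) s2 a C1 C2 J K Lam.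

Implicit Types (theta b eps del D kap : R) (n : nat).
Local Notation ar := (ar xi).

(** On this event the estimators are functions of the martingale up to small
    errors, and the compensator of its exponential is nearly deterministic. *)
Definition good eps del theta b n : set T :=
  [set w | `|noise_squares xi n w - n%:R * s2| <= eps * n%:R] `&`
  [set w | `|ar_noise xi theta n w| <= eps * n%:R] `&`
  [set w | ar theta 0 w ^+ 2 <= eps * n%:R] `&`
  [set w | ar theta n w ^+ 2 <= eps * n%:R] `&`
  [set w | ar theta n w ^+ 2 <=
           eps * (b * Num.sqrt n%:R / Num.sqrt (1 - theta ^+ 2))] `&`
  [set w | noise_excess xi ((1 - theta) * level del theta b n) n w <=
           eps * n%:R * (1 - theta)].

Lemma measurable_set_le (f : T -> R) c : measurable_fun setT f ->
  measurable [set w | f w <= c].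
Proof.
by move=> mf; rewrite -[X in measurable X]setTI; apply: measurable_fun_le.
Qed.

Lemma measurable_noise_excess c n : measurable_fun setT (noise_excess xi c n).
Proof. by apply: measurable_sum => k; exact: measurable_excess. Qed.

Lemma measurable_good eps del theta b n : measurable (good eps del theta b n).
Proof.
have mx k := measurable_ar xi theta k.
have mQ := measurable_noise_squares xi n.
have mM := measurable_ar_noise xi theta n.
have mE := measurable_noise_excess ((1 - theta) * level del theta b n) n.
by do !apply: measurableI; apply: measurable_set_le => //; solve_measurable.
Qed.

(** The factor 8 counts the exponents below: the first two conditions of [good]
    are two-sided.  The extra 8 in [D8] absorbs it. *)
Lemma good_prob eps del D : 0 < eps -> 0 < del -> 0 <= D ->
  exists2 kap, 1 <= kap & forall theta b n, regime kap theta b n ->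
    (P (~` good eps del theta b n) <= (expR (- (D * budget theta b)))%:E)%E.
Proof.
move=> e0 del0 D0; pose D8 := D + 8.
have D80 : 0 <= D8 by rewrite addr_ge0.
have [k1 k11 tail1] := noise_squares_tail xi_indep xi_ident nb e0 D80.
have [tau tau0 [k2 k21 tail2]] := ar_noise_tail xi_indep xi_ident nb e0 D80.
have [k3 k31 tail3] := ar_tail xi_indep xi_ident nb e0 D80.
have [k4 k41 tail4] := noise_excess_tail xi_indep xi_ident nb e0 del0 D80.
exists (k1 + k2 + k3 + k4); first by lra.
move=> theta b n reg.
have reg1 : regime k1 theta b n by apply: regime_le reg => //; lra.
have reg2 : regime k2 theta b n by apply: regime_le reg => //; lra.
have reg3 : regime k3 theta b n by apply: regime_le reg => //; lra.
have reg4 : regime k4 theta b n by apply: regime_le reg => //; lra.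
set rho := 1 - theta.
have r0 : 0 < rho := regime_rho_gt0 reg.
have a0 := nb_a nb.
have w1 := regime_budget_ge1 reg; have w0 := le_trans ler01 w1.
pose z := eps * (b * Num.sqrt n%:R / Num.sqrt (1 - theta ^+ 2)).
have z1 : eps * (k3 * budget theta b) <= rho * (eps * n%:R).
  rewrite [leRHS]mulrCA ler_wpM2l ?(ltW e0)// [leRHS]mulrC; exact: regime_n1.
have z2 : eps * (k3 * budget theta b) <= rho * z.
  rewrite /z [leRHS]mulrCA ler_wpM2l ?(ltW e0)//.
  apply: le_trans (regime_bn reg3) _; rewrite ler_wpM2l ?(ltW r0)//.
  have b0 : 0 <= b by apply: le_trans (regime_b_ge1 reg).
  have /andP[v1 _] := regime_v reg.
  rewrite ler_peMr ?mulr_ge0 ?sqrtr_ge0//.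
  rewrite invf_ge1 ?sqrtr_gt0 ?(lt_le_trans r0)//.
  by rewrite -[leRHS]sqrtr1 ler_wsqrtr// gerBl sqr_ge0.
pose f (i : nat) : T -> R := nth (fun=> 0) [::
  (fun w => 1 * rho * (noise_squares xi n w - n%:R * s2) - rho * eps * n%:R);
  (fun w => - 1 * rho * (noise_squares xi n w - n%:R * s2) - rho * eps * n%:R);
  (fun w => 1 * (tau * rho ^+ 2) * ar_noise xi theta n w - tau * rho ^+ 2 * eps * n%:R);
  (fun w => - 1 * (tau * rho ^+ 2) * ar_noise xi theta n w - tau * rho ^+ 2 * eps * n%:R);
  (fun w => a * rho * ar theta 0 w ^+ 2 - a * rho * (eps * n%:R));
  (fun w => a * rho * ar theta n w ^+ 2 - a * rho * (eps * n%:R));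
  (fun w => a * rho * ar theta n w ^+ 2 - a * rho * z);
  (fun w => a * noise_excess xi (rho * level del theta b n) n w
      - a * (eps * n%:R * rho))] i.
have mx k := measurable_ar xi theta k.
have mQ := measurable_noise_squares xi n.
have mM := measurable_ar_noise xi theta n.
have mE := measurable_noise_excess (rho * level del theta b n) n.
have h : (P (~` good eps del theta b n) <=
    (8%:R * expR (- (D8 * budget theta b)))%:E)%E.
  apply: (@exp_markov_union _ _ _ P _ 8 f).
  - by apply: measurableC; exact: measurable_good.
  - move=> i; do 8?[case: i => [|i]] => // _; (split; first by solve_measurable).
    + by apply: tail1; rewrite ?normr1.
    + by apply: tail1; rewrite ?normrN ?normr1.
    + by apply: tail2; rewrite ?normr1.
    + by apply: tail2; rewrite ?normrN ?normr1.
    + exact: (tail3 _ _ _ _ _ reg3 z1).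
    + exact: (tail3 _ _ _ _ _ reg3 z1).
    + exact: (tail3 _ _ _ _ _ reg3 z2).
    + exact: tail4.
  - move=> w; apply: contra_notP => nf.
    have neg i : (i < 8)%N -> f i w < 0.
      by move=> i8; rewrite ltNge; apply/negP => fi; apply: nf; exists i.
    have ar0 : 0 < a * rho by exact: mulr_gt0.
    have tr0 : 0 < tau * rho ^+ 2 by rewrite mulr_gt0// exprn_gt0.
    have lt0 (c x y : R) : 0 < c -> c * x - c * y < 0 -> x <= y.
      by move=> c0; rewrite subr_lt0 ltr_pM2l// => /ltW.
    do 5?split.
    + rewrite /= ler_norml; apply/andP; split.
        have := neg 1%N isT; rewrite /f/= => h.
        rewrite -subr_ge0; apply: (lt0 rho 0 _ r0); lra.
      by apply: (lt0 rho _ _ r0); have := neg 0%N isT; rewrite /f/=; lra.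
    + rewrite /= ler_norml; apply/andP; split.
        have := neg 3%N isT; rewrite /f/= => h.
        rewrite -subr_ge0; apply: (lt0 _ 0 _ tr0); lra.
      by apply: (lt0 _ _ _ tr0); have := neg 2%N isT; rewrite /f/=; lra.
    + by apply: (lt0 _ _ _ ar0); exact: (neg 4%N isT).
    + by apply: (lt0 _ _ _ ar0); exact: (neg 5%N isT).
    + by apply: (lt0 _ _ _ ar0); exact: (neg 6%N isT).
    + by apply: (lt0 _ _ _ a0); exact: (neg 7%N isT).
apply: le_trans h _; rewrite lee_fin.
have -> : expR (- (D8 * budget theta b)) =
    expR (- (D * budget theta b)) * (expR (8 * budget theta b))^-1.
  by rewrite -expRN -expRD; congr expR; rewrite /D8; ring.
rewrite mulrCA ler_piMr ?expR_ge0// ler_pdivrMr ?expR_gt0// mul1r.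
apply: (@le_trans _ _ (1 + 8 * budget theta b)); last exact: expR_ge1Dx.
lra.
Qed.

End GoodEvent.

(** * The process on the good event *)

Section OnGoodEvent.
Context {d : measure_display} {T : measurableType d} {R : realType}
  (P : probability T R) (xi : int -> {RV P >-> R})
  (s2 a C1 C2 J K : R) (Lam : R -> R).
Hypothesis nb : noise_bounds P (xi 0) s2 a C1 C2 J K Lam.

Implicit Types (theta b eps del D kap t : R) (n : nat).
Local Notation ar := (ar xi).

Let s20 : 0 < s2 := nb_s2 nb.
Let K0 : 0 <= K := nb_K nb.

(** The parameter for which [tilt * ar_noise] is [t * b^2] times the normalized
    martingale. *)
Definition tilt theta b n t : R :=
  t * b * Num.sqrt (1 - theta ^+ 2) / (Num.sqrt n%:R * s2).

(** The common leading term of the normalized errors of the two estimators; it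
    satisfies the moderate deviations with rate [x^2 / 2]. *)
Definition normalized_noise theta b n (w : T) : R :=
  ar_noise xi theta n w * Num.sqrt (1 - theta ^+ 2) / (Num.sqrt n%:R * s2 * b).

Section Fixed.
Context {kap theta b eps del : R} {n : nat} {w : T}.
Hypothesis reg : regime kap theta b n.
Hypothesis eps0 : 0 < eps.
Hypothesis del0 : 0 < del.
Hypothesis gw : good xi s2 eps del theta b n w.

Local Notation rho := (1 - theta).
Local Notation v := (1 - theta ^+ 2).
Let r0 : 0 < rho := regime_rho_gt0 reg.
Let n0 : 0 < n%:R :> R. Proof. by rewrite ltr0n (regime_n_gt0 reg). Qed.
Let v0 : 0 < v. Proof. by have /andP[v1 _] := regime_v reg; exact: lt_le_trans v1. Qed.
Let b0 : 0 < b. Proof. exact: lt_le_trans (regime_b_ge1 reg). Qed.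
Let th01 : 0 <= theta < 1. Proof. by have [] := reg. Qed.

Lemma tilt_normalized t : tilt theta b n t * ar_noise xi theta n w =
  t * b ^+ 2 * normalized_noise theta b n w.
Proof.
rewrite /tilt /normalized_noise; field.
by rewrite !gt_eqF// sqrtr_gt0.
Qed.

Lemma tilt_sq t : tilt theta b n t ^+ 2 * (n%:R * s2 ^+ 2) = t ^+ 2 * b ^+ 2 * v.
Proof.
rewrite /tilt !exprMn exprVn exprMn !sqr_sqrtr ?ltW//.
by field; rewrite !gt_eqF.
Qed.

Lemma good_squares : `|v * ar_squares xi theta n w - n%:R * s2| <= 5 * eps * n%:R.
Proof.
have [[[[[hQ hM] hX0] hXn] _] _] := gw.
have -> : v * ar_squares xi theta n w = noise_squares xi n w +
    2 * theta * ar_noise xi theta n w + ar theta 0 w ^+ 2 - ar theta n w ^+ 2.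
  exact: (@sum_squares_identity _ theta (ar theta ^~ w) (fun k => xi (k%:Z + 1) w) n
    (fun=> erefl)).
move: hQ hM hX0 hXn => /=; rewrite !ler_norml => /andP[q1 q2] /andP[m1 m2] x0 xn.
have X0 := sqr_ge0 (ar theta 0 w); have Xn := sqr_ge0 (ar theta n w).
have /andP[t0 t1] := th01.
set M := ar_noise xi theta n w in m1 m2 *.
have tM1 : theta * M <= eps * n%:R.
  apply: le_trans (ler_wpM2l t0 m2) _; apply: ler_piMl; last exact: ltW.
  by rewrite mulr_ge0// ltW.
have tM2 : - (eps * n%:R) <= theta * M.
  apply: le_trans _ (ler_wpM2l t0 m1); rewrite mulrN lerN2.
  by apply: ler_piMl; [rewrite mulr_ge0// ltW|exact: ltW].
have en0 : 0 <= eps * n%:R by rewrite mulr_ge0// ltW.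
apply/andP; split; lra.
Qed.

(** The excess of the process is controlled by that of the noise, up to the
    factor [rho^2] lost by convexity. *)
Lemma good_excess : v * ar_excess xi theta (level del theta b n) n w <= 4 * eps * n%:R.
Proof.
have [[[[[_ _] hX0] _] _] hE] := gw.
set A := level del theta b n.
have A0 : 0 <= A by rewrite /A /level divr_ge0 ?mulr_ge0 ?sqrtr_ge0// ltW.
have h : rho ^+ 2 * ar_excess xi theta A n w <=
    rho * ar theta 0 w ^+ 2 + noise_excess xi (rho * A) n w.
  exact: (@sum_excess_le _ theta th01 (ar theta ^~ w) (fun k => xi (k%:Z + 1) w) n A A0
    (fun=> erefl)).
set E := ar_excess xi theta A n w in h *.
have E0 : 0 <= E by apply: sumr_ge0 => k _; exact: sqr_ge0.
have h1 : rho * ar theta 0 w ^+ 2 <= rho * (eps * n%:R) by rewrite ler_wpM2l// ltW.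
have h2 : rho * (rho * E) <= rho * (2 * eps * n%:R).
  move: hE; rewrite /= -/A => hE; rewrite mulrA -expr2; lra.
have h3 : rho * E <= 2 * eps * n%:R by move: h2; rewrite ler_pM2l.
have /andP[_ v2] := regime_v reg.
have := ler_wpM2r E0 v2; lra.
Qed.

(** Sum the comparison of [Lam] with a parabola along the trajectory.  The
    quadratic part is a multiple of the sum of squares, which is nearly
    deterministic, and the excess is that of the process over its level. *)
Lemma good_Lam t del' : 0 < del' <= 1 -> eps <= s2 ->
  2 * `|t| * del <= del' * s2 ->
  `|ar_Lam xi theta Lam (tilt theta b n t) n w - t ^+ 2 / 2 * b ^+ 2| <=
  t ^+ 2 * b ^+ 2 *
    (6 * K / s2 * del' + (4 * K / s2 ^+ 2 + 5 / (2 * s2)) * eps).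
Proof.
move=> /[dup] del'01 /andP[del'0 del'1] es2 tdel.
set lam := tilt theta b n t; set A := level del theta b n.
(* below its level the process stays in the range where [Lam] is quadratic *)
have lamA : `|lam| * A <= del' / 2.
  have -> : `|lam| * A = `|t| * del / s2.
    rewrite /lam /A /tilt /level !normrM normfV normrM.
    rewrite (gtr0_norm b0) (gtr0_norm s20) !(ger0_norm (sqrtr_ge0 _)).
    by field; rewrite !gt_eqF// sqrtr_gt0.
  rewrite ler_pdivrMr//; lra.
pose S := ar_squares xi theta n w; pose E := ar_excess xi theta A n w.
have S0 : 0 <= S by apply: sumr_ge0 => k _; exact: sqr_ge0.
have E0 : 0 <= E by apply: sumr_ge0 => k _; exact: sqr_ge0.
have step : `|ar_Lam xi theta Lam lam n w - s2 / 2 * (lam ^+ 2 * S)| <=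
    K * (del' * (lam ^+ 2 * S) + lam ^+ 2 * E).
  rewrite /S /E /ar_squares /ar_excess /ar_Lam !big_distrr/= -big_split/= big_distrr/=.
  rewrite -sumrB; apply: le_trans (ler_norm_sum _ _ _) _.
  apply: ler_sum => k _; rewrite -exprMn.
  apply: le_trans (nb_Lam_near nb _ del'01) _.
  apply: ler_wpM2l => //; rewrite lerD2l.
  rewrite -[lam ^+ 2]real_normK ?num_real// -exprMn.
  apply: lerXn2r; rewrite ?nnegrE ?mulr_ge0 ?le_max ?lexx ?orbT//.
  rewrite ge_max mulr_ge0 ?le_max ?lexx ?orbT// andbT normrM.
  apply: (@le_trans _ _ (`|lam| * (`|ar theta k w| - A))); first by rewrite mulrBr lerD2l lerN2.
  by rewrite ler_wpM2l// le_max lexx.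
have l2 := tilt_sq t; rewrite -/lam in l2.
have hS := good_squares; have hE := good_excess; rewrite -/S -/E -/A in hS hE.
have lamS : lam ^+ 2 * S = t ^+ 2 * b ^+ 2 / s2 ^+ 2 * (v * S / n%:R).
  have -> : lam ^+ 2 = t ^+ 2 * b ^+ 2 * v / (n%:R * s2 ^+ 2).
    by rewrite -l2 mulfK// gt_eqF// mulr_gt0// exprn_gt0.
  by field; rewrite !gt_eqF.
have lamE : lam ^+ 2 * E = t ^+ 2 * b ^+ 2 / s2 ^+ 2 * (v * E / n%:R).
  have -> : lam ^+ 2 = t ^+ 2 * b ^+ 2 * v / (n%:R * s2 ^+ 2).
    by rewrite -l2 mulfK// gt_eqF// mulr_gt0// exprn_gt0.
  by field; rewrite !gt_eqF.
rewrite lamS lamE in step.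
set x := v * S / n%:R in step; set y := v * E / n%:R in step.
have xs : `|x - s2| <= 5 * eps.
  have -> : x - s2 = (v * S - n%:R * s2) / n%:R by rewrite /x; field; rewrite gt_eqF.
  by rewrite normrM normfV (gtr0_norm n0) ler_pdivrMr.
have y4 : y <= 4 * eps by rewrite /y ler_pdivrMr.
set q := t ^+ 2 * b ^+ 2 in step *.
have q0 : 0 <= q by rewrite mulr_ge0 ?sqr_ge0.
have xs6 : x <= 6 * s2 by move: xs; rewrite ler_norml => /andP[_]; lra.
have step2 : `|s2 / 2 * (q / s2 ^+ 2 * x) - t ^+ 2 / 2 * b ^+ 2| <= q * (5 / (2 * s2) * eps).
  have -> : s2 / 2 * (q / s2 ^+ 2 * x) - t ^+ 2 / 2 * b ^+ 2 = q / (2 * s2) * (x - s2).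
    by rewrite /q; field; rewrite gt_eqF.
  have p0 : 0 <= q / (2 * s2) by rewrite divr_ge0// mulr_ge0// ltW.
  rewrite normrM (ger0_norm p0); apply: le_trans (ler_wpM2l p0 xs) _.
  by rewrite le_eqVlt; apply/orP; left; apply/eqP; field; rewrite gt_eqF.
have step3 : K * (del' * (q / s2 ^+ 2 * x) + q / s2 ^+ 2 * y) <=
    q * (6 * K / s2 * del' + 4 * K / s2 ^+ 2 * eps).
  have -> : q * (6 * K / s2 * del' + 4 * K / s2 ^+ 2 * eps) =
    K * (del' * (q / s2 ^+ 2 * (6 * s2)) + q / s2 ^+ 2 * (4 * eps)).
    by field; rewrite gt_eqF.
  have p0 : 0 <= q / s2 ^+ 2 by rewrite divr_ge0// sqr_ge0.
  apply: ler_wpM2l => //; apply: lerD; last exact: ler_wpM2l.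
  by apply: ler_wpM2l; [exact: ltW|exact: ler_wpM2l].
rewrite -[X in `|X|](subrKA (s2 / 2 * (q / s2 ^+ 2 * x))).
apply: le_trans (ler_normD _ _) _.
have := le_trans step step3; lra.
Qed.

End Fixed.

End OnGoodEvent.

(** * Exponential tilting *)

Ltac nonneg := repeat (first
  [ by [] | exact: ltW | exact: sqr_ge0 | exact: expR_ge0 | exact: sqrtr_ge0
  | by rewrite indicE | apply: addr_ge0 | apply: divr_ge0 | apply: mulr_ge0 | rewrite invr_ge0 ]).

Ltac integrand_ge0 := try (by move=> ? _; rewrite -?EFinM ?lee_fin; nonneg);
  try (by rewrite lee_fin; nonneg).

Section Tilting.
Context {d : measure_display} {T : measurableType d} {R : realType}
  (P : probability T R) (xi : int -> {RV P >-> R})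
  (s2 a C1 C2 J K : R) (Lam : R -> R).
Hypothesis xi_indep : mutually_independent xi.
Hypothesis xi_ident : identically_distributed xi.
Hypothesis nb : noise_bounds P (xi 0) s2 a C1 C2 J K Lam.

Implicit Types (theta b eps del eta kap t : R) (n : nat).
Local Notation U := (normalized_noise xi s2).

Let s20 : 0 < s2 := nb_s2 nb.
Let a0 : 0 < a := nb_a nb.
Let C10 : 0 <= C1 := nb_C1 nb.
Let K0 : 0 <= K := nb_K nb.

Lemma good_Lam_ex eta tm : 0 < eta -> 0 <= tm ->
  exists2 del, 0 < del & exists2 eps0, 0 < eps0 &
  forall kap theta b n eps w t, regime kap theta b n -> 0 < eps <= eps0 ->
    good xi s2 eps del theta b n w -> `|t| <= tm ->
    `|ar_Lam xi theta Lam (tilt s2 theta b n t) n w - t ^+ 2 / 2 * b ^+ 2|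
      <= eta * b ^+ 2.
Proof.
move=> eta0 tm0.
pose G1 := 6 * K / s2; pose G2 := 4 * K / s2 ^+ 2 + 5 / (2 * s2).
have G10 : 0 <= G1 by nonneg.
have G20 : 0 <= G2.
  by nonneg.
pose L := 1 + 2 * tm ^+ 2 * G1 / eta.
have L1 : 1 <= L by rewrite lerDl; nonneg.
have L0 : 0 < L by exact: lt_le_trans L1.
pose N := s2^-1 + 2 * tm ^+ 2 * G2 / eta.
have N1 : s2^-1 <= N by rewrite lerDl; nonneg.
have N0 : 0 < N by apply: lt_le_trans N1; rewrite invr_gt0.
have t10 : 0 < 2 * (tm + 1) by rewrite mulr_gt0//; lra.
exists (L^-1 * s2 / (2 * (tm + 1))); first by apply: divr_gt0 => //; apply: mulr_gt0; rewrite ?invr_gt0.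
exists N^-1; first by rewrite invr_gt0.
move=> kap theta b n eps w t reg /andP[eps0 epsN] gw tle.
have del'01 : 0 < L^-1 <= 1 by rewrite invr_gt0 L0 invf_le1.
have es2 : eps <= s2.
  by apply: le_trans epsN _; rewrite -[leRHS]invrK lef_pV2 ?posrE ?invr_gt0.
have tdel : 2 * `|t| * (L^-1 * s2 / (2 * (tm + 1))) <= L^-1 * s2.
  rewrite mulrA ler_pdivrMr// [leLHS]mulrC ler_wpM2l//.
    by nonneg.
  by rewrite ler_wpM2l//; lra.
have q0 : 0 < L^-1 * s2 / (2 * (tm + 1)).
  by apply: divr_gt0 => //; apply: mulr_gt0; rewrite ?invr_gt0.
apply: le_trans (good_Lam nb reg eps0 q0 gw del'01 es2 tdel) _.
rewrite -/G1 -/G2 (mulrC _ (b ^+ 2)) -mulrA (mulrC eta) ler_wpM2l ?sqr_ge0//.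
have tt : t ^+ 2 <= tm ^+ 2.
  by rewrite -[leLHS]real_normK ?num_real//; apply: lerXn2r; rewrite ?nnegrE.
have h1 : tm ^+ 2 * (G1 * L^-1) <= eta / 2.
  rewrite mulrA ler_pdivrMr// /L [leRHS]mulrDr mulr1.
  have -> : eta / 2 * (2 * tm ^+ 2 * G1 / eta) = tm ^+ 2 * G1.
    by field; rewrite gt_eqF.
  by rewrite lerDr divr_ge0// ltW.
have h2 : tm ^+ 2 * (G2 * eps) <= eta / 2.
  apply: (@le_trans _ _ (tm ^+ 2 * (G2 * N^-1))).
    by rewrite ler_wpM2l ?sqr_ge0// ler_wpM2l.
  rewrite mulrA ler_pdivrMr// /N [leRHS]mulrDr.
  have -> : eta / 2 * (2 * tm ^+ 2 * G2 / eta) = tm ^+ 2 * G2.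
    by field; rewrite gt_eqF.
  rewrite lerDr; apply: mulr_ge0; first by rewrite divr_ge0// ltW.
  by rewrite invr_ge0 ltW.
have s0 : 0 <= G1 * L^-1 + G2 * eps.
  by nonneg.
apply: le_trans (ler_wpM2r s0 tt) _; lra.
Qed.

Section Fixed.
Context {kap theta b eta t : R} {n : nat} {G : set T}.
Hypothesis reg : regime kap theta b n.
Hypothesis mG : measurable G.
Hypothesis G_Lam : forall w, G w ->
  `|ar_Lam xi theta Lam (tilt s2 theta b n t) n w - t ^+ 2 / 2 * b ^+ 2|
      <= eta * b ^+ 2.

Local Notation rho := (1 - theta).
Local Notation lam := (tilt s2 theta b n t).

Let D w := expR (lam * ar_noise xi theta n w - ar_Lam xi theta Lam lam n w).

Let mM := measurable_ar_noise xi theta n.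
Let mD : measurable_fun setT D.
Proof.
apply: (measurableT_comp (@measurable_expR _)); apply: measurable_funB.
  exact: measurable_funM.
exact: (measurable_ar_Lam theta nb).
Qed.

Lemma measurable_normalized_noise : measurable_fun setT (U theta b n).
Proof. by apply: measurable_funM => //; apply: measurable_funM. Qed.

Let mU := measurable_normalized_noise.

Let mIG (B : set T) : measurable B -> measurable_fun setT (\1_B : T -> R).
Proof. exact: measurable_indic. Qed.

Let mE c : measurable_fun setT (fun w => expR (c * b ^+ 2 * U theta b n w)).
Proof.
by apply: (measurableT_comp (@measurable_expR _)); apply: measurable_funM.
Qed.

(** The exponential martingale has mean one, and on [G] its compensator is
    [t^2 b^2 / 2] up to [eta b^2]. *)
Lemma tilted_upper :
  (\int[P]_w (\1_G w * expR (t * b ^+ 2 * U theta b n w))%:E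
    <= (expR (b ^+ 2 * (t ^+ 2 / 2 + eta)))%:E)%E.
Proof.
apply: (@le_trans _ _ (\int[P]_w ((expR (b ^+ 2 * (t ^+ 2 / 2 + eta)))%:E * (D w)%:E))%E).
  apply: ge0_le_integral => //; integrand_ge0.
  - by apply/measurable_EFinP; apply: measurable_funM => //; exact: mIG.
  - by apply/measurable_EFinP; apply: measurable_funM.
  - move=> w _; rewrite -EFinM lee_fin indicE.
    case: (boolP (w \in G)) => [|_]; last by rewrite mul0r mulr_ge0 ?expR_ge0.
    rewrite inE => /G_Lam; rewrite ler_norml => /andP[_ h].
    by rewrite mul1r -expRD ler_expR -(tilt_normalized nb reg); lra.
rewrite ge0_integralZl//; integrand_ge0; last first.
- exact/measurable_EFinP.
by rewrite (exponential_martingale _ xi_indep xi_ident nb) mule1.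
Qed.

Let C5 := 64 * C1 * K / s2 ^+ 2.

(** The crude bound at twice the tilt. *)
Lemma tilted_square : 32 * K * t ^+ 2 / (a * s2 ^+ 2) <= kap ->
  (\int[P]_w (D w ^+ 2)%:E <= (expR (C5 * t ^+ 2 * budget theta b))%:E)%E.
Proof.
move=> hkap.
have r0 : 0 < rho := regime_rho_gt0 reg.
have n0 : 0 < n%:R :> R by rewrite ltr0n (regime_n_gt0 reg).
have [_ th01 _ _ _] := reg.
have /andP[_ v2] := regime_v reg.
have l2 := tilt_sq nb reg t.
have nl2 : n%:R * lam ^+ 2 <= 2 * t ^+ 2 * b ^+ 2 * rho / s2 ^+ 2.
  rewrite ler_pdivlMr ?exprn_gt0//.
  have -> : n%:R * lam ^+ 2 * s2 ^+ 2 = t ^+ 2 * b ^+ 2 * (1 - theta ^+ 2).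
    by rewrite -l2; ring.
  have p0 : 0 <= t ^+ 2 * b ^+ 2 by rewrite mulr_ge0 ?sqr_ge0.
  have := ler_wpM2l p0 v2; lra.
have cond : 4 * K * (2 * lam) ^+ 2 <= a * rho ^+ 2.
  rewrite -(ler_pM2l n0).
  have -> : n%:R * (4 * K * (2 * lam) ^+ 2) = 16 * K * (n%:R * lam ^+ 2) by ring.
  apply: (@le_trans _ _ (16 * K * (2 * t ^+ 2 * b ^+ 2 * rho / s2 ^+ 2))).
    by rewrite ler_wpM2l// mulr_ge0.
  have -> : 16 * K * (2 * t ^+ 2 * b ^+ 2 * rho / s2 ^+ 2) =
      a * rho * (32 * K * t ^+ 2 / (a * s2 ^+ 2) * b ^+ 2).
    by field; rewrite !gt_eqF.
  have -> : n%:R * (a * rho ^+ 2) = a * rho * (n%:R * rho) by ring.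
  have ar0 : 0 <= a * rho by rewrite mulr_ge0// ltW.
  apply: ler_wpM2l => //; apply: le_trans (regime_n1 reg).
  have k0 : 0 <= kap by have [k1 _ _ _ _] := reg; exact: le_trans k1.
  apply: le_trans (ler_wpM2r (sqr_ge0 b) hkap) _.
  exact: ler_wpM2l (regime_sq_le reg).
apply: (@le_trans _ _ (\int[P]_w (expR (2 * lam * ar_noise xi theta n w))%:E)%E).
  apply: ge0_le_integral => //; integrand_ge0.
  - by apply/measurable_EFinP; apply: measurable_funX.
  - apply/measurable_EFinP; apply: (measurableT_comp (@measurable_expR _)).
    exact: measurable_funM.
  - move=> w _; rewrite lee_fin /D -expRM_natr ler_expR.
    have : 0 <= ar_Lam xi theta Lam lam n w.
      by apply: sumr_ge0 => k _; exact: nb_Lam_ge0 nb _.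
    lra.
apply: le_trans (crude_mgf xi_indep xi_ident th01 nb n cond) _.
rewrite lee_fin ler_expR.
have nrho : rho^-1 <= n%:R.
  rewrite -[leLHS]mul1r ler_pdivrMr// (le_trans _ (regime_n1 reg))// mulr_ege1//.
    by have [] := reg.
  exact: regime_budget_ge1 reg.
have -> : C1 * (4 * K * (2 * lam) ^+ 2 / rho ^+ 2) * (rho^-1 + n%:R) =
    16 * C1 * K * lam ^+ 2 / rho ^+ 2 * (rho^-1 + n%:R) by ring.
have c0 : 0 <= 16 * C1 * K * lam ^+ 2 / rho ^+ 2.
  by rewrite divr_ge0 ?sqr_ge0// mulr_ge0 ?sqr_ge0// !mulr_ge0.
apply: (@le_trans _ _ (16 * C1 * K * lam ^+ 2 / rho ^+ 2 * (n%:R + n%:R))).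
  by rewrite ler_wpM2l// lerD2r.
have -> : 16 * C1 * K * lam ^+ 2 / rho ^+ 2 * (n%:R + n%:R) =
    32 * C1 * K / rho ^+ 2 * (n%:R * lam ^+ 2) by ring.
have c1 : 0 <= 32 * C1 * K / rho ^+ 2 by rewrite divr_ge0 ?sqr_ge0// !mulr_ge0.
apply: le_trans (ler_wpM2l c1 nl2) _.
rewrite le_eqVlt; apply/orP; left; apply/eqP.
by rewrite /C5 /budget; field; rewrite !gt_eqF.
Qed.

(** The exponential martingale has mean one, and the part of that mean carried
    by the complement of [G] is small because its square integral is at most
    exponential in the budget. *)
Lemma tilted_lower : 32 * K * t ^+ 2 / (a * s2 ^+ 2) <= kap ->
  (P (~` G) <= (expR (- ((C5 * t ^+ 2 + 4) * budget theta b)))%:E)%E ->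
  ((expR (b ^+ 2 * (t ^+ 2 / 2 - eta)) / 2)%:E <=
    \int[P]_w (\1_G w * expR (t * b ^+ 2 * U theta b n w))%:E)%E.
Proof.
move=> hkap PG.
have mGC : measurable (~` G) by exact: measurableC.
have w1 := regime_budget_ge1 reg.
set B := budget theta b in PG w1 *.
pose q := C5 * t ^+ 2.
have bad : (\int[P]_w (\1_(~` G) w * D w)%:E <= (2^-1)%:E)%E.
  apply: (@le_trans _ _ (\int[P]_w
     ((expR (- ((q + 2) * B)) / 2)%:E * (D w ^+ 2)%:E +
      (expR ((q + 2) * B) / 2)%:E * (\1_(~` G) w)%:E))%E).
    apply: ge0_le_integral => //; integrand_ge0.
    - by apply/measurable_EFinP; apply: measurable_funM => //; exact: mIG.
    - apply/measurable_EFinP; apply: measurable_funD.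
        by apply: measurable_funM => //; exact: measurable_funX.
      by apply: measurable_funM => //; exact: (mIG mGC).
    - move=> w _; rewrite -!EFinM -EFinD lee_fin.
      (* [2 i D <= z^-2 D^2 + z^2 i^2], with [z] balancing the two integrals *)
      set i := \1_(~` G) w; have ii : i ^+ 2 = i.
        by rewrite /i indicE; case: (_ \in _) => /=; rewrite ?expr1n ?expr0n.
      set z := expR ((q + 2) * B / 2).
      have z0 : 0 < z by exact: expR_gt0.
      have -> : expR ((q + 2) * B) = z ^+ 2 by rewrite -expRM_natr divfK.
      have -> : expR (- ((q + 2) * B)) = z^-1 ^+ 2.
        by rewrite expRN exprVn -expRM_natr divfK.
      have := sqr_ge0 (z^-1 * D w - z * i).
      have -> : (z^-1 * D w - z * i) ^+ 2 =
         z^-1 ^+ 2 * D w ^+ 2 - 2 * (i * D w) + z ^+ 2 * i ^+ 2.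
        by field; rewrite gt_eqF.
      by rewrite ii; lra.
  rewrite ge0_integralD//; integrand_ge0; first last.
  - by apply/measurable_EFinP; apply: measurable_funM => //; exact: mIG.
  - by apply/measurable_EFinP; apply: measurable_funM => //; exact: measurable_funX.
  rewrite !ge0_integralZl//; integrand_ge0; first last.
  - by apply/measurable_EFinP; exact: measurable_funX.
  - by apply/measurable_EFinP; exact: mIG.
  rewrite integral_indic// setIT.
  apply: (@le_trans _ _ ((expR (- ((q + 2) * B)) / 2)%:E * (expR (q * B))%:E +
     (expR ((q + 2) * B) / 2)%:E * (expR (- ((q + 4) * B)))%:E)%E).
    apply: leeD; apply: lee_wpmul2l; rewrite ?lee_fin ?divr_ge0 ?expR_ge0//.
    exact: tilted_square.
  rewrite -!EFinM -EFinD lee_fin ![_ / 2 * _]mulrAC -!expRD.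
  have -> : - ((q + 2) * B) + q * B = - (2 * B) by ring.
  have -> : (q + 2) * B + - ((q + 4) * B) = - (2 * B) by ring.
  have : expR (- (2 * B)) <= 2^-1.
    rewrite expRN lef_pV2 ?posrE ?expR_gt0//.
    by apply: le_trans (expR_ge1Dx _); lra.
  lra.
have split : (\int[P]_w (\1_G w * D w)%:E + \int[P]_w (\1_(~` G) w * D w)%:E = 1)%E.
  rewrite -ge0_integralD//; integrand_ge0; first last.
  - by apply/measurable_EFinP; apply: measurable_funM => //; exact: mIG.
  - by apply/measurable_EFinP; apply: measurable_funM => //; exact: mIG.
  rewrite -(exponential_martingale theta xi_indep xi_ident nb lam n).
  apply: eq_integral => w _; rewrite -EFinD -mulrDl; congr (_%:E).
  rewrite !indicE in_setC; case: (w \in G); rewrite /= ?addr0 ?add0r mul1r//.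
have half : ((2^-1)%:E <= \int[P]_w (\1_G w * D w)%:E)%E.
  have : (1%:E <= \int[P]_w (\1_G w * D w)%:E + (2^-1)%:E)%E.
    by rewrite -split; exact: leeD.
  rewrite -leeBlDr// -EFinB; apply: le_trans; rewrite lee_fin; lra.
apply: (@le_trans _ _ (\int[P]_w ((expR (b ^+ 2 * (t ^+ 2 / 2 - eta)))%:E *
    (\1_G w * D w)%:E))%E).
  rewrite ge0_integralZl//; integrand_ge0; last first.
  - by apply/measurable_EFinP; apply: measurable_funM => //; exact: mIG.
  by rewrite EFinM; apply: lee_wpmul2l; rewrite ?lee_fin ?expR_ge0.
apply: ge0_le_integral => //; integrand_ge0.
- apply/measurable_EFinP; apply: measurable_funM => //.
  by apply: measurable_funM => //; exact: mIG.
- by apply/measurable_EFinP; apply: measurable_funM => //; exact: mIG.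
- move=> w _; rewrite -EFinM lee_fin mulrCA.
  rewrite indicE; case: (boolP (w \in G)) => [|_]; last by rewrite !mul0r.
  rewrite inE => /G_Lam; rewrite ler_norml => /andP[h _].
  by rewrite !mul1r -expRD ler_expR -(tilt_normalized nb reg); lra.
Qed.

End Fixed.

End Tilting.

(** * Bounds for the normalized martingale *)

Section ModerateDeviations.
Context {d : measure_display} {T : measurableType d} {R : realType}
  (P : probability T R) (xi : int -> {RV P >-> R})
  (s2 a C1 C2 J K : R) (Lam : R -> R).
Hypothesis xi_indep : mutually_independent xi.
Hypothesis xi_ident : identically_distributed xi.
Hypothesis nb : noise_bounds P (xi 0) s2 a C1 C2 J K Lam.

Implicit Types (theta b eps del eta kap t : R) (n : nat).
Local Notation U := (normalized_noise xi s2).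

Let s20 : 0 < s2 := nb_s2 nb.
Let a0 : 0 < a := nb_a nb.
Let C10 : 0 <= C1 := nb_C1 nb.
Let K0 : 0 <= K := nb_K nb.

Section Fixed.
Context {kap theta b eta : R} {n : nat} {G : set T}.
Hypothesis reg : regime kap theta b n.
Hypothesis mG : measurable G.

Let compensated t := forall w, G w ->
  `|ar_Lam xi theta Lam (tilt s2 theta b n t) n w - t ^+ 2 / 2 * b ^+ 2|
      <= eta * b ^+ 2.

Let mU : measurable_fun setT (U theta b n).
Proof. exact: measurable_normalized_noise. Qed.

Let mE c : measurable_fun setT (fun w => expR (c * b ^+ 2 * U theta b n w)).
Proof.
by apply: (measurableT_comp (@measurable_expR _)); apply: measurable_funM.
Qed.

Let mIE c : measurable_fun setT (fun w => \1_G w * expR (c * b ^+ 2 * U theta b n w)).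
Proof. by apply: measurable_funM => //; exact: measurable_indic. Qed.

(** Chernoff's bound with tilt [sg * r]. *)
Lemma normalized_upper sg r : `|sg| = 1 -> 0 <= r -> compensated (sg * r) ->
  (P (G `&` [set w | r <= sg * U theta b n w]%R)
    <= (expR (- (b ^+ 2 * (r ^+ 2 / 2 - eta))))%:E)%E.
Proof.
move=> sg1 r0 hG.
have sg2 : sg ^+ 2 = 1 by rewrite -real_normK ?num_real// sg1 expr1n.
set A := [set w | r <= sg * U theta b n w].
have mA : measurable A.
  by rewrite -[X in measurable X]setTI; apply: measurable_fun_le => //; apply: measurable_funM.
have mGA : measurable (G `&` A) by exact: measurableI.
rewrite -[X in P X]setIT -integral_indic//.
apply: (@le_trans _ _ (\int[P]_w ((expR (- (b ^+ 2 * r ^+ 2)))%:E *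
    (\1_G w * expR (sg * r * b ^+ 2 * U theta b n w))%:E))%E).
  apply: ge0_le_integral => //; integrand_ge0.
  - by apply/measurable_EFinP; exact: measurable_indic.
  - by apply/measurable_EFinP; apply: measurable_funM.
  - move=> w _; rewrite -EFinM lee_fin indicI /=.
    rewrite [\1_G w]indicE; case: (boolP (w \in G)) => [_|_]; last by rewrite !mul0r mulr0.
    rewrite !mul1r -expRD indicE; case: (boolP (w \in A)) => [|_]; last exact: expR_ge0.
    rewrite inE /A/= => h; rewrite -expR0 ler_expR.
    have p0 : 0 <= b ^+ 2 * r by rewrite mulr_ge0// sqr_ge0.
    have := ler_wpM2l p0 h; lra.
rewrite ge0_integralZl//; integrand_ge0; last exact/measurable_EFinP.
have := tilted_upper xi_indep xi_ident nb reg mG hG.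
move=> /(lee_wpmul2l (x := (expR (- (b ^+ 2 * r ^+ 2)))%:E)).
move=> h; apply: le_trans (h _) _; first by rewrite lee_fin expR_ge0.
rewrite -EFinM -expRD lee_fin ler_expR exprMn sg2; lra.
Qed.

Let C5 := 64 * C1 * K / s2 ^+ 2.

(** Under the tilt [t] the normalized noise concentrates on [t - del, t + del]:
    both sides of this window are discarded by tilting a little more or a little
    less. *)
Lemma normalized_lower t del : 0 <= t -> 0 < del -> eta = del ^+ 2 / 8 ->
  compensated t -> compensated (t + del) -> compensated (t - del) ->
  32 * K * t ^+ 2 / (a * s2 ^+ 2) <= kap -> 32 / del ^+ 2 <= kap ->
  (P (~` G) <= (expR (- ((C5 * t ^+ 2 + 4) * budget theta b)))%:E)%E ->
  ((expR (- (b ^+ 2 * (t ^+ 2 / 2 + t * del + 2 * eta))))%:E <=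
   P (G `&` [set w | (t - del <= U theta b n w)%R]))%E.
Proof.
move=> t0 del0 etaE h0 h1 h2 hkap kdel PG.
have kb : kap <= b ^+ 2.
  have [k1 _ _ kb _] := reg; apply: le_trans kb _.
  by rewrite expr2 ler_peMr// ?(regime_b_ge1 reg)// (le_trans ler01)// (regime_b_ge1 reg).
have bdel : 32 <= b ^+ 2 * del ^+ 2.
  by rewrite -ler_pdivrMr ?exprn_gt0//; exact: le_trans kb.
set A := [set w | t - del <= U theta b n w].
have mA : measurable A.
  by rewrite -[X in measurable X]setTI; apply: measurable_fun_le.
have mGA : measurable (G `&` A) by exact: measurableI.
have PGA : P (G `&` A) \is a fin_num by exact: fin_num_measure.
set p := fine (P (G `&` A)).
rewrite -(fineK PGA) lee_fin -/p.
pose c := expR (t * b ^+ 2 * (t + del)).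
pose c1 := expR (- (del * b ^+ 2 * (t + del))).
pose c2 := expR (del * b ^+ 2 * (t - del)).
pose V := expR (b ^+ 2 * (t ^+ 2 / 2 - eta)).
have lower := tilted_lower xi_indep xi_ident nb reg mG h0 hkap PG.
have up1 := tilted_upper xi_indep xi_ident nb reg mG h1.
have up2 := tilted_upper xi_indep xi_ident nb reg mG h2.
have mI : measurable_fun setT (\1_(G `&` A) : T -> R) by exact: measurable_indic.
have intGA : (\int[P]_w (\1_(G `&` A) w)%:E = p%:E)%E.
  by rewrite integral_indic// setIT; exact: (esym (fineK PGA)).
(* inside the window bound [U] by [t + del]; above it and below it, change the
   tilt by [del] *)
have bound : (\int[P]_w (\1_G w * expR (t * b ^+ 2 * U theta b n w))%:E <=
    (c * p + c1 * expR (b ^+ 2 * ((t + del) ^+ 2 / 2 + eta)) +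
     c2 * expR (b ^+ 2 * ((t - del) ^+ 2 / 2 + eta)))%:E)%E.
  apply: (@le_trans _ _ (\int[P]_w ((c%:E * (\1_(G `&` A) w)%:E +
      c1%:E * (\1_G w * expR ((t + del) * b ^+ 2 * U theta b n w))%:E) +
      c2%:E * (\1_G w * expR ((t - del) * b ^+ 2 * U theta b n w))%:E))%E).
    apply: ge0_le_integral => //; integrand_ge0.
    - by apply/measurable_EFinP.
    - by apply/measurable_EFinP; apply: measurable_funD;
        [apply: measurable_funD|]; apply: measurable_funM.
    - move=> w _; rewrite -!EFinM -!EFinD lee_fin indicI /=.
      rewrite [\1_G w]indicE; case: (boolP (w \in G)) => [_|_]; last first.
        by rewrite !(mul0r, mulr0) !addr0.
      rewrite !mul1r indicE; set x := U theta b n w.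
      have b2 : 0 <= b ^+ 2 by exact: sqr_ge0.
      have e0 y : 0 <= expR y :> R by exact: expR_ge0.
      have [xt|xt] := leP (t + del) x.
        apply: (@le_trans _ _ (c1 * expR ((t + del) * b ^+ 2 * x))).
          rewrite -expRD ler_expR.
          have p0 : 0 <= del * b ^+ 2 by rewrite mulr_ge0// ltW.
          have := ler_wpM2l p0 xt; lra.
        by rewrite -addrA addrCA lerDl; nonneg.
      have [xt'|xt'] := leP (t - del) x.
        have -> : (w \in A) = true by apply/mem_set.
        apply: (@le_trans _ _ c).
          rewrite ler_expR; apply: ler_wpM2l; last exact: ltW.
          exact: mulr_ge0.
        by rewrite mulr1 -addrA lerDl; nonneg.
      apply: (@le_trans _ _ (c2 * expR ((t - del) * b ^+ 2 * x))).
        rewrite -expRD ler_expR.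
        have p0 : 0 <= del * b ^+ 2 by rewrite mulr_ge0// ltW.
        have := ler_wpM2l p0 (ltW xt'); lra.
      by rewrite lerDr; nonneg.
  rewrite ge0_integralD//; integrand_ge0; first last.
  - by apply/measurable_EFinP; apply: measurable_funM.
  - by apply/measurable_EFinP; apply: measurable_funD; apply: measurable_funM.
  rewrite ge0_integralD//; integrand_ge0; first last.
  - by apply/measurable_EFinP; apply: measurable_funM.
  - by apply/measurable_EFinP; apply: measurable_funM.
  rewrite !ge0_integralZl//; integrand_ge0; first last.
  - exact/measurable_EFinP.
  - exact/measurable_EFinP.
  - exact/measurable_EFinP.
  rewrite intGA !EFinD !EFinM.
  apply: leeD; [apply: leeD => //|]; apply: lee_wpmul2l => //;
    by rewrite lee_fin expR_ge0.
have V0 : 0 < V by exact: expR_gt0.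
have side x : x = b ^+ 2 * (t ^+ 2 / 2 - eta) - b ^+ 2 * del ^+ 2 / 4 ->
    expR x <= V / 8.
  move=> ->; rewrite expRD -/V ler_wpM2l ?expR_ge0// expRN.
  rewrite lef_pV2 ?posrE ?expR_gt0//; apply: le_trans (expR_ge1Dx _); lra.
have s1 : c1 * expR (b ^+ 2 * ((t + del) ^+ 2 / 2 + eta)) <= V / 8.
  by rewrite -expRD; apply: side; rewrite etaE; field.
have s2' : c2 * expR (b ^+ 2 * ((t - del) ^+ 2 / 2 + eta)) <= V / 8.
  by rewrite -expRD; apply: side; rewrite etaE; field.
have := le_trans lower bound; rewrite lee_fin -/V => key.
have cp : V / 4 <= c * p by lra.
have quarter : expR (- (b ^+ 2 * eta)) <= 4^-1.
  rewrite expRN lef_pV2 ?posrE ?expR_gt0//; apply: le_trans (expR_ge1Dx _).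
  by rewrite etaE; lra.
have c0 : 0 < c by exact: expR_gt0.
rewrite -(ler_pM2l c0); apply: le_trans cp.
have -> : c * expR (- (b ^+ 2 * (t ^+ 2 / 2 + t * del + 2 * eta))) =
    V * expR (- (b ^+ 2 * eta)).
  by rewrite -!expRD; congr expR; field.
by rewrite ler_wpM2l// ltW.
Qed.

End Fixed.

End ModerateDeviations.

(** * Moderate deviations of a general statistic *)

Section CloseStatistics.
Context {R : realType} (r h kappa u z : R).
Hypothesis r_gt0 : 0 < r.
Hypothesis kappaE : kappa * (r + 2) = h.
Hypothesis kappa_gt0 : 0 < kappa.
Hypothesis h_le1 : h <= 1.
Hypothesis zu : `|z - u| <= kappa * (1 + `|u|).

(** The value of [kappa] makes the error at most [h] when [`|u|] is near [r]. *)
Lemma close_ge : r + h <= u -> r <= `|z|.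
Proof.
move=> ru; have kr : 0 < kappa * r by exact: mulr_gt0.
have kE : kappa * r + kappa * 2 = h by rewrite -mulrDr.
have u0 : 0 <= u by move: kE ru kappa_gt0 r_gt0 kr; lra.
have k1 : 0 <= 1 - kappa by move: kE h_le1 kappa_gt0 kr; lra.
have kh : kappa * h <= kappa by rewrite ler_piMr// ltW.
move: zu; rewrite (ger0_norm u0) ler_norml => /andP[zl _].
apply: le_trans (ler_norm _); have := ler_wpM2l k1 ru; move: kE zl kh; lra.
Qed.

Lemma close_le : r <= `|z| -> r - h <= `|u|.
Proof.
move=> rz; rewrite leNgt; apply/negP => ur.
have kE : kappa * r + kappa * 2 = h by rewrite -mulrDr.
have h0 : 0 < h by rewrite -kappaE mulr_gt0// addr_gt0.
have kh : 0 < kappa * h by exact: mulr_gt0.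
have ku : kappa * `|u| <= kappa * (r - h) by rewrite ler_wpM2l// ltW.
have : `|z| <= `|z - u| + `|u| by rewrite -[X in `|X| <= _](subrK u) ler_normD.
move: zu kE kh ku rz ur kappa_gt0; lra.
Qed.

End CloseStatistics.

Section ModerateDeviationPrinciple.
Context {d : measure_display} {T : measurableType d} {R : realType}
  (P : probability T R) (xi : int -> {RV P >-> R})
  (s2 a C1 C2 J K : R) (Lam : R -> R).
Hypothesis xi_indep : mutually_independent xi.
Hypothesis xi_ident : identically_distributed xi.
Hypothesis nb : noise_bounds P (xi 0) s2 a C1 C2 J K Lam.

Implicit Types (theta b eps del eta kap t : R) (n : nat).
Local Notation U := (normalized_noise xi s2).

(** A statistic that differs from the normalized martingale by an arbitrarily
    small relative and absolute error on good events. *)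
Definition close_to_noise (Z : R -> R -> nat -> T -> R) := forall kappa, 0 < kappa ->
  exists2 eps0, 0 < eps0 & forall kap theta b n eps del w,
    regime kap theta b n -> 0 < eps <= eps0 -> 0 < del ->
    good xi s2 eps del theta b n w ->
    `|Z theta b n w - U theta b n w| <= kappa * (1 + `|U theta b n w|).

(** The window used for the lower bound is centered at [t = r + 2 h], so that it
    stays beyond [r] after the approximation error [kappa] of the statistic; for
    the upper bound the same error lowers the level to [r - h].  The step [h] is
    small enough for both changes to cost less than [eta] in the rate. *)
Lemma moderate_deviations (Z : R -> R -> nat -> T -> R) (r eta : R) :
  (forall theta b n, measurable_fun setT (Z theta b n)) -> close_to_noise Z ->
  0 < r -> 0 < eta ->
  exists2 kap, 1 <= kap & forall theta b n, regime kap theta b n ->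
    ((expR (- (b ^+ 2 * (r ^+ 2 / 2 + eta))))%:E <=
       P [set w | (r <= `|Z theta b n w|)%R] <=
     (expR (- (b ^+ 2 * (r ^+ 2 / 2 - eta))))%:E)%E.
Proof.
move=> mZ hZ r0 eta0.
have sum_ge (k1 k2 k3 k4 : R) : 0 <= k1 -> 0 <= k2 -> 0 <= k3 -> 0 <= k4 ->
    [/\ k1 <= k1 + k2 + k3 + k4, k2 <= k1 + k2 + k3 + k4,
        k3 <= k1 + k2 + k3 + k4 & k4 <= k1 + k2 + k3 + k4].
  by move=> ? ? ? ?; split; lra.
have three_le (y : R) : 4 <= y * eta -> 3 <= 1 + y * (eta / 2) by lra.
have s20 : 0 < s2 := nb_s2 nb; have a0 : 0 < a := nb_a nb.
have K0 : 0 <= K := nb_K nb; have C10 : 0 <= C1 := nb_C1 nb.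
pose L := 1 + 2 / r + 2 * (3 * r + 5) / eta.
have q1 : 0 <= 2 / r by nonneg.
have q2 : 0 <= 2 * (3 * r + 5) / eta by nonneg.
have L1 : 1 <= L by rewrite /L; lra.
have L0 : 0 < L by exact: lt_le_trans L1.
pose h := L^-1; have h0 : 0 < h by rewrite invr_gt0.
have h1 : h <= 1 by rewrite invf_le1.
have hr : h <= r / 2.
  rewrite -invf_div lef_pV2 ?posrE ?divr_gt0// /L; lra.
have heta : h * (3 * r + 5) <= eta / 2.
  rewrite mulrC ler_pdivrMr//.
  have : eta / 2 * (2 * (3 * r + 5) / eta) <= eta / 2 * L.
    by apply: ler_wpM2l; [nonneg|rewrite /L; lra].
  have -> // : eta / 2 * (2 * (3 * r + 5) / eta) = 3 * r + 5.
  by field; rewrite gt_eqF.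
have hh : h ^+ 2 <= h by rewrite expr2 ler_piMl// ltW.
have hh0 : 0 <= h ^+ 2 by exact: sqr_ge0.
have hr0 : 0 <= h * r by rewrite mulr_ge0// ltW.
pose kappa := h / (r + 2).
have r20 : 0 < r + 2 by rewrite addr_gt0.
have kappa0 : 0 < kappa by rewrite divr_gt0.
have kapE : kappa * (r + 2) = h by rewrite divfK// gt_eqF.
pose e := h ^+ 2 / 8; have e0 : 0 < e by rewrite divr_gt0// exprn_gt0.
pose t := r + 2 * h.
have t0 : 0 <= t by rewrite /t; lra.
have t_window : r + h <= t - h by rewrite /t; lra.
have t_le : `|t| <= r + 3 by rewrite /t ger0_norm; lra.
have t_le_up : `|t + h| <= r + 3 by rewrite /t ger0_norm; lra.
have t_le_down : `|t - h| <= r + 3 by rewrite /t ger0_norm; lra.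
have rh0 : 0 <= r - h by lra.
have rh_le : r - h <= r + 3 by lra.
have cost_low : t ^+ 2 / 2 + t * h + 2 * e <= r ^+ 2 / 2 + eta.
  have -> : t ^+ 2 / 2 + t * h + 2 * e =
     r ^+ 2 / 2 + 3 * (h * r) + (4 + 1 / 4) * h ^+ 2 by rewrite /t /e; field.
  by have := heta; rewrite mulrDr; lra.
have cost_up : r ^+ 2 / 2 - eta / 2 <= (r - h) ^+ 2 / 2 - e.
  have -> : (r - h) ^+ 2 / 2 - e = r ^+ 2 / 2 - h * r + 3 / 8 * h ^+ 2.
    by rewrite /e; field.
  by have := heta; rewrite mulrDr; lra.
have tm0 : 0 <= r + 3 by rewrite addr_ge0// ltW.
have [del del0 [eps1 eps10 hLam]] := good_Lam_ex nb e0 tm0.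
have [eps2 eps20 hclose] := hZ _ kappa0.
pose eps := Num.min eps1 eps2.
have eps0 : 0 < eps by rewrite lt_min eps10.
have eps1le : 0 < eps <= eps1 by rewrite eps0 ge_min lexx.
have eps2le : 0 < eps <= eps2 by rewrite eps0 ge_min lexx orbT.
pose C5 := 64 * C1 * K / s2 ^+ 2.
have D00 : 0 <= C5 * t ^+ 2 + 4.
  by apply: addr_ge0 => //; apply: mulr_ge0; [rewrite /C5; nonneg|exact: sqr_ge0].
pose D := C5 * t ^+ 2 + 4 + r ^+ 2 / 2.
have D0 : 0 <= D by rewrite /D addr_ge0// divr_ge0// sqr_ge0.
have [kG kG1 hG] := good_prob xi_indep xi_ident nb eps0 del0 D0.
have p1 : 0 <= 32 * K * t ^+ 2 / (a * s2 ^+ 2) by nonneg.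
have p2 : 0 <= 32 / h ^+ 2 by nonneg.
have p3 : 0 <= 4 / eta by nonneg.
have [kap [kap_good kap_tilt kap_window kap_eta]] : exists kap,
    [/\ kG <= kap, 32 * K * t ^+ 2 / (a * s2 ^+ 2) <= kap, 32 / h ^+ 2 <= kap
      & 4 / eta <= kap].
  exists (kG + 32 * K * t ^+ 2 / (a * s2 ^+ 2) + 32 / h ^+ 2 + 4 / eta).
  exact: sum_ge (le_trans ler01 kG1) p1 p2 p3.
exists kap; first exact: le_trans kap_good.
move=> theta b n reg.
have regG : regime kG theta b n by exact: regime_le reg.
have {hG}PG := hG _ _ _ regG.
set G := good xi s2 eps del theta b n in PG.
have mG : measurable G by exact: measurable_good.
have mGC : measurable (~` G) by exact: measurableC.
have w1 := regime_budget_ge1 reg; have w0 := le_trans ler01 w1.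
have bw := regime_sq_le reg.
have comp t' : `|t'| <= r + 3 -> forall w, G w ->
    `|ar_Lam xi theta Lam (tilt s2 theta b n t') n w - t' ^+ 2 / 2 * b ^+ 2|
      <= e * b ^+ 2.
  by move=> ht w Gw; apply: hLam reg eps1le Gw ht.
have near w : G w -> `|Z theta b n w - U theta b n w| <=
    kappa * (1 + `|U theta b n w|).
  by move=> Gw; apply: hclose reg eps2le del0 Gw.
have mU : measurable_fun setT (U theta b n) by exact: measurable_normalized_noise.
have mE : measurable [set w | r <= `|Z theta b n w|].
  rewrite -[X in measurable X]setTI; apply: measurable_fun_le => //.
  exact: (measurableT_comp (@normr_measurable _ setT)).
have mUge (f : T -> R) c : measurable_fun setT f -> measurable [set w | c <= f w].
  by move=> mf; rewrite -[X in measurable X]setTI; apply: measurable_fun_le.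
have kb : kap <= b ^+ 2.
  have [k1 _ _ kb _] := reg; apply: le_trans kb _.
  by rewrite expr2 ler_peMr// ?(regime_b_ge1 reg)// (le_trans ler01)// (regime_b_ge1 reg).
have b20 : 0 <= b ^+ 2 by exact: sqr_ge0.
apply/andP; split.
- have low : (expR (- (b ^+ 2 * (r ^+ 2 / 2 + eta))) <=
      expR (- (b ^+ 2 * (t ^+ 2 / 2 + t * h + 2 * e))))%R.
    rewrite ler_expR lerN2; apply: ler_wpM2l => //.
  apply: (@le_trans _ _ (expR (- (b ^+ 2 * (t ^+ 2 / 2 + t * h + 2 * e))))%:E) => //.
  apply: (@le_trans _ _ (P (G `&` [set w | t - h <= U theta b n w]%R))).
    apply: (normalized_lower xi_indep xi_ident nb reg mG t0 h0 erefl).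
    + exact: comp.
    + exact: comp.
    + exact: comp.
    + exact: kap_tilt.
    + exact: kap_window.
    + apply: le_trans PG _; rewrite lee_fin ler_expR lerN2 -/C5.
      by apply: ler_wpM2r => //; rewrite /D lerDl divr_ge0// sqr_ge0.
  apply: le_measure; rewrite ?inE//.
    by apply: measurableI => //; exact: mUge.
  move=> w [Gw /= Uw]; apply: (close_ge r0 kapE kappa0 h1 (near _ Gw)).
  exact: le_trans t_window Uw.
- set A1 := G `&` [set w | r - h <= 1 * U theta b n w].
  set A2 := G `&` [set w | r - h <= - 1 * U theta b n w].
  have mA1 : measurable A1.
    by apply: measurableI => //; apply: mUge; apply: measurable_funM.
  have mA2 : measurable A2.
    by apply: measurableI => //; apply: mUge; apply: measurable_funM.
  pose B := expR (- (b ^+ 2 * (r ^+ 2 / 2 - eta / 2))).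
  have side : (expR (- (b ^+ 2 * ((r - h) ^+ 2 / 2 - e))) <= B)%R.
    rewrite /B ler_expR lerN2; apply: ler_wpM2l => //.
  have PA1 : (P A1 <= B%:E)%E.
    apply: (@le_trans _ _ (expR (- (b ^+ 2 * ((r - h) ^+ 2 / 2 - e))))%:E) => //.
    apply: (normalized_upper xi_indep xi_ident nb reg mG) => //; first by rewrite normr1.
    by apply: comp; rewrite mul1r ger0_norm.
  have PA2 : (P A2 <= B%:E)%E.
    apply: (@le_trans _ _ (expR (- (b ^+ 2 * ((r - h) ^+ 2 / 2 - e))))%:E) => //.
    apply: (normalized_upper xi_indep xi_ident nb reg mG) => //; first by rewrite normrN normr1.
    by apply: comp; rewrite mulN1r normrN ger0_norm.
  have PGB : (P (~` G) <= B%:E)%E.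
    apply: le_trans PG _; rewrite lee_fin /B ler_expR lerN2.
    apply: (@le_trans _ _ (b ^+ 2 * (r ^+ 2 / 2))).
      by apply: ler_wpM2l => //; rewrite gerBl divr_ge0// ltW.
    apply: (@le_trans _ _ (budget theta b * (r ^+ 2 / 2))).
      by apply: ler_wpM2r => //; rewrite divr_ge0// sqr_ge0.
    by rewrite [leLHS]mulrC; apply: ler_wpM2r => //; rewrite /D lerDr.
  apply: (@le_trans _ _ (P (~` G `|` (A1 `|` A2)))).
    apply: le_measure; rewrite ?inE//.
      by apply: measurableU => //; exact: measurableU.
    move=> w /= rw; have [Gw|] := pselect (G w); last by left.
    right; have := close_le r0 kapE kappa0 (near _ Gw) rw.
    rewrite ler_normr => /orP[Ur|Ur]; [left|right]; split => //=.
      by rewrite mul1r.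
    by rewrite mulN1r.
  apply: (@le_trans _ _ (B%:E + (B%:E + B%:E))%E).
    apply: le_trans (measureU2 _ _ _) _ => //; first exact: measurableU.
    apply: leeD => //.
    by apply: le_trans (measureU2 _ _ _) _ => //; exact: leeD.
  rewrite -!EFinD lee_fin.
  have -> : expR (- (b ^+ 2 * (r ^+ 2 / 2 - eta))) = B * expR (b ^+ 2 * (eta / 2)).
    by rewrite -expRD; congr expR; field.
  have e3 : 3 <= expR (b ^+ 2 * (eta / 2)).
    apply: le_trans (expR_ge1Dx _).
    have : 4 / eta <= b ^+ 2 by exact: le_trans kb.
    by rewrite ler_pdivrMr//; exact: three_le.
  have B0 : 0 <= B by exact: expR_ge0.
  apply: le_trans (ler_wpM2l B0 e3); rewrite le_eqVlt; apply/orP; left; apply/eqP; ring.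
Qed.

End ModerateDeviationPrinciple.

(** * The two estimators *)

Section Estimators.
Context {d : measure_display} {T : measurableType d} {R : realType}
  (P : probability T R) (xi : int -> {RV P >-> R}) (s2 : R).
Hypothesis s20 : 0 < s2.

Implicit Types (theta b eps del eta kap : R) (n : nat).
Local Notation U := (normalized_noise xi s2).
Local Notation ar := (ar xi).

Lemma arS theta k w : ar theta k.+1 w = theta * ar theta k w + xi (k%:Z + 1) w.
Proof. by []. Qed.

Lemma least_squaresE theta n w :
  least_squares (ar theta) n w =
  (theta * ar_squares xi theta n w + ar_noise xi theta n w) / ar_squares xi theta n w.
Proof.
rewrite /least_squares !big_add1/=; congr (_ / _).
rewrite /ar_squares /ar_noise big_distrr/= -big_split/=.
by apply: eq_bigr => k _; rewrite arS; ring.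
Qed.

Lemma yule_walkerE theta n w :
  yule_walker (ar theta) n w =
  (theta * ar_squares xi theta n w + ar_noise xi theta n w) /
  (ar_squares xi theta n w + ar theta n w ^+ 2).
Proof.
rewrite /yule_walker big_add1/= big_nat_recr//=; congr (_ / _).
rewrite /ar_squares /ar_noise big_distrr/= -big_split/=.
by apply: eq_bigr => k _; rewrite arS; ring.
Qed.

(** Inversion of a nonnegative number is the power of exponent -1, also at 0. *)
Lemma measurable_ratio (f g : T -> R) : measurable_fun setT f ->
  measurable_fun setT g -> (forall w, 0 <= g w) ->
  measurable_fun setT (fun w => f w / g w).
Proof.
move=> mf mg g0; apply: measurable_funM => //.
have -> : (fun w => (g w)^-1) = (fun w => g w `^ (- 1)).
  by apply/funext => w; rewrite powR_inv1.
exact: (measurableT_comp (@measurable_powR R (- 1))).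
Qed.

Lemma measurable_least_squares (X : nat -> T -> R) n :
  (forall k, measurable_fun setT (X k)) -> measurable_fun setT (least_squares X n).
Proof.
move=> mX; apply: measurable_ratio.
- by apply: measurable_sum => k; exact: measurable_funM.
- by apply: measurable_sum => k; exact: measurable_funX.
- by move=> w; apply: sumr_ge0 => k _; exact: sqr_ge0.
Qed.

Lemma measurable_yule_walker (X : nat -> T -> R) n :
  (forall k, measurable_fun setT (X k)) -> measurable_fun setT (yule_walker X n).
Proof.
move=> mX; apply: measurable_ratio.
- by apply: measurable_sum => k; exact: measurable_funM.
- by apply: measurable_sum => k; exact: measurable_funX.
- by move=> w; apply: sumr_ge0 => k _; exact: sqr_ge0.
Qed.

Definition error_scale theta b n : R :=
  Num.sqrt n%:R / (b * Num.sqrt (1 - theta ^+ 2)).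

(** [E] is the boundary term of the numerator and [Den] the sum of squares in the
    denominator, which divided by its limit is close to 1. *)
Lemma ratio_close kap theta b n eps kappa (M E Den Un : R) :
  regime kap theta b n -> 0 < eps -> 0 < kappa -> 6 * eps * (1 + kappa) <= kappa * s2 ->
  Un = M * Num.sqrt (1 - theta ^+ 2) / (Num.sqrt n%:R * s2 * b) ->
  `|(1 - theta ^+ 2) * Den - n%:R * s2| <= 6 * eps * n%:R ->
  0 <= E <= eps * (b * Num.sqrt n%:R / Num.sqrt (1 - theta ^+ 2)) ->
  `|error_scale theta b n * ((M - E) / Den) - Un| <= kappa * (1 + `|Un|).
Proof.
move=> reg eps0 kappa0 hk UE hD /andP[E0 hE].
have n0 : 0 < n%:R :> R by rewrite ltr0n (regime_n_gt0 reg).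
have r0 := regime_rho_gt0 reg.
have v0 : 0 < 1 - theta ^+ 2 by have /andP[v1 _] := regime_v reg; exact: lt_le_trans v1.
have b0 : 0 < b by exact: lt_le_trans (regime_b_ge1 reg).
move: UE hD hE; rewrite /error_scale.
set q := Num.sqrt (1 - theta ^+ 2); set N := Num.sqrt n%:R.
have vq : 1 - theta ^+ 2 = q ^+ 2 by rewrite sqr_sqrtr// ltW.
have nN : n%:R = N ^+ 2 by rewrite sqr_sqrtr// ltW.
have q0 : 0 < q by rewrite sqrtr_gt0.
have N0 : 0 < N by rewrite sqrtr_gt0.
rewrite vq nN => UE hD hE.
set x := q ^+ 2 * Den / N ^+ 2.
set y := E * q / (b * N).
have y0 : 0 <= y by rewrite /y; nonneg.
have ye : y <= eps.
  rewrite /y ler_pdivrMr ?mulr_gt0//.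
  by move: hE; rewrite mulrA ler_pdivlMr// => /le_trans; apply; rewrite mulrA.
have xs : `|x - s2| <= 6 * eps.
  have -> : x - s2 = (q ^+ 2 * Den - N ^+ 2 * s2) / N ^+ 2.
    by rewrite /x; field; rewrite gt_eqF.
  by rewrite normrM normfV (gtr0_norm (exprn_gt0 2 N0)) ler_pdivrMr ?exprn_gt0.
have e6 : 6 * eps < s2.
  rewrite -(ltr_pM2l kappa0); apply: lt_le_trans hk; lra.
have x0 : 0 < x by move: xs; rewrite ler_norml => /andP[]; lra.
have Den0 : Den != 0.
  by apply/eqP => D0; move: x0; rewrite /x D0 mulr0 mul0r ltxx.
(* [x] is the ratio of the denominator to [n / (1 - theta^2)], close to [s2] *)
have -> : N / (b * q) * ((M - E) / Den) - Un = ((s2 - x) * Un - y) / x.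
  rewrite UE /y /x; field.
  by rewrite Den0 !gt_eqF.
rewrite normrM normfV (gtr0_norm x0) ler_pdivrMr//.
apply: (@le_trans _ _ (6 * eps * (1 + `|Un|))).
  apply: le_trans (ler_normB _ _) _; rewrite normrM (ger0_norm y0) distrC.
  have := ler_wpM2r (normr_ge0 Un) xs; lra.
rewrite [leRHS]mulrAC; apply: ler_wpM2r; first by rewrite addr_ge0.
have : kappa * (s2 - 6 * eps) <= kappa * x.
  apply: ler_wpM2l; first exact: ltW.
  by move: xs; rewrite ler_norml => /andP[]; lra.
lra.
Qed.

Let closeness kappa : 0 < kappa -> exists2 eps0, 0 < eps0 & forall eps,
  0 < eps <= eps0 -> 6 * eps * (1 + kappa) <= kappa * s2.
Proof.
move=> k0; have k1 : 0 < 6 * (1 + kappa) by rewrite mulr_gt0// addr_gt0.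
exists (kappa * s2 / (6 * (1 + kappa))); first by rewrite divr_gt0// mulr_gt0.
by move=> eps /andP[_]; rewrite ler_pdivlMr// => h; lra.
Qed.

Lemma least_squares_close : close_to_noise xi s2 (fun theta b n w =>
  error_scale theta b n * (least_squares (ar theta) n w - theta)).
Proof.
move=> kappa k0; have [eps0 eps00 heps] := closeness k0.
exists eps0 => // kap theta b n eps del w reg /[dup] /heps hk /andP[e0 _] del0 gw.
have n0 : 0 < n%:R :> R by rewrite ltr0n (regime_n_gt0 reg).
have hS := good_squares reg e0 gw.
have e6 : 6 * eps < s2.
  rewrite -(ltr_pM2l k0); apply: lt_le_trans hk; rewrite -subr_gt0.
  have : 0 < eps * kappa by exact: mulr_gt0.
  lra.
have S0 : ar_squares xi theta n w != 0.
  apply/eqP => S0; move: hS; rewrite S0 mulr0 sub0r normrN gtr0_norm ?mulr_gt0//.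
  rewrite [leLHS]mulrC ler_pM2r//; lra.
have -> : least_squares (ar theta) n w - theta =
    (ar_noise xi theta n w - 0) / ar_squares xi theta n w.
  by rewrite least_squaresE; field.
apply: (ratio_close reg e0 k0 hk) => //.
- by apply: le_trans hS _; rewrite ler_wpM2r// ?(ltW n0)//; lra.
- rewrite lexx/=.
  have b0 : 0 < b by exact: lt_le_trans (regime_b_ge1 reg).
  by nonneg.
Qed.

(** The Yule-Walker denominator has the additional last square, which adds
    [theta] times that square to the error in the numerator. *)
Lemma yule_walker_close : close_to_noise xi s2 (fun theta b n w =>
  error_scale theta b n * (yule_walker (ar theta) n w - theta)).
Proof.
move=> kappa k0; have [eps0 eps00 heps] := closeness k0.
exists eps0 => // kap theta b n eps del w reg /[dup] /heps hk /andP[e0 _] del0 gw.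
have n0 : 0 < n%:R :> R by rewrite ltr0n (regime_n_gt0 reg).
have hS := good_squares reg e0 gw.
have r0 := regime_rho_gt0 reg.
have v0 : 0 < 1 - theta ^+ 2 by have /andP[v1 _] := regime_v reg; exact: lt_le_trans v1.
have v1 : 1 - theta ^+ 2 <= 1 by rewrite gerBl sqr_ge0.
have [_ /andP[t0 t1] _ _ _] := reg.
have [[[[[_ _] _] Xn] Xn'] _] := gw.
have {}Xn : ar theta n w ^+ 2 <= eps * n%:R := Xn.
have {}Xn' : ar theta n w ^+ 2 <=
  eps * (b * Num.sqrt n%:R / Num.sqrt (1 - theta ^+ 2)) := Xn'.
have X0 : 0 <= ar theta n w ^+ 2 := sqr_ge0 _.
set S := ar_squares xi theta n w in hS *.
have vX : 0 <= (1 - theta ^+ 2) * ar theta n w ^+ 2 <= eps * n%:R.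
  rewrite mulr_ge0// ?(ltW v0)//=; apply: le_trans Xn.
  by rewrite ler_piMl.
have hD : `|(1 - theta ^+ 2) * (S + ar theta n w ^+ 2) - n%:R * s2| <= 6 * eps * n%:R.
  rewrite mulrDr; move: hS vX; rewrite !ler_norml => /andP[h1 h2] /andP[h3 h4].
  by apply/andP; split; lra.
have e6 : 6 * eps < s2.
  rewrite -(ltr_pM2l k0); apply: lt_le_trans hk; rewrite -subr_gt0.
  have : 0 < eps * kappa by exact: mulr_gt0.
  lra.
have S0 : S + ar theta n w ^+ 2 != 0.
  apply/eqP => S0; move: hD; rewrite S0 mulr0 sub0r normrN gtr0_norm ?mulr_gt0//.
  rewrite [leLHS]mulrC ler_pM2r//; lra.
have -> : yule_walker (ar theta) n w - theta =
    (ar_noise xi theta n w - theta * ar theta n w ^+ 2) / (S + ar theta n w ^+ 2).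
  by rewrite yule_walkerE -/S; field.
apply: (ratio_close reg e0 k0 hk) => //.
rewrite mulr_ge0//=; apply: le_trans Xn'.
by rewrite ler_piMl// ltW.
Qed.

End Estimators.

(** * Passage to the limit *)

Section LogarithmicLimit.
Context {R : realType}.

Lemma log_scale_limit (p : nat -> \bar R) (s : R^nat) (c : R) :
  (forall eta, 0 < eta -> \forall n \near \oo, 0 < s n /\
    ((expR (- (s n * (c + eta))))%:E <= p n <= (expR (- (s n * (c - eta))))%:E)%E) ->
  (((s n)^-1)%:E * lne (p n) @[n --> \oo] --> (- c)%:E)%E.
Proof.
move=> h.
have fin n eta : 0 < s n ->
    ((expR (- (s n * (c + eta))))%:E <= p n <= (expR (- (s n * (c - eta))))%:E)%E ->
    exists2 x, (((s n)^-1)%:E * lne (p n) = x%:E)%E & `|- c - x| <= eta.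
  move=> s0; case: (p n) => [q| |] /andP[] //; rewrite !lee_fin => ql qu.
  have q0 : 0 < q by apply: lt_le_trans ql; exact: expR_gt0.
  exists ((s n)^-1 * ln q); first by rewrite lne_EFin.
  have l1 : - (s n * (c + eta)) <= ln q.
    by rewrite -[leLHS]expRK ler_ln ?posrE ?expR_gt0.
  have l2 : ln q <= - (s n * (c - eta)).
    by rewrite -[leRHS]expRK ler_ln ?posrE ?expR_gt0.
  have u1 : - (c + eta) <= (s n)^-1 * ln q.
    by rewrite ler_pdivlMl// mulrN.
  have u2 : (s n)^-1 * ln q <= - (c - eta).
    by rewrite ler_pdivrMl// mulrN.
  by rewrite ler_norml; apply/andP; split; lra.
apply: cvg_EFin.
  have := h 1 ltr01; apply: filterS => n [s0 hn].
  by have [x -> _] := fin n 1 s0 hn.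
apply/cvgrPdist_le => eta eta0; have := h eta eta0; apply: filterS => n [s0 hn].
by have [x E hx] := fin n eta s0 hn; rewrite /= E.
Qed.

End LogarithmicLimit.

Section AlmostSureEquality.
Context {d : measure_display} {T : measurableType d} {R : realType}
  (P : probability T R).

Lemma le_prob_ae (A B : set T) : measurable A -> measurable B ->
  {ae P, forall w, A w -> B w} -> (P A <= P B)%E.
Proof.
move=> mA mB [N [mN PN hN]].
apply: (@le_trans _ _ (P (B `|` N))).
  apply: le_measure; rewrite ?inE//; first exact: measurableU.
  move=> w Aw; have [Bw|nB] := pselect (B w); first by left.
  by right; apply: hN => /= h; apply: nB; exact: h.
apply: le_trans (measureU2 _ _ _) _ => //; rewrite -[leRHS]adde0.
by apply: leeD => //; rewrite le_eqVlt; apply/orP; left; apply/eqP; exact: PN.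
Qed.

Lemma eq_prob_ae (A B : set T) : measurable A -> measurable B ->
  {ae P, forall w, A w <-> B w} -> P A = P B.
Proof.
move=> mA mB AB; apply/eqP; rewrite eq_le !le_prob_ae//.
  by apply: filterS AB => w [_ BA]; exact: BA.
by apply: filterS AB => w [AB _]; exact: AB.
Qed.

End AlmostSureEquality.

Lemma eventually_regime {R : realType} (theta b : R^nat) (kap : R) :
  (forall n : nat, (1 <= n)%N -> 0 <= theta n < 1) ->
  theta n @[n --> \oo] --> (1 : R) -> b n @[n --> \oo] --> +oo ->
  Num.sqrt n%:R * (1 - theta n) ^+ 2 / b n @[n --> \oo] --> +oo ->
  1 <= kap -> \forall n \near \oo, regime kap (theta n) (b n) n.
Proof.
move=> th01 th1 boo rate k1; have k0 : 0 < kap by exact: lt_le_trans k1.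
have hb : \forall n \near \oo, kap <= b n by move/cvgryPge : boo; apply.
have hr : \forall n \near \oo, kap <= Num.sqrt n%:R * (1 - theta n) ^+ 2 / b n.
  by move/cvgryPge : rate; apply.
have ki : 0 < kap^-1 by rewrite invr_gt0.
have ht : \forall n \near \oo, `|1 - theta n| <= kap^-1.
  by move/cvgrPdist_le : th1 => /(_ _ ki).
near=> n.
have n1 : (1 <= n)%N by near: n; exact: nbhs_infty_ge.
have bk : kap <= b n by near: n.
have b0 : 0 < b n by exact: lt_le_trans bk.
split => //.
- exact: th01.
- rewrite mulrC -ler_pdivlMr// div1r; apply: le_trans (ler_norm _) _; near: n; exact: ht.
- by rewrite -ler_pdivlMr//; near: n; exact: hr.
Unshelve. all: by end_near. Qed.

Theorem proposition2p1 (R : realType) (d : measure_display)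
    (T : measurableType d) (P : probability T R)
    (xi : int -> {RV P >-> R}) (theta b : nat -> R)
    (xi_indep : mutually_independent xi)
    (xi_ident : identically_distributed xi)
    (xi_mean : ('E_P[xi 0%R] = 0)%E)
    (xi_var : (0 < 'E_P[fun w => (xi 0 w ^+ 2)%R])%E)
    (xi_exp : exists2 alpha : R, 0 < alpha &
       ('E_P[fun w => (expR (alpha * xi 0 w ^+ 2))%R] < +oo)%E)
    (theta_range : forall n : nat, (1 <= n)%N -> 0 <= theta n < 1)
    (theta_cvg : theta n @[n --> \oo] --> (1 : R))
    (b_gt0 : forall n : nat, (1 <= n)%N -> 0 < b n)
    (b_cvg : b n @[n --> \oo] --> +oo)
    (rate_cvg :
       Num.sqrt n%:R * (1 - theta n) ^+ 2 / b n @[n --> \oo] --> +oo)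
    (r : R) (r_gt0 : 0 < r) :
  let X (n : nat) : nat -> T -> R := ar_process (theta n) xi in
  let scale (n : nat) : R :=
    Num.sqrt n%:R / (b n * Num.sqrt (1 - theta n ^+ 2)) in
  (((b n ^+ 2)^-1)%:E *
     lne (P [set w | (r <= scale n * `|least_squares (X n) n w - theta n|)%R])
     @[n --> \oo] --> (- (r ^+ 2 / 2))%:E)%E /\
  (((b n ^+ 2)^-1)%:E *
     lne (P [set w | (r <= scale n * `|yule_walker (X n) n w - theta n|)%R])
     @[n --> \oo] --> (- (r ^+ 2 / 2))%:E)%E.
Proof.
move=> X scale.
have [s2 [a [C1 [C2 [J [K [Lam nb]]]]]]] := noise_bounds_hold xi_mean xi_var xi_exp.
have s20 := nb_s2 nb.
have mX n k : measurable_fun setT (X n k).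
  exact: past_measurable_fun (@stationary_past _ _ _ _ xi (theta n) k%:Z).
(* Both estimators are functionals [F] of a path, so one argument serves for
   the two of them. *)
have main (F : (nat -> T -> R) -> nat -> T -> R) :
    (forall Y n, (forall k, measurable_fun setT (Y k)) -> measurable_fun setT (F Y n)) ->
    (forall Y Y' n w, (forall k, Y k w = Y' k w) -> F Y n w = F Y' n w) ->
    close_to_noise xi s2 (fun th bn n w =>
      error_scale th bn n * (F (ar xi th) n w - th)) ->
    (((b n ^+ 2)^-1)%:E *
     lne (P [set w | (r <= scale n * `|F (X n) n w - theta n|)%R])
     @[n --> \oo] --> (- (r ^+ 2 / 2))%:E)%E.
  move=> mF extF closeF; apply: log_scale_limit => eta eta0.
  have mZ th bn n : measurable_fun setT (fun w =>
      error_scale th bn n * (F (ar xi th) n w - th)).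
    apply: measurable_funM => //; apply: measurable_funB => //; apply: mF => k.
    exact: measurable_ar.
  have [kap k1 hkap] :=
    moderate_deviations xi_indep xi_ident nb mZ closeF r_gt0 eta0.
  have := eventually_regime theta_range theta_cvg b_cvg rate_cvg k1.
  apply: filterS => n reg.
  have b0 : 0 < b n by exact: lt_le_trans (regime_b_ge1 reg).
  split; first by rewrite exprn_gt0.
  have [_ th01 _ _ _] := reg.
  rewrite (@eq_prob_ae _ _ _ _ _
    [set w | r <= `|error_scale (theta n) (b n) n *
                    (F (ar xi (theta n)) n w - theta n)|]); first exact: hkap.
  - rewrite -[X in measurable X]setTI; apply: measurable_fun_le => //.
    apply: measurable_funM => //; apply: (measurableT_comp (@normr_measurable _ setT)).
    by apply: measurable_funB => //; exact: mF.
  - rewrite -[X in measurable X]setTI; apply: measurable_fun_le => //.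
    exact: (measurableT_comp (@normr_measurable _ setT)).
  have := ar_eq_process xi_ident th01 nb; apply: filterS => w hw /=.
  rewrite (extF (X n) (ar xi (theta n)) n w)//.
  rewrite normrM (ger0_norm (_ : 0 <= error_scale _ _ _))//.
  by rewrite /error_scale; nonneg.
split; apply: main.
- exact: measurable_least_squares.
- by move=> Y Y' n w YY; rewrite /least_squares; congr (_ / _);
    apply: eq_bigr => k _; rewrite !YY.
- exact: least_squares_close.
- exact: measurable_yule_walker.
- by move=> Y Y' n w YY; rewrite /yule_walker; congr (_ / _);
    apply: eq_bigr => k _; rewrite !YY.
- exact: yule_walker_close.
Qed.
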